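(* Let $\Phi\subset\mathbb{R}^n$ be a root system with affine Weyl group $\widetilde W_\Phi$, let $\Psi_\Phi:\mathbb{C}^n\to\mathbb{C}^n$ be its generalized cosine, let $\mathcal{H}_\Phi\subset\mathbb{C}^n$ be its complex Cartan--Stiefel diagram, and let $\mathcal{D}_\Phi=\Psi_\Phi(\mathcal{H}_\Phi)$. Then there is an exact sequence of groups $$0\longrightarrow \pi_1(\mathbb{C}^n\setminus\mathcal{H}_\Phi)\longrightarrow \pi_1(\mathbb{C}^n\setminus\mathcal{D}_\Phi)\longrightarrow \widetilde W_\Phi\longrightarrow 0,$$ where the map $\pi_1(\mathbb{C}^n\setminus\mathcal{H}_\Phi)\to\pi_1(\mathbb{C}^n\setminus\mathcal{D}_\Phi)$ is the injection $(\Psi_\Phi)_*$ and the map $\pi_1(\mathbb{C}^n\setminus\mathcal{D}_\Phi)\to\widetilde W_\Phi$ is the induced canonical projection.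
   Context: $\langle\cdot,\cdot\rangle$ is the standard inner product on $\mathbb{R}^n$, extended to $\mathbb{C}^n$ as a Hermitian form antilinear in the first variable and linear in the second. For nonzero $v\in\mathbb{C}^n$ and $\ell\in\mathbb{R}$, the complex reflection $\rho_{v,\ell}:\mathbb{C}^n\to\mathbb{C}^n$ is $\rho_{v,\ell}(x)=x-2\frac{\langle v,x\rangle-\ell}{\langle v,v\rangle}v$; its fixed-point set is the complex hyperplane $H_{v,\ell}=\{x\in\mathbb{C}^n:\langle v,x\rangle=\ell\}$. A root system of rank $n$ is a finite set $\Phi\subset\mathbb{R}^n$ such that: $\Phi$ spans $\mathbb{R}^n$; for $v\in\Phi$ and $\lambda\in\mathbb{R}$, $\lambda v\in\Phi$ iff $\lambda=\pm1$; $\rho_{v,0}(w)\in\Phi$ for all $v,w\in\Phi$; and $2\langle v,w\rangle/\langle v,v\rangle\in\mathbb{Z}$ for all $v,w\in\Phi$. The coroot of $v\in\Phi$ is $v^\vee=2v/\langle v,v\rangle$. The Weyl group $W_\Phi$ is generated by all $\rho_{v,0}$, $v\in\Phi$; the affine Weyl group $\widetilde W_\Phi$ is generated by all $\rho_{v,\ell}$, $v\in\Phi$, $\ell\in\mathbb{Z}$. Given a linear functional $\phi:\mathbb{R}^n\to\mathbb{R}$ vanishing on no element of $\Phi$, the positive roots are the $v\in\Phi$ with $\phi(v)>0$, and a positive root is simple if it is not a sum of two distinct positive roots. The simple roots form a basis $\alpha_1,\dots,\alpha_n$ of $\mathbb{R}^n$; the fundamental weights $\omega_1,\dots,\omega_n$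 are defined by $\langle\omega_j,\alpha_k^\vee\rangle=1$ if $j=k$ and $0$ otherwise. Fix a choice of fundamental weights for $\Phi$. For $1\le k\le n$ let $\psi_k(x)=\sum_{r\in W_\Phi\omega_k}\exp(2\pi i\langle r,x\rangle)$ for $x\in\mathbb{C}^n$, where $W_\Phi\omega_k$ is the orbit of $\omega_k$. The generalized cosine is $\Psi_\Phi=(\psi_1,\dots,\psi_n):\mathbb{C}^n\to\mathbb{C}^n$. The (complex) Cartan--Stiefel diagram is $\mathcal{H}_\Phi=\bigcup_{v\in\Phi,\,\ell\in\mathbb{Z}}H_{v,\ell}$. The restriction of $\Psi_\Phi$ to $\mathcal{Y}=\mathbb{C}^n\setminus\mathcal{H}_\Phi$ is a regular covering of $\mathcal{X}=\mathbb{C}^n\setminus\mathcal{D}_\Phi$ with deck transformation group $\mathrm{Gal}(\mathcal{Y}/\mathcal{X})=\widetilde W_\Phi$; the ''induced canonical projection'' is the quotient map $\pi_1(\mathcal{X})\to\pi_1(\mathcal{X})/(\Psi_\Phi)_*(\pi_1(\mathcal{Y}))\cong\mathrm{Gal}(\mathcal{Y}/\mathcal{X})=\widetilde W_\Phi$. Basepoints $y_0\in\mathcal{Y}$ and $x_0=\Psi_\Phi(y_0)\in\mathcal{X}$ are used. *)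

(* Defs.v *)
From HB Require Import structures.
From mathcomp Require Import all_boot all_order all_algebra finmap generic_quotient.
From mathcomp Require Import ring lra.
From mathcomp Require Import all_classical all_reals all_analysis.
From mathcomp Require Import homotopy complex.

Set Implicit Arguments.
Unset Strict Implicit.
Unset Printing Implicit Defensive.

Import Order.TTheory GRing.Theory Num.Theory.
Import numFieldNormedType.Exports.

Local Open Scope classical_set_scope.
Local Open Scope ring_scope.


Record bijection (T : Type) := Bijection {
  bij_fun :> T -> T;
  bij_inv : T -> T;
  bij_funK : cancel bij_fun bij_inv;
  bij_invK : cancel bij_inv bij_fun }.

Lemma bijectionP (T : Type) (f g : bijection T) : f =1 g -> f = g.
Proof.
case: f g => [f f' fK f'K] [g g' gK g'K] /= fg.
have efg : f = g by apply: funext.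
subst g; have ef'g' : f' = g' by apply: funext => x; rewrite -{2}(f'K x) gK.
by subst g'; congr Bijection; exact: Prop_irrelevance.
Qed.

HB.instance Definition _ (T : Type) := gen_eqMixin (bijection T).
HB.instance Definition _ (T : Type) := gen_choiceMixin (bijection T).

Section BijectionGroup.
Variable T : Type.
Implicit Types f g h : bijection T.

Definition bij_one : bijection T := @Bijection T id id (frefl _) (frefl _).

Definition bij_opp f : bijection T := Bijection (bij_invK f) (bij_funK f).

Definition bij_comp f g : bijection T :=
  Bijection (can_comp (bij_funK f) (bij_funK g))
            (can_comp (bij_invK g) (bij_invK f)).

Lemma bij_compA : associative bij_comp.
Proof. by move=> f g h; apply: bijectionP. Qed.
Lemma bij_comp1f : left_id bij_one bij_comp.
Proof. by move=> f; apply: bijectionP. Qed.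
Lemma bij_compf1 : right_id bij_one bij_comp.
Proof. by move=> f; apply: bijectionP. Qed.
Lemma bij_compVf : left_inverse bij_one bij_opp bij_comp.
Proof. by move=> f; apply: bijectionP => x /=; rewrite bij_funK. Qed.
Lemma bij_compfV : right_inverse bij_one bij_opp bij_comp.
Proof. by move=> f; apply: bijectionP => x /=; rewrite bij_invK. Qed.

HB.instance Definition _ := isGroup.Build (bijection T)
  bij_compA bij_comp1f bij_compf1 bij_compVf bij_compfV.

End BijectionGroup.

Definition generated_group (G : groupType) (S : set G) : set G :=
  smallest [set H : set G | group_closed (mem H)] S.

Lemma generated_group_closed (G : groupType) (S : set G) :
  group_closed (mem (generated_group S)).
Proof.
split; first by apply/mem_set => H [[H1 _] _]; exact/set_mem.
move=> u v /set_mem Su /set_mem Sv; apply/mem_set => H [[H1 HV] SH].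
by apply/set_mem/HV; apply/mem_set; [apply: Su|apply: Sv].
Qed.

Definition generated (G : groupType) (S : set G) : Type := generated_group S.

HB.instance Definition _ (G : groupType) (S : set G) :=
  SubChoice.on (generated S).
HB.instance Definition _ (G : groupType) (S : set G) :=
  SubChoice_isSubGroup.Build G (mem (generated_group S)) (generated S)
    (generated_group_closed S).

HB.instance Definition _ (R : realType) := PseudoPointedMetric.copy R[i] R[i]^o.

Definition unit_interval (R : realType) : Type := (`[0, 1]%classic : set R).

HB.instance Definition _ (R : realType) := Topological.on (unit_interval R).

Section UnitInterval.
Variable R : realType.
Local Notation I := (unit_interval R).

Definition clamp (x : R) : R := Num.max 0 (Num.min 1 x).

Lemma clamp_itv x : clamp x \in (`[0, 1]%classic : set R).
Proof.
apply/mem_set; rewrite /= in_itv /= /clamp.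
by rewrite le_max lexx ge_max ler01 ge_min lexx.
Qed.

Definition to_unit (x : R) : I := exist _ (clamp x) (clamp_itv x).

Definition of_unit (t : I) : R := val t.

Lemma of_unit_itv (t : I) : 0 <= of_unit t <= 1.
Proof. by case: t => t ht; have := set_mem ht; rewrite /= in_itv. Qed.

Lemma to_unitK x : 0 <= x <= 1 -> of_unit (to_unit x) = x.
Proof.
by case/andP=> x0 x1; rewrite /of_unit /= /clamp (min_idPr x1) (max_idPr x0).
Qed.

Lemma of_unitK : cancel of_unit to_unit.
Proof. by move=> t; apply: val_inj; exact: to_unitK (of_unit_itv t). Qed.

Lemma continuous_of_unit : continuous of_unit.
Proof. exact: initial_continuous. Qed.

Lemma continuous_to_unit : continuous to_unit.
Proof.
apply: continuous_comp_initial => x.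
apply: (@continuous_max R R (cst 0)); first exact: cvg_cst.
by apply: (@continuous_min R R (cst 1)); [exact: cvg_cst | exact: cvg_id].
Qed.

Lemma to_unit01 : to_unit 0 != to_unit 1.
Proof.
apply/eqP => /(congr1 of_unit); rewrite !to_unitK ?lexx ?ler01 //.
by move/eqP; rewrite eq_sym oner_eq0.
Qed.

HB.instance Definition _ := isBiPointed.Build I to_unit01.

Lemma to_unit0 : to_unit 0 = zero. Proof. by []. Qed.
Lemma to_unit1 : to_unit 1 = one. Proof. by []. Qed.
Lemma of_unit0 : of_unit zero = 0. Proof. by rewrite to_unitK ?lexx ?ler01. Qed.
Lemma of_unit1 : of_unit one = 1. Proof. by rewrite to_unitK ?lexx ?ler01. Qed.

End UnitInterval.

Lemma continuous_glue (R : realType) (S T : topologicalType) (g : S -> R)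
    (a : R) (f1 f2 : S -> T) :
    continuous g -> continuous f1 -> continuous f2 ->
    (forall s, g s = a -> f1 s = f2 s) ->
  continuous (fun s => if g s <= a then f1 s else f2 s).
Proof.
move=> cg cf1 cf2 f12 s U /= fU.
suff : \forall t \near s, U (if g t <= a then f1 t else f2 t) by [].
move: fU; have [sa|sa|sa] := ltgtP (g s) a => fU.
- have ga : \forall t \near s, g t < a by apply: (cvgr_lt (g s)) => //; exact: cg.
  have Uf : \forall t \near s, U (f1 t) by exact: cf1.
  by near=> t; rewrite ifT; [near: t | apply/ltW; near: t].
- have ga : \forall t \near s, g t > a by apply: (cvgr_gt (g s)) => //; exact: cg.
  have Uf : \forall t \near s, U (f2 t) by exact: cf2.
  by near=> t; rewrite ifF; [near: t | apply/negbTE; rewrite -ltNge; near: t].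
- have Uf1 : \forall t \near s, U (f1 t) by exact: cf1.
  have Uf2 : \forall t \near s, U (f2 t) by apply: cf2; rewrite -(f12 _ sa).
  by near=> t; case: ifP => _; near: t.
Unshelve. all: by end_near. Qed.

Lemma continuous_compT (S T U : topologicalType) (f : S -> T) (g : T -> U) :
  continuous f -> continuous g -> continuous (fun s => g (f s)).
Proof. by move=> cf cg s; exact: (@continuous_comp _ _ _ f g s (cf s) (cg (f s))). Qed.

Lemma continuous_pairT (S T U : topologicalType) (f : S -> T) (g : S -> U) :
  continuous f -> continuous g -> continuous (fun s => (f s, g s)).
Proof. by move=> cf cg s; apply: cvg_pair => /=; [exact: cf | exact: cg]. Qed.

Section Homotopy.
Variables (R : realType) (T : topologicalType).
Local Notation I := (unit_interval R).
Implicit Types x y z : T.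

Definition homotopic x y (p q : {path I from x to y}) : Prop :=
  exists H : I * I -> T,
    [/\ continuous H,
        forall t, H (t, zero) = p t, forall t, H (t, one) = q t,
        forall s, H (zero, s) = x & forall s, H (one, s) = y].

Lemma continuous_fst_unit : continuous (fun ts : I * I => of_unit ts.1).
Proof.
by apply: continuous_compT; [move=> ts; exact: cvg_fst|exact: continuous_of_unit].
Qed.

Lemma continuous_snd_unit : continuous (fun ts : I * I => of_unit ts.2).
Proof.
by apply: continuous_compT; [move=> ts; exact: cvg_snd|exact: continuous_of_unit].
Qed.

Lemma continuous_toP (S : topologicalType) (f : S -> R) :
  continuous f -> continuous (fun s => to_unit (f s)).
Proof.
by move=> cf; apply: continuous_compT; [exact: cf|exact: continuous_to_unit].
Qed.

Lemma continuous_pathP (S : topologicalType) x y (p : {path I from x to y})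
  (f : S -> R) : continuous f -> continuous (fun s => p (to_unit (f s))).
Proof.
move=> cf; apply: (continuous_compT (continuous_toP cf) (g := p)).
by move=> t; exact: cts_fun.
Qed.

Lemma reparam_homotopic x y z w (p : {path I from x to y})
    (a b : {path I from z to w}) (f g : R -> R) :
    continuous f -> continuous g -> f 0 = g 0 -> f 1 = g 1 ->
    (forall t, a t = p (to_unit (f (of_unit t)))) ->
    (forall t, b t = p (to_unit (g (of_unit t)))) ->
  homotopic a b.
Proof.
move=> cf cg fg0 fg1 aE bE.
exists (fun ts => p (to_unit ((1 - of_unit ts.2) * f (of_unit ts.1)
                              + of_unit ts.2 * g (of_unit ts.1)))); split=> /=.
- apply: continuous_pathP => ts; apply: cvgD; apply: cvgM.
  + by apply: cvgB; [exact: cvg_cst | exact: continuous_snd_unit].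
  + exact: (continuous_compT continuous_fst_unit cf).
  + exact: continuous_snd_unit.
  + exact: (continuous_compT continuous_fst_unit cg).
- by move=> t; rewrite of_unit0 subr0 mul1r mul0r addr0 aE.
- by move=> t; rewrite of_unit1 subrr mul0r mul1r add0r bE.
- move=> s; rewrite of_unit0 fg0 -mulrDl subrK mul1r.
  by rewrite -[RHS](path_zero (s := b)) bE of_unit0.
- move=> s; rewrite of_unit1 fg1 -mulrDl subrK mul1r.
  by rewrite -[RHS](path_one (s := b)) bE of_unit1.
Qed.

Lemma homotopic_refl x y (p : {path I from x to y}) : homotopic p p.
Proof.
apply: (@reparam_homotopic _ _ _ _ p p p id id) => // t;
  by [exact: cvg_id | rewrite of_unitK].
Qed.

Lemma homotopic_sym x y (p q : {path I from x to y}) :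
  homotopic p q -> homotopic q p.
Proof.
case=> H [cH H0 H1 Hx Hy].
exists (fun ts => H (ts.1, to_unit (1 - of_unit ts.2))); split=> //=.
- apply: (continuous_compT (f := fun ts : I * I => (ts.1, to_unit (1 - of_unit ts.2))) _ cH).
  apply: continuous_pairT; first by move=> ts; exact: cvg_fst.
  apply: (continuous_toP (f := fun ts : I * I => 1 - of_unit ts.2)) => us.
  by apply: cvgB; [exact: cvg_cst | exact: continuous_snd_unit].
- by move=> t; rewrite of_unit0 subr0 H1.
- by move=> t; rewrite of_unit1 subrr H0.
Qed.

Lemma homotopic_trans x y (p q r : {path I from x to y}) :
  homotopic p q -> homotopic q r -> homotopic p r.
Proof.
case=> H [cH H0 H1 Hx Hy] [K [cK K0 K1 Kx Ky]].
exists (fun ts => if of_unit ts.2 <= 2^-1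
                  then H (ts.1, to_unit (2 * of_unit ts.2))
                  else K (ts.1, to_unit (2 * of_unit ts.2 - 1))); split=> /=.
- apply: (continuous_glue continuous_snd_unit) => [||[t s] /= ->].
  + apply: (continuous_compT (f := fun ts : I * I => (ts.1, to_unit (2 * of_unit ts.2))) _ cH).
    apply: continuous_pairT; first by move=> ts; exact: cvg_fst.
    apply: (continuous_toP (f := fun ts : I * I => 2 * of_unit ts.2)) => us.
    by apply: cvgM; [exact: cvg_cst | exact: continuous_snd_unit].
  + apply: (continuous_compT (f := fun ts : I * I => (ts.1, to_unit (2 * of_unit ts.2 - 1))) _ cK).
    apply: continuous_pairT; first by move=> ts; exact: cvg_fst.
    apply: (continuous_toP (f := fun ts : I * I => 2 * of_unit ts.2 - 1)) => us.
    apply: cvgB; last exact: cvg_cst.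
    by apply: cvgM; [exact: cvg_cst | exact: continuous_snd_unit].
  + by rewrite divff ?pnatr_eq0 // subrr H1 K0.
- move=> t; rewrite of_unit0 mulr0 H0 ifT //; lra.
- move=> t; rewrite of_unit1 mulr1 ifF; last lra.
  by rewrite -[in RHS]K1; congr (K (t, to_unit _)); lra.
- by move=> s; case: ifP.
- by move=> s; case: ifP.
Qed.

Definition cat_fun (f g : I -> T) (t : I) : T :=
  if of_unit t <= 2^-1 then f (to_unit (2 * of_unit t))
  else g (to_unit (2 * of_unit t - 1)).

Lemma continuous_affine (a b : R) : continuous (fun t : R => a * t + b).
Proof.
move=> t; apply: cvgD; last exact: cvg_cst.
by apply: cvgM; [exact: cvg_cst | exact: cvg_id].
Qed.

Lemma continuous_affine_unit (a b : R) :
  continuous (fun t : I => a * of_unit t + b).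
Proof.
exact: (continuous_compT (@continuous_of_unit R) (@continuous_affine a b)).
Qed.

Lemma continuous_double : continuous (fun t : I => 2 * of_unit t).
Proof.
rewrite (_ : (fun _ => _) = (fun t : I => 2 * of_unit t + 0)).
  exact: continuous_affine_unit.
by apply/funext => t; rewrite addr0.
Qed.

Lemma continuous_double1 : continuous (fun t : I => 2 * of_unit t - 1).
Proof. exact: continuous_affine_unit. Qed.

Lemma continuous_revarg : continuous (fun t : I => 1 - of_unit t).
Proof.
rewrite (_ : (fun _ => _) = (fun t : I => - 1 * of_unit t + 1)).
  exact: continuous_affine_unit.
by apply/funext => t; rewrite mulN1r addrC.
Qed.

Lemma continuous_cat x y z (p : {path I from x to y}) (q : {path I from y to z}) :
  continuous (cat_fun p q).
Proof.
apply: (continuous_glue (@continuous_of_unit R)).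
- exact: (continuous_pathP (p := p) (@continuous_double)).
- exact: (continuous_pathP (p := q) (@continuous_double1)).
- move=> t ->; rewrite divff ?pnatr_eq0 // subrr.
  by rewrite to_unit0 to_unit1 path_zero path_one.
Qed.

Lemma cat_zero x y z (p : {path I from x to y}) (q : {path I from y to z}) :
  cat_fun p q zero = x.
Proof.
rewrite /cat_fun of_unit0 mulr0 ifT; first exact: path_zero.
by rewrite invr_ge0.
Qed.

Lemma cat_one x y z (p : {path I from x to y}) (q : {path I from y to z}) :
  cat_fun p q one = z.
Proof.
rewrite /cat_fun of_unit1 mulr1 ifF; last lra.
rewrite (_ : 2 - 1 = 1); [exact: path_one | lra].
Qed.

Definition path_cat x y z (p : {path I from x to y}) (q : {path I from y to z}) :
    {path I from x to z} :=
  mk_path (@continuous_cat x y z p q) (cat_zero p q) (cat_one p q).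

Lemma path_catE x y z (p : {path I from x to y}) (q : {path I from y to z}) t :
  path_cat p q t = if of_unit t <= 2^-1 then p (to_unit (2 * of_unit t))
                   else q (to_unit (2 * of_unit t - 1)).
Proof. by []. Qed.

Lemma continuous_rev x y (p : {path I from x to y}) :
  continuous (fun t : I => p (to_unit (1 - of_unit t))).
Proof. exact: (continuous_pathP (p := p) (@continuous_revarg)). Qed.

Lemma rev_zero x y (p : {path I from x to y}) :
  p (to_unit (1 - of_unit zero)) = y.
Proof. by rewrite of_unit0 subr0; exact: path_one. Qed.

Lemma rev_one x y (p : {path I from x to y}) :
  p (to_unit (1 - of_unit one)) = x.
Proof. by rewrite of_unit1 subrr; exact: path_zero. Qed.

Definition path_rev x y (p : {path I from x to y}) : {path I from y to x} :=
  mk_path (@continuous_rev x y p) (rev_zero p) (rev_one p).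

Lemma path_revE x y (p : {path I from x to y}) t :
  path_rev p t = p (to_unit (1 - of_unit t)).
Proof. by []. Qed.

Lemma path_cat_homotopic x y z (p p' : {path I from x to y})
    (q q' : {path I from y to z}) :
  homotopic p p' -> homotopic q q' -> homotopic (path_cat p q) (path_cat p' q').
Proof.
case=> H [cH H0 H1 Hx Hy] [K [cK K0 K1 Kx Ky]].
exists (fun ts => if of_unit ts.1 <= 2^-1
                  then H (to_unit (2 * of_unit ts.1), ts.2)
                  else K (to_unit (2 * of_unit ts.1 - 1), ts.2)); split=> /=.
- apply: (continuous_glue continuous_fst_unit) => [||[t s] /= ->].
  + apply: (continuous_compT (f := fun ts : I * I => (to_unit (2 * of_unit ts.1), ts.2)) _ cH).
    apply: continuous_pairT; last by move=> ts; exact: cvg_snd.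
    apply: (continuous_toP (f := fun ts : I * I => 2 * of_unit ts.1)) => us.
    by apply: cvgM; [exact: cvg_cst | exact: continuous_fst_unit].
  + apply: (continuous_compT (f := fun ts : I * I => (to_unit (2 * of_unit ts.1 - 1), ts.2)) _ cK).
    apply: continuous_pairT; last by move=> ts; exact: cvg_snd.
    apply: (continuous_toP (f := fun ts : I * I => 2 * of_unit ts.1 - 1)) => us.
    apply: cvgB; last exact: cvg_cst.
    by apply: cvgM; [exact: cvg_cst | exact: continuous_fst_unit].
  + by rewrite divff ?pnatr_eq0 // subrr to_unit0 to_unit1 Hy Kx.
- by move=> t; rewrite H0 K0.
- by move=> t; rewrite H1 K1.
- move=> s; rewrite of_unit0 mulr0 to_unit0 Hx ifT //; lra.
- move=> s; rewrite of_unit1 mulr1 ifF; last lra.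
  by rewrite -(Ky s); congr (K (to_unit _, s)); lra.
Qed.

Lemma path_rev_homotopic x y (p p' : {path I from x to y}) :
  homotopic p p' -> homotopic (path_rev p) (path_rev p').
Proof.
case=> H [cH H0 H1 Hx Hy].
exists (fun ts => H (to_unit (1 - of_unit ts.1), ts.2)); split=> /=.
- apply: (continuous_compT (f := fun ts : I * I => (to_unit (1 - of_unit ts.1), ts.2)) _ cH).
  apply: continuous_pairT; last by move=> ts; exact: cvg_snd.
  apply: (continuous_toP (f := fun ts : I * I => 1 - of_unit ts.1)) => us.
  by apply: cvgB; [exact: cvg_cst | exact: continuous_fst_unit].
- by move=> t; rewrite H0.
- by move=> t; rewrite H1.
- by move=> s; rewrite of_unit0 subr0 Hy.
- by move=> s; rewrite of_unit1 subrr Hx.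
Qed.

Lemma continuous_minfun (f g : R -> R) : continuous f -> continuous g ->
  continuous (fun t => Num.min (f t) (g t)).
Proof. by move=> cf cg t; exact: (@continuous_min R R f g t (cf t) (cg t)). Qed.

Lemma path_catA x y z w (p : {path I from x to y}) (q : {path I from y to z})
    (r : {path I from z to w}) :
  homotopic (path_cat p (path_cat q r)) (path_cat (path_cat p q) r).
Proof.
apply: (@reparam_homotopic _ _ _ _ (path_cat p (path_cat q r)) _ _ id
  (fun t => Num.min (2 * t + 0)
                    (Num.min (1 * t + 4^-1) (2^-1 * t + 2^-1)))).
- by move=> t; exact: cvg_id.
- apply: continuous_minfun; first exact: continuous_affine.
  by apply: continuous_minfun; exact: continuous_affine.
- by rewrite min_l; [lra | rewrite le_min; apply/andP; split; lra].
- rewrite min_r; last by rewrite ge_min; apply/orP; right; lra.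
  rewrite min_r; lra.
- by move=> t; rewrite of_unitK.
move=> t; have /andP[t0 t1] := of_unit_itv t.
rewrite path_catE; set u := of_unit t in t0 t1 *.
have [u2|u2] := leP u 2^-1.
  rewrite path_catE to_unitK; last by apply/andP; split; lra.
  have [u4|u4] := leP (2 * u) 2^-1.
    rewrite min_l; last by rewrite le_min; apply/andP; split; lra.
    rewrite path_catE to_unitK; last by apply/andP; split; lra.
    rewrite ifT; last lra.
    by congr (p (to_unit _)); lra.
  rewrite min_r; last by rewrite ge_min; apply/orP; left; lra.
  rewrite min_l; last lra.
  rewrite path_catE to_unitK; last by apply/andP; split; lra.
  rewrite ifF; last by apply/negbTE; rewrite -ltNge; lra.
  rewrite path_catE to_unitK; last by apply/andP; split; lra.
  rewrite ifT; last lra.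
  by congr (q (to_unit _)); lra.
rewrite min_r; last by rewrite ge_min; apply/orP; right; lra.
rewrite min_r; last lra.
rewrite path_catE to_unitK; last by apply/andP; split; lra.
rewrite ifF; last by apply/negbTE; rewrite -ltNge; lra.
rewrite path_catE to_unitK; last by apply/andP; split; lra.
rewrite ifF; last by apply/negbTE; rewrite -ltNge; lra.
by congr (r (to_unit _)); lra.
Qed.

Definition const_path x : {path I from x to x} := cst x.

Lemma path_cat1p x y (p : {path I from x to y}) :
  homotopic (path_cat (const_path x) p) p.
Proof.
apply: (@reparam_homotopic _ _ _ _ p _ _
  (fun t => - (Num.min (- 2 * t + 1) (0 * t + 0))) id).
- move=> t; apply: cvgN; move: t.
  by apply: continuous_minfun; exact: continuous_affine.
- by move=> t; exact: cvg_id.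
- by rewrite min_r; lra.
- by rewrite min_l; lra.
- move=> t; have /andP[t0 t1] := of_unit_itv t.
  rewrite path_catE; have [u2|u2] := leP (of_unit t) 2^-1.
    rewrite min_r; last lra.
    by rewrite mul0r addr0 oppr0; rewrite to_unit0 path_zero.
  by rewrite min_l; [congr (p (to_unit _)); lra | lra].
- by move=> t; rewrite of_unitK.
Qed.

Lemma path_catp1 x y (p : {path I from x to y}) :
  homotopic (path_cat p (const_path y)) p.
Proof.
apply: (@reparam_homotopic _ _ _ _ p _ _
  (fun t => Num.min (2 * t + 0) (0 * t + 1)) id).
- by apply: continuous_minfun; exact: continuous_affine.
- by move=> t; exact: cvg_id.
- by rewrite min_l; lra.
- by rewrite min_r; lra.
- move=> t; have /andP[t0 t1] := of_unit_itv t.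
  rewrite path_catE; have [u2|u2] := leP (of_unit t) 2^-1.
    by rewrite min_l; [congr (p (to_unit _)); lra | lra].
  rewrite min_r; last lra.
  by rewrite mul0r add0r to_unit1 path_one.
- by move=> t; rewrite of_unitK.
Qed.

Lemma path_catpV x y (p : {path I from x to y}) :
  homotopic (path_cat p (path_rev p)) (const_path x).
Proof.
apply: (@reparam_homotopic _ _ _ _ p _ _
  (fun t => Num.min (2 * t + 0) (- 2 * t + 2)) (cst 0)).
- by apply: continuous_minfun; exact: continuous_affine.
- by move=> t; exact: cvg_cst.
- by rewrite /= min_l; lra.
- by rewrite /= min_r; lra.
- move=> t; have /andP[t0 t1] := of_unit_itv t.
  rewrite path_catE !path_revE.
  have [u2|u2] := leP (of_unit t) 2^-1.
    by rewrite min_l; [congr (p (to_unit _)); lra | lra].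
  rewrite to_unitK; last by apply/andP; split; lra.
  by rewrite min_r; [congr (p (to_unit _)); lra | lra].
- by move=> t; rewrite /= to_unit0 path_zero.
Qed.

Lemma path_catVp x y (p : {path I from x to y}) :
  homotopic (path_cat (path_rev p) p) (const_path y).
Proof.
apply: (@reparam_homotopic _ _ _ _ p _ _
  (fun t => - (Num.min (2 * t + (-1)) (- 2 * t + 1))) (cst 1)).
- move=> t; apply: cvgN; move: t.
  by apply: continuous_minfun; exact: continuous_affine.
- by move=> t; exact: cvg_cst.
- by rewrite /= min_l; lra.
- by rewrite /= min_r; lra.
- move=> t; have /andP[t0 t1] := of_unit_itv t.
  rewrite path_catE !path_revE.
  have [u2|u2] := leP (of_unit t) 2^-1.
    rewrite to_unitK; last by apply/andP; split; lra.
    by rewrite min_l; [congr (p (to_unit _)); lra | lra].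
  by rewrite min_r; [congr (p (to_unit _)); lra | lra].
- by move=> t; rewrite /= to_unit1 path_one.
Qed.

End Homotopy.

Section FundamentalGroup.
Variables (R : realType) (T : topologicalType) (x : T).
Local Notation I := (unit_interval R).
Local Notation loop := {path I from x to x}.
Local Open Scope quotient_scope.

Definition homotopicb (p q : loop) : bool := `[< homotopic p q >].

Lemma homotopicb_refl : reflexive homotopicb.
Proof. by move=> p; apply/asboolP; exact: homotopic_refl. Qed.

Lemma homotopicb_sym : symmetric homotopicb.
Proof. by move=> p q; apply/asboolP/asboolP; exact: homotopic_sym. Qed.

Lemma homotopicb_trans : transitive homotopicb.
Proof.
by move=> p q r /asboolP qp /asboolP pr; apply/asboolP; exact: homotopic_trans pr.
Qed.

Canonical homotopic_equiv :=
  EquivRel homotopicb homotopicb_refl homotopicb_sym homotopicb_trans.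

Definition pi1 : Type := {eq_quot homotopic_equiv}.

HB.instance Definition _ := Choice.on pi1.
HB.instance Definition _ := Quotient.on pi1.

Definition pi1_class (p : loop) : pi1 := \pi_({eq_quot homotopic_equiv}) p.

Lemma pi1_classP (p q : loop) : pi1_class p = pi1_class q <-> homotopic p q.
Proof.
split=> [/(@eqquotP _ homotopic_equiv)/asboolP //|pq].
by apply/(@eqquotP _ homotopic_equiv)/asboolP.
Qed.

Lemma pi1_reprK (c : pi1) : pi1_class (repr c) = c.
Proof. exact: reprK. Qed.

Lemma pi1_ind (P : pi1 -> Prop) : (forall p, P (pi1_class p)) -> forall c, P c.
Proof. by move=> Pp c; rewrite -[c]pi1_reprK. Qed.

Definition pi1_mul (c d : pi1) : pi1 := pi1_class (path_cat (repr c) (repr d)).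
Definition pi1_one : pi1 := pi1_class (const_path R x).
Definition pi1_inv (c : pi1) : pi1 := pi1_class (path_rev (repr c)).

Lemma pi1_mulE (p q : loop) :
  pi1_mul (pi1_class p) (pi1_class q) = pi1_class (path_cat p q).
Proof.
by apply/pi1_classP; apply: path_cat_homotopic; apply/pi1_classP; exact: pi1_reprK.
Qed.

Lemma pi1_invE (p : loop) : pi1_inv (pi1_class p) = pi1_class (path_rev p).
Proof.
by apply/pi1_classP; apply: path_rev_homotopic; apply/pi1_classP; exact: pi1_reprK.
Qed.

Lemma pi1_mulA : associative pi1_mul.
Proof.
elim/pi1_ind => p; elim/pi1_ind => q; elim/pi1_ind => r; rewrite !pi1_mulE.
by apply/pi1_classP; exact: path_catA.
Qed.
Lemma pi1_mul1c : left_id pi1_one pi1_mul.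
Proof.
by elim/pi1_ind => p; rewrite pi1_mulE; apply/pi1_classP; exact: path_cat1p.
Qed.
Lemma pi1_mulc1 : right_id pi1_one pi1_mul.
Proof.
by elim/pi1_ind => p; rewrite pi1_mulE; apply/pi1_classP; exact: path_catp1.
Qed.
Lemma pi1_mulVc : left_inverse pi1_one pi1_inv pi1_mul.
Proof.
elim/pi1_ind => p; rewrite pi1_invE pi1_mulE; apply/pi1_classP.
exact: path_catVp.
Qed.
Lemma pi1_mulcV : right_inverse pi1_one pi1_inv pi1_mul.
Proof.
elim/pi1_ind => p; rewrite pi1_invE pi1_mulE; apply/pi1_classP.
exact: path_catpV.
Qed.

HB.instance Definition _ := isGroup.Build pi1
  pi1_mulA pi1_mul1c pi1_mulc1 pi1_mulVc pi1_mulcV.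

End FundamentalGroup.

Section InducedMap.
Variables (R : realType) (Y X : topologicalType) (f : continuousType Y X) (y : Y).
Local Notation I := (unit_interval R).

Definition path_image (a b : Y) (p : {path I from a to b}) :
  {path I from f a to f b} := f \o p.

Definition pi1_map (c : pi1 R y) : pi1 R (f y) := pi1_class (path_image (repr c)).

Lemma pi1_mapE (p : {path I from y to y}) :
  pi1_map (pi1_class p) = pi1_class (path_image p).
Proof.
apply/pi1_classP.
have /pi1_classP[H [cH H0 H1 Hx Hy]] := pi1_reprK (pi1_class p).
exists (f \o H); split=> /=; try by move=> t; rewrite ?H0 ?H1 ?Hx ?Hy.
by move=> t; apply: continuous_comp; [exact: cH | exact: cts_fun].
Qed.

Lemma pi1_mapM : {morph pi1_map : c d / (c * d)%g}.
Proof.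
elim/pi1_ind => p; elim/pi1_ind => q.
have -> : (pi1_class p * pi1_class q)%g = pi1_class (path_cat p q).
  exact: pi1_mulE.
rewrite !pi1_mapE; rewrite [RHS]pi1_mulE.
congr pi1_class; apply/path_eqP => t.
by rewrite path_catE /path_image /= /mk_path /cat_fun; case: ifP.
Qed.

HB.instance Definition _ :=
  isMultiplicative.Build (pi1 R y) (pi1 R (f y)) pi1_map pi1_mapM.

End InducedMap.

Arguments pi1_map R {Y X} f y c.

Record deck_transformation (Y X : topologicalType) (f : Y -> X)
    (g : bijection Y) : Prop := DeckTransformation {
  deck_continuous : continuous g;
  deck_inv_continuous : continuous (bij_inv g);
  deck_over : forall y, f (g y) = f y }.

Definition short_exact (A B C : groupType) (i : {multiplicative A -> B})
    (p : {multiplicative B -> C}) : Prop :=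
  [/\ injective i,
      (forall b, p b = 1%g <-> exists a, i a = b)
    & forall c, exists b, p b = c].

Section Vectors.
Variables (R : realType) (n : nat).
Local Open Scope complex_scope.

Definition dot (v w : 'rV[R]_n) : R := \sum_j v 0 j * w 0 j.

Definition cdot (x y : 'rV[R[i]]_n) : R[i] := \sum_j conjc (x 0 j) * y 0 j.

Definition cvec (v : 'rV[R]_n) : 'rV[R[i]]_n := map_mx (real_complex R) v.

(* for v = 0, excluded in the mathematical definition, this is the identity *)
Definition creflection (v : 'rV[R[i]]_n) (l : R) (x : 'rV[R[i]]_n) :
    'rV[R[i]]_n :=
  x - (2 * ((cdot v x - l%:C) / cdot v v)) *: v.

Lemma creflectionK v l : involutive (creflection v l).
Proof.
move=> x; rewrite /creflection; set c := 2 * _.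
have cdotBZ : cdot v (x - c *: v) = cdot v x - c * cdot v v.
  rewrite /cdot mulr_sumr -sumrB; apply: eq_bigr => j _; rewrite !mxE; ring.
rewrite cdotBZ -addrA -opprD -scalerDl.
suff -> : c + 2 * ((cdot v x - c * cdot v v - l%:C) / cdot v v) = 0.
  by rewrite scale0r subr0.
have [v0|v0] := eqVneq (cdot v v) 0.
  by rewrite /c v0 invr0 !mulr0 addr0.
by rewrite /c; field.
Qed.

Definition reflection (v : 'rV[R[i]]_n) (l : R) : bijection 'rV[R[i]]_n :=
  Bijection (creflectionK v l) (creflectionK v l).

Definition hyperplane (v : 'rV[R[i]]_n) (l : R) : set 'rV[R[i]]_n :=
  [set x | cdot v x = l%:C].

Definition cexp (z : R[i]) : R[i] :=
  let: a +i* b := z in (expR a * cos b) +i* (expR a * sin b).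

End Vectors.

Record root_system (R : realType) (n : nat) (Phi : {fset 'rV[R]_n}) : Prop :=
  RootSystem {
    roots_span : <<Phi>>%VS = fullv;
    roots_scale : forall (v : 'rV[R]_n) (a : R), v \in Phi ->
      (a *: v \in Phi) = (a == 1) || (a == - 1);
    roots_reflection : forall v w, v \in Phi -> w \in Phi ->
      exists2 u, u \in Phi & reflection (cvec v) 0 (cvec w) = cvec u;
    roots_integral : forall v w, v \in Phi -> w \in Phi ->
      2 * dot v w / dot v v \is a Num.int }.

Section RootSystems.
Variables (R : realType) (n : nat) (Phi : {fset 'rV[R]_n}).

Definition coroot (v : 'rV[R]_n) : 'rV[R]_n := (2 / dot v v) *: v.

Definition weyl_group : set (bijection 'rV[R[i]]_n) :=
  generated_group
    [set g | exists2 v, v \in Phi & g = reflection (cvec v) 0].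

Definition affine_weyl_group : groupType :=
  generated [set g : bijection 'rV[R[i]]_n |
    exists2 v, v \in Phi & exists l : int, g = reflection (cvec v) l%:~R].

Definition positive_root (phi : 'rV[R]_n -> R) (v : 'rV[R]_n) : Prop :=
  v \in Phi /\ 0 < phi v.

Definition simple_root (phi : 'rV[R]_n -> R) (v : 'rV[R]_n) : Prop :=
  positive_root phi v /\
  ~ exists u w, [/\ positive_root phi u, positive_root phi w, u != w
                  & v = u + w].

Definition fundamental_weights (omega : 'I_n -> 'rV[R]_n) : Prop :=
  exists (phi : {linear 'rV[R]_n -> R^o}) (alpha : 'I_n -> 'rV[R]_n),
    [/\ (forall v, v \in Phi -> phi v != 0),
        injective alpha,
        (forall v, simple_root phi v <-> exists k, v = alpha k)
      & forall j k, dot (omega j) (coroot (alpha k)) = (j == k)%:R].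

Definition cartan_stiefel : set 'rV[R[i]]_n :=
  \bigcup_(v in [set` Phi]) \bigcup_(l : int) hyperplane (cvec v) l%:~R.

Definition weyl_orbit (v : 'rV[R]_n) : set 'rV[R[i]]_n :=
  [set g (cvec v) | g in weyl_group].

Variable omega : 'I_n -> 'rV[R]_n.

Definition generalized_cosine (x : 'rV[R[i]]_n) : 'rV[R[i]]_n :=
  \row_k \sum_(r \in weyl_orbit (omega k))
    cexp (Complex 0 (2 * pi) * cdot r x).

Definition regular_points : set 'rV[R[i]]_n := ~` cartan_stiefel.

Definition regular_values : set 'rV[R[i]]_n :=
  ~` (generalized_cosine @` cartan_stiefel).

(* [p] sends the class of a loop to the element of the affine Weyl group that
   restricts to the deck transformation taking the base point to the end point
   of the lift of the loop *)
Definition canonical_projection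
    (F : continuousType regular_points regular_values) (y0 : regular_points)
    (p : pi1 R (F y0) -> affine_weyl_group) : Prop :=
  forall c : {path unit_interval R from F y0 to F y0},
  exists g : bijection regular_points,
    [/\ deck_transformation F g,
        (forall y, val (g y) = val (p (pi1_class c)) (val y))
      & exists l : {path unit_interval R from y0 to g y0},
          forall t, F (l t) = c t].

End RootSystems.

(* Main.v *)
(* The generalized cosine is invariant under the affine Weyl group, and once it
   is known to be a covering of its regular values by its regular points whose
   fibres are the orbits of that group, acting freely, the exact sequence is path
   lifting: the projection sends a loop to the g such that its lift from y0 ends
   at g y0.

   Freeness comes from the exchange argument for affine reflections. The rest
   is algebra of functions f on the weights. Given prescribed values c_k, a
   function with sum_{r in W omega_k} f(p + r) = c_k f(p) for all p and k is
   built by recursion on dominant weights. The product over r in W omega_k of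
   the differences (shift by omega_k) - (shift by r) vanishes, and averaging it
   over W gives a monic linear recurrence for such an f in direction omega_k,
   with coefficients depending only on c. Hence the shifts have a common
   eigenvector among these f: its eigenvalues are exp(2 i pi <omega_k, x>) for
   some x, and x is mapped to c, so the cosine is onto. The same recurrence
   bounds the exponentials in terms of c, so the cosine is proper modulo the
   group, and linear independence of characters identifies its fibres with
   orbits. Surjectivity, properness and this description of the fibres make
   the map open, without any Jacobian computation. *)

Require Import Defs.
From HB Require Import structures.
From mathcomp Require Import all_boot all_order all_algebra finmap.
From mathcomp Require Import zify ring lra.
From mathcomp Require Import all_classical all_reals all_analysis.
From mathcomp Require Import homotopy complex.

Set Implicit Arguments.
Unset Strict Implicit.
Unset Printing Implicit Defensive.

Import Order.TTheory GRing.Theory Num.Theory.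
Import numFieldNormedType.Exports.

Local Open Scope classical_set_scope.
Local Open Scope ring_scope.

(** * Root systems *)

(** The right end of the sequence needs an input of its own: the projection is onto only if [y0] can
    be joined to each of its translates inside the regular points. The complex hyperplanes have real
    codimension two, which leaves room to go around them; the real ones would cut the space into
    alcoves.

    The exchange argument serves twice. With the single level 0 it gives the uniqueness of the
    dominant vector in an orbit, and this is what makes the recursion on weights well founded: among
    sums of conjugates of fundamental weights, the dominant one is strictly the highest.

    Since the group acts by isometries, the covering is treated metrically. Evenly covered
    neighbourhoods are replaced by two estimates, that distinct points of one fibre stay apart and
    that nearby fibres are close to each other. A single point of a fibre suffices for each, and
    compactness of the square makes both uniform along a homotopy. Distances are kept squared, so
    each triangle inequality reads [d x z <= 2 * (d x y + d y z)]; the constants e/4, e/16 and e/32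
    pay for these factors. *)

Section Dot.
Variables (R : realType) (n : nat).
Implicit Types u v w x y : 'rV[R]_n.

Lemma dotC v w : dot v w = dot w v.
Proof. by apply: eq_bigr => j _; rewrite mulrC. Qed.

Lemma dotDl u v w : dot (u + v) w = dot u w + dot v w.
Proof. by rewrite /dot -big_split; apply: eq_bigr => j _; rewrite !mxE mulrDl. Qed.

Lemma dotZl a v w : dot (a *: v) w = a * dot v w.
Proof. by rewrite /dot mulr_sumr; apply: eq_bigr => j _; rewrite !mxE mulrA. Qed.

Lemma dotNl v w : dot (- v) w = - dot v w.
Proof. by rewrite -scaleN1r dotZl mulN1r. Qed.

Lemma dotBl u v w : dot (u - v) w = dot u w - dot v w.
Proof. by rewrite dotDl dotNl. Qed.

Lemma dot0l v : dot 0 v = 0.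
Proof. by rewrite -(scale0r 0) dotZl mul0r. Qed.

Lemma dotDr u v w : dot w (u + v) = dot w u + dot w v.
Proof. by rewrite dotC dotDl !(dotC w). Qed.

Lemma dotZr a v w : dot v (a *: w) = a * dot v w.
Proof. by rewrite dotC dotZl dotC. Qed.

Lemma dotNr v w : dot v (- w) = - dot v w.
Proof. by rewrite dotC dotNl dotC. Qed.

Lemma dotBr u v w : dot w (u - v) = dot w u - dot w v.
Proof. by rewrite dotDr dotNr. Qed.

Lemma dot0r v : dot v 0 = 0.
Proof. by rewrite dotC dot0l. Qed.

Lemma dot_suml (I : Type) (s : seq I) (P : pred I) (F : I -> 'rV[R]_n) w :
  dot (\sum_(i <- s | P i) F i) w = \sum_(i <- s | P i) dot (F i) w.
Proof.
by elim/big_rec2: _ => [|i a b _ <-]; rewrite ?dot0l // dotDl.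
Qed.

Lemma dot_sumr (I : Type) (s : seq I) (P : pred I) (F : I -> 'rV[R]_n) w :
  dot w (\sum_(i <- s | P i) F i) = \sum_(i <- s | P i) dot w (F i).
Proof. by rewrite dotC dot_suml; apply: eq_bigr => i _; rewrite dotC. Qed.

Lemma dot_ge0 v : 0 <= dot v v.
Proof. by apply: sumr_ge0 => j _; rewrite -expr2 sqr_ge0. Qed.

Lemma dot_eq0 v : (dot v v == 0) = (v == 0).
Proof.
apply/eqP/eqP => [|->]; last exact: dot0l.
rewrite /dot => /eqP; rewrite psumr_eq0 => [/allP v0|j _]; last first.
  by rewrite -expr2 sqr_ge0.
apply/rowP => j; rewrite mxE; have := v0 j (mem_index_enum j).
by rewrite /= mulf_eq0 orbb => /eqP.
Qed.

Lemma dot_gt0 v : v != 0 -> 0 < dot v v.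
Proof. by move=> v0; rewrite lt_def dot_ge0 dot_eq0 v0. Qed.

Definition rrefl v (l : R) x := x - (2 * (dot v x - l) / dot v v) *: v.

Lemma dot_rrefl v l x w :
  dot w (rrefl v l x) = dot w x - 2 * (dot v x - l) / dot v v * dot w v.
Proof. by rewrite /rrefl dotBr dotZr. Qed.

Lemma rreflK v l : v != 0 -> involutive (rrefl v l).
Proof.
move=> /dot_gt0 v0 x; rewrite {1}/rrefl dot_rrefl {1}/rrefl -addrA -opprD.
rewrite -scalerDl [X in X *: v](_ : _ = 0) ?scale0r ?subr0 //.
by field; rewrite gt_eqF.
Qed.

End Dot.

Section RootSystemBasics.
Variables (R : realType) (n : nat) (Phi : {fset 'rV[R]_n}).
Hypothesis rsP : root_system Phi.
Implicit Types u v w x y : 'rV[R]_n.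

Lemma cdot_cvec v w : cdot (cvec v) (cvec w) = (dot v w)%:C%C.
Proof.
rewrite /cdot /dot rmorph_sum; apply: eq_bigr => j _; rewrite !mxE rmorphM /=.
by congr (_ * _); rewrite /= oppr0.
Qed.

Lemma cvec_inj : injective (@cvec R n).
Proof.
by move=> v w /rowP vw; apply/rowP => j; have := vw j; rewrite !mxE => -[].
Qed.

Lemma creflection_cvec v l x :
  creflection (cvec v) l (cvec x) = cvec (rrefl v l x).
Proof.
apply/rowP => j; rewrite /creflection !mxE !cdot_cvec.
rewrite !(rmorphD, rmorphN, rmorphM) /= fmorphV.
by congr (_ - _ * _); rewrite mulrA; congr (_ * _ / _); congr (_ * _); rewrite -[2]/(1+1).
Qed.

Lemma root_neq0 v : v \in Phi -> v != 0.
Proof.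
move=> vPhi; apply/eqP => v0; have := roots_scale rsP 0 vPhi.
rewrite v0 scaler0 -v0 vPhi => /esym/orP[|]; first by rewrite eq_sym oner_eq0.
by rewrite eq_sym oppr_eq0 oner_eq0.
Qed.

Lemma root_gt0 v : v \in Phi -> 0 < dot v v.
Proof. by move=> /root_neq0; exact: dot_gt0. Qed.

Lemma rootN v : v \in Phi -> - v \in Phi.
Proof.
by move=> vPhi; rewrite -scaleN1r (roots_scale rsP _ vPhi) eqxx orbT.
Qed.

Lemma root_rrefl v w : v \in Phi -> w \in Phi -> rrefl v 0 w \in Phi.
Proof.
move=> vPhi wPhi; have [u uPhi] := roots_reflection rsP vPhi wPhi.
by rewrite /= creflection_cvec => /cvec_inj ->.
Qed.

(** The Cartan integer of [w] against the coroot of [v]. The floor only serves to land in [int]; it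
    is exact when both are roots. *)
Definition pairing w v : int := Num.floor (2 * dot v w / dot v v).

Lemma pairingE v w : v \in Phi -> w \in Phi ->
  (pairing w v)%:~R = 2 * dot v w / dot v v.
Proof. by move=> vPhi wPhi; apply: floorK; exact: (roots_integral rsP). Qed.

Lemma rrefl_pairing v w : v \in Phi -> w \in Phi ->
  rrefl v 0 w = w - (pairing w v)%:~R *: v.
Proof. by move=> vPhi wPhi; rewrite /rrefl subr0 pairingE. Qed.

(** The product is 4 cos^2 of the angle between the roots. Cauchy-Schwarz is strict because
    proportional roots are equal or opposite, and a positive pairing excludes opposite ones. *)
Lemma pairing_mul v w : v \in Phi -> w \in Phi -> 0 < pairing w v -> v != w ->
  0 < pairing v w /\ pairing v w * pairing w v < 4.
Proof.
move=> vPhi wPhi k0 vw; have v0 := root_gt0 vPhi; have w0 := root_gt0 wPhi.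
move: k0; rewrite -(ltr0z R) pairingE // => k0.
have d0 : 0 < dot v w.
  by move: k0; rewrite pmulr_lgt0 ?invr_gt0 // pmulr_rgt0.
split; first by rewrite -(ltr0z R) pairingE // dotC divr_gt0 ?mulr_gt0.
rewrite -(ltr_int R) rmorphM /= !pairingE // (dotC w v).
rewrite [X in X < _](_ : _ = 4 * (dot v w ^+ 2 / (dot v v * dot w w))); last first.
  by field; rewrite !gt_eqF.
rewrite -[X in _ < X]mulr1 ltr_pM2l ?ltr0n // ltr_pdivrMr ?mulr_gt0 // mul1r.
set t := dot v w / dot w w.
have t0 : 0 < t by rewrite divr_gt0.
suff : 0 < dot (v - t *: w) (v - t *: w).
  rewrite dotBl !dotBr !dotZl !dotZr (dotC w v) /t => h.
  have : 0 < (dot v v - dot v w / dot w w * dot v w) * dot w w.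
    rewrite mulr_gt0 //; move: h; congr (_ < _); field; rewrite gt_eqF //.
  rewrite mulrBl subr_gt0; congr (_ < _); field; rewrite gt_eqF //.
apply: dot_gt0; rewrite subr_eq0; apply/eqP => vE.
have := vPhi; rewrite vE (roots_scale rsP) // => /orP[/eqP t1|/eqP tN1].
  by move: vw; rewrite vE t1 scale1r eqxx.
by move: t0; rewrite tN1 oppr_gt0 ltr10.
Qed.

End RootSystemBasics.

Lemma rreflD (R : realType) (n : nat) (v x y : 'rV[R]_n) l t :
  rrefl v l (x + t *: y) = rrefl v l x + t *: rrefl v 0 y.
Proof.
rewrite /rrefl dotDr dotZr !subr0 scalerBr scalerA addrACA -opprD -scalerDl.
by congr (_ - _ *: _); ring.
Qed.

Lemma dot_rreflrefl (R : realType) (n : nat) (v x y : 'rV[R]_n) : v != 0 ->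
  dot (rrefl v 0 x) (rrefl v 0 y) = dot x y.
Proof.
move=> v0; rewrite dot_rrefl /rrefl !dotBl !dotZl !subr0.
by rewrite (dotC x v); field; rewrite dot_eq0.
Qed.

Lemma int_mul_lt4 (k l : int) : 0 < k -> 0 < l -> k * l < 4 ->
  k * l <= 3 /\ (1 < l -> k = 1) /\ (1 < l -> l != 2 -> l = 3).
Proof. by move=> k0 l0 kl; do ![split] => *; nia. Qed.

(** * Affine reflections and alcoves *)

Section Exchange.
Variables (R : realType) (n : nat) (Phi : {fset 'rV[R]_n}).
Hypothesis rsP : root_system Phi.
(* The pair (v, l) stands for the affine function x |-> <v, x> - l, with l in L:
   all integers for the affine Weyl group, only 0 for the finite one. A regular
   point a singles out the positive affine roots. *)
Variable L : pred int.
Hypothesis L_sub : forall m l k, L m -> L l -> L (m - k * l).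
Variable a : 'rV[R]_n.
Hypothesis a_reg : forall v l, v \in Phi -> L l -> dot v a != l%:~R.
Local Notation aroot := ('rV[R]_n * int)%type.
Implicit Types (b c d : aroot) (x y p : 'rV[R]_n) (s : seq aroot).

Definition aval c x := dot c.1 x - c.2%:~R.
Definition arefl c x := rrefl c.1 c.2%:~R x.
Definition isroot c := (c.1 \in Phi) && L c.2.
Definition ract b c : aroot :=
  (c.1 - (pairing c.1 b.1)%:~R *: b.1, c.2 - pairing c.1 b.1 * b.2).
Definition aopp c : aroot := (- c.1, - c.2).
Definition apos c := 0 < aval c a.
Definition wact s x := foldr arefl x s.
Definition wract s c := foldr ract c s.
Definition closed_alcove p := forall c, isroot c -> apos c -> 0 <= aval c p.
(** Simplicity is taken to be the very property that the exchange argument uses, rather than a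
    description by walls or by indecomposability. That such roots generate all reflections is
    [arefl_simple]. *)
Definition asimple b := [/\ isroot b, apos b &
  forall c, isroot c -> apos c -> c != b -> apos (ract b c)].

Lemma areflK b : isroot b -> involutive (arefl b).
Proof. by case/andP=> /(root_neq0 rsP) b0 _; exact: rreflK. Qed.

Lemma aval_arefl b x : isroot b -> aval b (arefl b x) = - aval b x.
Proof.
case/andP=> /(root_gt0 rsP) b0 _; rewrite /aval /arefl dot_rrefl.
by field; rewrite gt_eqF.
Qed.

Lemma aval_ractE b c x :
  aval (ract b c) x = aval c x - (pairing c.1 b.1)%:~R * aval b x.
Proof. by rewrite /aval /= dotBl dotZl rmorphB rmorphM /=; ring. Qed.

Lemma aval_reflE b c x : isroot b -> isroot c ->
  aval c (arefl b x) = aval c x - (pairing c.1 b.1)%:~R * aval b x.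
Proof.
case/andP=> bP _ /andP[cP _].
rewrite /aval /arefl dot_rrefl (pairingE rsP) // (dotC c.1 b.1).
by have := root_gt0 rsP bP => b0; field; rewrite gt_eqF.
Qed.

Lemma aval_ract b c x : isroot b -> isroot c ->
  aval (ract b c) (arefl b x) = aval c x.
Proof.
by move=> hb hc; rewrite aval_ractE aval_reflE // aval_arefl //; ring.
Qed.

Lemma isroot_ract b c : isroot b -> isroot c -> isroot (ract b c).
Proof.
case/andP=> bP bL /andP[cP cL]; rewrite /isroot /= L_sub // andbT.
by rewrite -(rrefl_pairing rsP) //; exact: root_rrefl.
Qed.

Lemma arefl_ract b c x : isroot b -> isroot c ->
  arefl (ract b c) (arefl b x) = arefl b (arefl c x).
Proof.
move=> hb hc; have /andP[bP bL] := hb; have /andP[cP cL] := hc.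
have areflE d y : arefl d y = y - (2 * aval d y / dot d.1 d.1) *: d.1 by [].
rewrite [LHS]areflE aval_ract // [in RHS](areflE c); set t := _ / dot c.1 c.1.
have -> : arefl b (x - t *: c.1) = arefl b x - t *: rrefl b.1 0 c.1.
  by rewrite -scaleNr /arefl rreflD scaleNr.
rewrite /= -!(rrefl_pairing rsP) // dot_rreflrefl //.
exact: root_neq0 bP.
Qed.

Lemma isroot_opp c : isroot c -> isroot (aopp c).
Proof.
case/andP=> cP cL; rewrite /isroot /= rootN //=.
have -> : - c.2 = c.2 - 2 * c.2 by lia.
exact: L_sub.
Qed.

Lemma aval_opp c x : aval (aopp c) x = - aval c x.
Proof. by rewrite /aval /= dotNl rmorphN /=; ring. Qed.

Lemma arefl_opp c x : arefl (aopp c) x = arefl c x.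
Proof.
rewrite /arefl /rrefl /= !dotNl dotNr opprK rmorphN /= -scaleNr.
by rewrite scalerN scaleNr opprK -scaleNr; congr (_ + _ *: _); ring.
Qed.

Lemma pairingvv v : v \in Phi -> pairing v v = 2.
Proof.
move=> vP; apply: (@intr_inj R); rewrite (pairingE rsP) // mulfK //.
by rewrite gt_eqF // (root_gt0 rsP).
Qed.

Lemma ract_self b : isroot b -> ract b b = aopp b.
Proof.
case/andP=> bP _; rewrite /ract /aopp pairingvv //; congr (_, _); last by lia.
by rewrite scaler_int mulrz_nat mulr2n opprD addrA subrr sub0r.
Qed.

Lemma pairingNl v w : v \in Phi -> w \in Phi -> pairing (- w) v = - pairing w v.
Proof.
move=> vP wP; apply: (@intr_inj R).
by rewrite rmorphN /= !(pairingE rsP) ?rootN // dotNr; ring.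
Qed.

Lemma ract_opp b c : isroot b -> isroot c -> ract b (aopp c) = aopp (ract b c).
Proof.
case/andP=> bP _ /andP[cP _]; rewrite /ract /aopp /= pairingNl //.
by congr (_, _); [rewrite rmorphN /= scaleNr opprD | lia].
Qed.

Lemma aposVneg c : isroot c -> apos c || apos (aopp c).
Proof.
case/andP=> cP cL; rewrite /apos aval_opp oppr_gt0 orbC -neq_lt /aval.
by rewrite subr_eq0 a_reg.
Qed.

Lemma apos_opp c : apos (aopp c) -> ~~ apos c.
Proof. by rewrite /apos aval_opp oppr_gt0 -leNgt => /ltW. Qed.

Lemma aposN c : isroot c -> ~~ apos c -> apos (aopp c).
Proof. by move=> /aposVneg/orP[->//|]. Qed.

Lemma isroot_wract s c : all isroot s -> isroot c -> isroot (wract s c).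
Proof.
by move=> + hc; elim: s => //= b s IH /andP[hb /IH]; exact: isroot_ract.
Qed.

Lemma aval_wract s c x : all isroot s -> isroot c ->
  aval (wract s c) (wact s x) = aval c x.
Proof.
move=> + hc; elim: s => //= b s IH /andP[hb hs].
by rewrite aval_ract ?isroot_wract // IH.
Qed.

Lemma arefl_wract s c x : all isroot s -> isroot c ->
  arefl (wract s c) (wact s x) = wact s (arefl c x).
Proof.
move=> + hc; elim: s => //= b s IH /andP[hb hs].
by rewrite arefl_ract ?isroot_wract // IH.
Qed.

Lemma wract_opp s c : all isroot s -> isroot c ->
  wract s (aopp c) = aopp (wract s c).
Proof.
move=> + hc; elim: s => //= b s IH /andP[hb hs].
by rewrite IH // ract_opp ?isroot_wract.
Qed.

Definition simple_word s := forall b, b \in s -> asimple b.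

Lemma simple_word_root s : simple_word s -> all isroot s.
Proof. by move=> hs; apply/allP => b /hs[]. Qed.

Lemma simple_cons b s : simple_word (b :: s) <-> asimple b /\ simple_word s.
Proof.
split=> [h|[hb hs] c]; last by rewrite inE => /orP[/eqP->//|/hs].
by split=> [|c cs]; apply: h; rewrite inE ?eqxx // cs orbT.
Qed.

(** Applying the letters of [s] from the last one on, the image of [c] starts positive and ends
    negative. At the letter [b] where the sign changes, that image must be [b] itself, as [b] is
    simple. The reflection in [c], carried through the letters after [b], becomes the one in [b] and
    cancels it. *)
Lemma exchange s c : simple_word s -> asimple c -> ~~ apos (wract s c) ->
  exists s', [/\ simple_word s', (size s' < size s)%N &
    forall x, wact s (arefl c x) = wact s' x].
Proof.
move=> + hc; have [rc pc _] := hc.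
elim: s => [|b s IH] /=; first by rewrite pc.
case/simple_cons=> hb hs neg; have rs := simple_word_root hs.
have [pos|/(IH hs)[s' [h1 h2 h3]]] := boolP (apos (wract s c)); last first.
  exists (b :: s'); split=> //; first by apply/simple_cons.
  by move=> x /=; rewrite h3.
have [rb pb fb] := hb.
have bE : wract s c = b.
  by apply/eqP; apply: contraNT neg => ne; apply: fb => //; exact: isroot_wract.
exists s; split=> // x.
by rewrite -arefl_wract // bE areflK.
Qed.

Lemma wact_rcons s b x : wact (rcons s b) x = wact s (arefl b x).
Proof. by rewrite /wact foldr_rcons. Qed.

Lemma wract_rcons s b c : wract (rcons s b) c = wract s (ract b c).
Proof. by rewrite /wract foldr_rcons. Qed.

Lemma simple_rcons s b : simple_word (rcons s b) -> asimple b /\ simple_word s.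
Proof.
by move=> h; split=> [|c cs]; apply: h; rewrite mem_rcons inE ?eqxx // cs orbT.
Qed.

(** A word fixing [a] preserves signs, so its last letter [b] stays positive, and the word without
    that letter makes [b] negative. Exchange then gives a word with the same action and at least two
    letters fewer. *)
Lemma simple_fix_regular s : simple_word s -> wact s a = a ->
  forall x, wact s x = x.
Proof.
have [N] := ubnP (size s); elim: N s => // N IH s.
elim/last_ind: s => [//|s b _]; rewrite size_rcons ltnS => sN hs sa.
have rs := simple_word_root hs; have [hb hs'] := simple_rcons hs.
have [rb pb _] := hb; have rs' := simple_word_root hs'.
have : apos (wract (rcons s b) b).
  by rewrite /apos -{1}sa aval_wract.
rewrite wract_rcons ract_self // wract_opp // => /apos_opp.
case/(exchange hs' hb)=> s' [h1 h2 h3] x.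
rewrite wact_rcons h3; apply: IH => //; first exact: ltn_trans h2 sN.
by rewrite -h3 -wact_rcons.
Qed.

Lemma simple_closed_alcove s p : simple_word s -> closed_alcove p ->
  closed_alcove (wact s p) -> wact s p = p.
Proof.
move=> + pC; have [N] := ubnP (size s); elim: N s => // N IH s.
elim/last_ind: s => [//|s b _]; rewrite size_rcons ltnS => sN hs spC.
have [hb hs'] := simple_rcons hs.
have [rb pb _] := hb; have rs' := simple_word_root hs'.
have [pos|/(exchange hs' hb)[s' [h1 h2 h3]]] := boolP (apos (wract s b)).
  have := spC _ (isroot_wract rs' rb) pos; rewrite wact_rcons aval_wract //.
  rewrite aval_arefl // oppr_ge0 => bp.
  have {bp}bp : aval b p = 0 by apply/le_anti; rewrite bp pC.
  have fp : arefl b p = p.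
    by rewrite /arefl /rrefl -[dot _ p - _]/(aval b p) bp mulr0 mul0r scale0r subr0.
  by rewrite wact_rcons fp in spC *; apply: IH.
by rewrite wact_rcons h3 in spC *; apply: IH => //; exact: ltn_trans h2 sN.
Qed.

Lemma aval_neq0 c : isroot c -> aval c a != 0.
Proof. by case/andP=> cP cL; rewrite /aval subr_eq0 a_reg. Qed.

(** A rank-two analysis. If [c] is parallel to [b], or has the smaller value at [a], then [g] is
    [c]. Otherwise the assumed bound on [aval c a] leaves only the Cartan integers 1 and 3, as in
    type G2, and [g] is [c - b]. *)
Lemma smaller_root_aux b c : isroot b -> isroot c -> apos b -> apos c ->
    0 < pairing c.1 b.1 -> 2 * aval c a <= (pairing c.1 b.1)%:~R * aval b a ->
    (c.1 = b.1 -> aval c a < aval b a) ->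
  exists g, [/\ isroot g, apos g, aval g a < aval b a &
    `|aval (ract g b) a| < aval b a].
Proof.
move=> hb hc; rewrite /apos => pb pc k0 ck cb.
have /andP[bP bL] := hb; have /andP[cP cL] := hc.
have [e|ne] := eqVneq b.1 c.1.
  have lt := cb (esym e); exists c; split=> //.
  rewrite aval_ractE e pairingvv // -pmulrn ltr_norml; lra.
have [k'0 kk'] := pairing_mul rsP bP cP k0 ne.
have [kk'3 [k'1 k3]] := int_mul_lt4 k'0 k0 kk'.
have [lt|ge] := ltP (aval c a) (aval b a).
  exists c; split=> //; rewrite aval_ractE.
  have : 0 < (pairing b.1 c.1)%:~R * aval c a by rewrite mulr_gt0 ?ltr0z.
  suff : (pairing b.1 c.1)%:~R * aval c a < 2 * aval b a by rewrite ltr_norml; lra.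
  have h : (pairing b.1 c.1)%:~R * (2 * aval c a) <=
           (pairing b.1 c.1 * pairing c.1 b.1)%:~R * aval b a.
    by rewrite rmorphM -mulrA; apply: ler_wpM2l => //; rewrite ler0z ltW.
  have : (pairing b.1 c.1 * pairing c.1 b.1)%:~R <= 3 :> R.
    by rewrite (ler_int R _ 3).
  move=> /(ler_wpM2r (ltW pb)); lra.
have k2 : 1 < pairing c.1 b.1.
  rewrite -(ltr_int R); have : aval b a * 2 <= (pairing c.1 b.1)%:~R * aval b a by lra.
  by rewrite mulrC ler_pM2r //; lra.
move: k'1 k3 => /(_ k2) k'1 /(_ k2) k3.
set d := ract c b; have hd : isroot d by exact: isroot_ract.
have dE : aval d a = aval b a - aval c a by rewrite aval_ractE k'1 mul1r.
have dlt : aval d a < 0 by rewrite lt_neqAle aval_neq0 // dE subr_le0.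
(* With Cartan integer 2 the two values would be equal, and [d] would vanish at the regular point
   [a]. *)
have {}k3 : pairing c.1 b.1 = 3.
  apply: k3; apply/eqP => e; move: ck dlt; rewrite e -pmulrn dE; lra.
exists (aopp d); split.
- exact: isroot_opp.
- by rewrite /apos aval_opp; lra.
- by rewrite aval_opp; move: ck; rewrite k3 -pmulrn; lra.
(* [d] is the reflection of [b] in [c], so both have the same length and the pairing can be
   computed. Writing b and c for the values at [a], the new value is 2b - c, which is in [b/2, b)
   because b < c <= 3b/2. *)
rewrite aval_ractE; have -> : pairing b.1 (aopp d).1 = 1.
  apply: (@intr_inj R); rewrite (pairingE rsP) //; last first.
    by have /andP[] := isroot_opp hd.
  have dd : d.1 = rrefl c.1 0 b.1 by rewrite (rrefl_pairing rsP).
  have -> : dot (aopp d).1 (aopp d).1 = dot b.1 b.1.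
    by rewrite [(aopp d).1]/(- d.1) dotNl dotNr opprK dd dot_rreflrefl // (root_neq0 rsP).
  have := pairingE rsP bP cP; rewrite k3 -pmulrn /= k'1 scale1r dotNl dotBl => e.
  have b0 := root_gt0 rsP bP; have {}e : 3 * dot b.1 b.1 = 2 * dot b.1 c.1.
    by rewrite e; field; rewrite gt_eqF.
  have -> : dot c.1 b.1 = 3 * dot b.1 b.1 / 2 by rewrite e (dotC c.1); lra.
  by field; rewrite gt_eqF.
rewrite mul1r aval_opp dE; move: ck dlt; rewrite dE k3 -pmulrn ltr_norml; lra.
Qed.

(* The reflection in b is the conjugate by the one in g of that in [ract g b], so
   this is the induction step for expressing reflections by simple ones. *)
Lemma smaller_root b : isroot b -> apos b -> ~ asimple b ->
  exists g, [/\ isroot g, apos g, aval g a < aval b a &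
    `|aval (ract g b) a| < aval b a].
Proof.
move=> hb pb nb.
have [c [hc pc cb nc]] :
    exists c, [/\ isroot c, apos c, c != b & ~~ apos (ract b c)].
  apply: contrapT => nex; apply: nb; split=> // c hc pc cb.
  by apply: contrapT => /negP nc; apply: nex; exists c.
have /andP[bP bL] := hb; have /andP[cP cL] := hc.
have hd := isroot_ract hb hc; set d := ract b c in hd nc.
have := aposN hd nc; rewrite /apos aval_opp oppr_gt0 aval_ractE => dneg.
set k := pairing c.1 b.1 in dneg.
have k0 : 0 < k.
  rewrite ltNge; apply/negP; rewrite -(ler_int R) => k0.
  have := mulr_le0_ge0 k0 (ltW pb); move: pc dneg; rewrite /apos; lra.
(* The values of [c] and of [aopp d] add up to [k] times that of [b], so one of these two positive
   roots has at most half of it. *)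
have [le|gt] := leP (2 * aval c a) (k%:~R * aval b a).
  apply: (smaller_root_aux hb hc pb pc k0 le) => e.
  rewrite lt_neqAle; apply/andP; split.
    apply: contra cb; rewrite /aval e => /eqP /addrI /oppr_inj /intr_inj e2.
    by case: (c) (b) e e2 => [? ?] [? ?] /= -> ->.
  by move: le; rewrite /k e pairingvv // -pmulrn; lra.
have ho := isroot_opp hd; have po := aposN hd nc.
have kE : pairing (aopp d).1 b.1 = k.
  apply: (@intr_inj R); rewrite (pairingE rsP) //; last by have /andP[] := ho.
  rewrite /= dotNr dotBr dotZr; have b0 := root_gt0 rsP bP.
  have -> : dot b.1 c.1 = k%:~R * dot b.1 b.1 / 2.
    by rewrite (pairingE rsP) //; field; rewrite gt_eqF.
  by field; rewrite gt_eqF.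
apply: (smaller_root_aux hb ho pb po); rewrite ?kE // aval_opp aval_ractE -/k.
  by lra.
by move=> e; move: gt dneg; rewrite -kE e pairingvv // -pmulrn; lra.
Qed.

(** For t >= 0, [level t - level 0] is the number of pairs (v, l), with v a root and l any integer,
    whose value at [a] lies in (0, t]. It replaces the real number [aval c a] as an induction
    measure. *)
Definition level (t : R) : int := \sum_(v <- Phi) Num.floor (t - dot v a).

Lemma level_lt c t : isroot c -> t < aval c a -> level t < level (aval c a).
Proof.
case/andP=> cP cL tc; rewrite /level (big_rem c.1) // [ltRHS](big_rem c.1) //=.
apply: ltr_leD; last first.
  by apply: ler_sum => v _; apply: le_floor; rewrite lerD2r ltW.
rewrite /aval (_ : _ - _ - _ = (- c.2)%:~R); last by rewrite rmorphN /=; ring.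
by rewrite intrKfloor -(ltr_int R); apply: le_lt_trans (floor_le _) _; 
   rewrite rmorphN /=; move: tc; rewrite /aval; lra.
Qed.

Lemma level_ge0 t : 0 < t -> level 0 <= level t.
Proof.
by move=> t0; apply: ler_sum => v _; apply: le_floor; rewrite lerD2r ltW.
Qed.

Lemma wact_cat s1 s2 x : wact (s1 ++ s2) x = wact s1 (wact s2 x).
Proof. by rewrite /wact foldr_cat. Qed.

Lemma simple_cat s1 s2 : simple_word s1 -> simple_word s2 ->
  simple_word (s1 ++ s2).
Proof. by move=> h1 h2 b; rewrite mem_cat => /orP[/h1|/h2]. Qed.

(** Induction on [level]. For a non-simple [d], the reflection is that in [ract g d] between two
    copies of that in [g], both with smaller values. If [ract g d] is negative, its opposite has the
    same reflection. *)
Lemma arefl_simple c : isroot c ->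
  exists2 s, simple_word s & forall x, arefl c x = wact s x.
Proof.
suff pos_case d : isroot d -> apos d ->
    exists2 s, simple_word s & forall x, arefl d x = wact s x.
  move=> hc; case/orP: (aposVneg hc) => [|/pos_case]; first exact: pos_case.
  case=> [|s hs sE]; first exact: isroot_opp.
  by exists s => // x; rewrite -arefl_opp.
have [N] := ubnP `|level (aval d a) - level 0|%N.
elim: N d => // N IH d dN hd pd.
have [sd|/(smaller_root hd pd)[g [hg pg gd rd]]] := pselect (asimple d).
  by exists [:: d] => // b; rewrite inE => /eqP->.
have IH' e : isroot e -> apos e -> aval e a < aval d a ->
    exists2 s, simple_word s & forall x, arefl e x = wact s x.
  move=> he pe ed; apply: IH => //.
  by move: (level_lt hd ed) (level_ge0 pe) dN; clear; lia.
have [s1 hs1 s1E] := IH' _ hg pg gd.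
have hr := isroot_ract hg hd.
have [s2 hs2 s2E] : exists2 s, simple_word s &
    forall x, arefl (ract g d) x = wact s x.
  move: rd; rewrite ltr_norml => /andP[r1 r2].
  case/orP: (aposVneg hr) => pr; first exact: IH'.
  have [|s hs sE] := IH' _ (isroot_opp hr) pr; first by rewrite aval_opp; lra.
  by exists s => // x; rewrite -sE arefl_opp.
exists (s1 ++ s2 ++ s1); first by do 2![apply: simple_cat => //].
by move=> x; rewrite !wact_cat -!s1E -s2E arefl_ract // areflK.
Qed.

Lemma wact_simple s : all isroot s ->
  exists2 t, simple_word t & forall x, wact s x = wact t x.
Proof.
elim: s => [|c s IH] /= => [_|/andP[/arefl_simple[s1 h1 s1E] /IH[s2 h2 s2E]]].
  by exists [::].
exists (s1 ++ s2); first exact: simple_cat.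
by move=> x; rewrite wact_cat -s1E -s2E.
Qed.

Lemma wact_fix_regular s : all isroot s -> wact s a = a ->
  forall x, wact s x = x.
Proof.
move=> /wact_simple[t ht tE]; rewrite tE => ta x; rewrite tE.
exact: simple_fix_regular.
Qed.

Lemma wact_closed_alcove s p : all isroot s -> closed_alcove p ->
  closed_alcove (wact s p) -> wact s p = p.
Proof.
by move=> /wact_simple[t ht tE]; rewrite tE; exact: simple_closed_alcove.
Qed.

End Exchange.

(** * The finite Weyl group and dominant weights *)

Section WeylMatrices.
Variables (R : realType) (n : nat) (Phi : {fset 'rV[R]_n}).
Hypothesis rsP : root_system Phi.
Implicit Types (u v w x y : 'rV[R]_n) (A B : 'M[R]_n).

Lemma dotE x y : x *m y^T = (dot x y)%:M.
Proof.
apply/matrixP => i j; rewrite !ord1 !mxE mulr1n /dot.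
by apply: eq_bigr => k _; rewrite !mxE.
Qed.

Definition rmx v : 'M[R]_n := 1%:M - (2 / dot v v) *: (v^T *m v).

Lemma mul_rmx x v : x *m rmx v = rrefl v 0 x.
Proof.
rewrite /rmx mulmxBr mulmx1 -scalemxAr mulmxA dotE mul_scalar_mx scalerA.
by rewrite /rrefl subr0 (dotC x) mulrAC.
Qed.

Lemma tr_rmx v : (rmx v)^T = rmx v.
Proof. by rewrite /rmx linearB linearZ /= trmx1 trmx_mul trmxK. Qed.

Lemma row_mulmxP A B : (forall x, x *m A = x *m B) -> A = B.
Proof. by move=> AB; apply/row_matrixP => i; rewrite !rowE. Qed.

Lemma rmxK v : v \in Phi -> rmx v *m rmx v = 1%:M.
Proof.
move=> vP; apply: row_mulmxP => x; rewrite mulmxA !mul_rmx mulmx1.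
exact/rreflK/(root_neq0 rsP).
Qed.

Definition wmx (s : seq 'rV[R]_n) : 'M[R]_n :=
  foldr (fun v A => A *m rmx v) 1%:M s.

(** Matrices act on the right of row vectors, and transposes are inverses. [weyl_group_mx] and
    [weyl_mx_group] match them with the bijections of [weyl_group]. *)
Definition weyl : set 'M[R]_n :=
  [set A | exists2 s, all (mem Phi) s & A = wmx s].

Lemma mul_wmx x s : x *m wmx s = wact [seq (v, 0) | v <- s] x.
Proof. by elim: s => [|v s IH] /=; rewrite ?mulmx1 // mulmxA mul_rmx IH. Qed.

Lemma wmx_cat s t : wmx (s ++ t) = wmx t *m wmx s.
Proof. by elim: s => [|v s IH] /=; rewrite ?mulmx1 // IH mulmxA. Qed.

Lemma weyl1 : weyl 1%:M.
Proof. by exists [::]. Qed.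

Lemma weylM A B : weyl A -> weyl B -> weyl (A *m B).
Proof.
move=> [s hs ->] [t ht ->]; exists (t ++ s); last by rewrite wmx_cat.
by rewrite all_cat ht.
Qed.

Lemma weyl_rmx v : v \in Phi -> weyl (rmx v).
Proof. by move=> vP; exists [:: v]; rewrite /= ?mul1mx // andbT. Qed.

Lemma weyl_inv A : weyl A -> weyl A^T /\ A *m A^T = 1%:M.
Proof.
case=> s hs ->; elim: s hs => [_|v s IH /= /andP[vP hs]].
  by rewrite /= trmx1 mulmx1; split=> //; exact: weyl1.
have [h1 h2] := IH hs; rewrite trmx_mul tr_rmx; split.
  by apply: weylM => //; exact: weyl_rmx.
by rewrite mulmxA -(mulmxA (wmx s)) rmxK // mulmx1.
Qed.

Lemma weyl_dot A x y : weyl A -> dot (x *m A) (y *m A) = dot x y.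
Proof.
case=> s hs ->; elim: s hs => [_|v s IH /= /andP[vP hs]]; rewrite ?mulmx1 //.
by rewrite !mulmxA !mul_rmx dot_rreflrefl ?IH // (root_neq0 rsP).
Qed.

Lemma weyl_dotC A x y : weyl A -> dot (x *m A) y = dot x (y *m A^T).
Proof.
move=> hA; have [hT AT] := weyl_inv hA.
by rewrite -(weyl_dot _ _ hT) -mulmxA AT mulmx1.
Qed.

Lemma weyl_root A v : weyl A -> v \in Phi -> v *m A \in Phi.
Proof.
case=> s hs -> vP; elim: s hs => [_|w s IH /= /andP[wP hs]]; rewrite ?mulmx1 //.
by rewrite mulmxA mul_rmx; apply: root_rrefl => //; exact: IH.
Qed.

Lemma coroot_rrefl v w : v != 0 ->
  coroot (rrefl v 0 w) = rrefl v 0 (coroot w).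
Proof.
move=> v0; rewrite /coroot dot_rreflrefl // /rrefl !subr0 dotZr scalerBr.
by rewrite scalerA; congr (_ - _ *: _); ring.
Qed.

Lemma rrefl_coroot v x : rrefl v 0 x = x - dot x (coroot v) *: v.
Proof. by rewrite /rrefl subr0 /coroot dotZr (dotC v); congr (_ - _ *: _); ring. Qed.

End WeylMatrices.

(** * Positive roots, fundamental weights and integrality *)

Record root_basis (R : realType) (n : nat) (Phi : {fset 'rV[R]_n})
    (phi : 'rV[R]_n -> R) (alpha omega : 'I_n -> 'rV[R]_n) : Prop := RootBasis {
  rb_root_system : root_system Phi;
  rb_phiD : forall x y, phi (x + y) = phi x + phi y;
  rb_phiZ : forall a x, phi (a *: x) = a * phi x;
  rb_phi_reg : forall v, v \in Phi -> phi v != 0;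
  rb_simpleP : forall v, simple_root Phi phi v <-> exists k, v = alpha k;
  rb_dual : forall j k, dot (omega j) (coroot (alpha k)) = (j == k)%:R }.

Section RootBasis.
Variables (R : realType) (n : nat) (Phi : {fset 'rV[R]_n}).
Variables (phi : 'rV[R]_n -> R) (alpha omega : 'I_n -> 'rV[R]_n).
Hypothesis rb : root_basis Phi phi alpha omega.
Let rsP := rb_root_system rb.
Let phiD := rb_phiD rb.
Let phiZ := rb_phiZ rb.
Let phi_reg := rb_phi_reg rb.
Let simpleP := rb_simpleP rb.
Let dual := rb_dual rb.
Implicit Types (u v w x y p : 'rV[R]_n) (A B : 'M[R]_n).
Local Notation ppos := (positive_root Phi phi).
Local Notation s_ i := (rrefl (alpha i) 0).

Lemma phiN x : phi (- x) = - phi x.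
Proof. by rewrite -scaleN1r phiZ mulN1r. Qed.

Lemma alpha_pos k : ppos (alpha k).
Proof. by have /simpleP[] : exists j, alpha k = alpha j by exists k. Qed.

Lemma alpha_root k : alpha k \in Phi.
Proof. by have [] := alpha_pos k. Qed.

(** Duality alone makes the simple coroots and the [omega j] dual bases, since a one-sided inverse
    of a square matrix is two-sided. Both expansions below rest on this. *)
Lemma omega_coroot_mx :
  (\matrix_j omega j) *m (\matrix_k coroot (alpha k))^T = 1%:M.
Proof.
apply/matrixP => j k; rewrite !mxE -dual.
by apply: eq_bigr => i _; rewrite !mxE.
Qed.

Lemma omega_expand x : x = \sum_k dot x (coroot (alpha k)) *: omega k.
Proof.
rewrite -[LHS]mulmx1 -(mulmx1C omega_coroot_mx) mulmxA mulmx_sum_row.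
apply: eq_bigr => k _; rewrite rowK; congr (_ *: _).
by rewrite mxE; apply: eq_bigr => i _; rewrite !mxE.
Qed.

Lemma coroot_expand x : x = \sum_k dot x (omega k) *: coroot (alpha k).
Proof.
have e : (\matrix_j omega j)^T *m (\matrix_k coroot (alpha k)) = 1%:M.
  by rewrite -[LHS]trmxK trmx_mul trmxK (mulmx1C omega_coroot_mx) trmx1.
rewrite -[LHS]mulmx1 -e mulmxA mulmx_sum_row.
apply: eq_bigr => k _; rewrite rowK; congr (_ *: _).
by rewrite mxE; apply: eq_bigr => i _; rewrite !mxE.
Qed.

Lemma alphaE k : alpha k = (dot (alpha k) (alpha k) / 2) *: coroot (alpha k).
Proof.
rewrite /coroot scalerA -[LHS]scale1r; congr (_ *: _).
by have := root_gt0 rsP (alpha_root k) => h; field; rewrite gt_eqF.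
Qed.

Lemma dot_alpha_omega k j :
  dot (alpha k) (omega j) = dot (alpha k) (alpha k) / 2 * (j == k)%:R.
Proof. by rewrite {1}alphaE dotZl (dotC _ (omega j)) dual. Qed.

Lemma phi_root_ind (P : 'rV[R]_n -> Prop) :
  (forall v, v \in Phi ->
     (forall u, u \in Phi -> phi u < phi v -> P u) -> P v) ->
  forall v, v \in Phi -> P v.
Proof.
move=> IH v; have [N] := ubnP (count (fun u => phi u < phi v) Phi).
elim: N v => // N IHN v vN vP; apply: IH => // u uP uv; apply: IHN => //.
rewrite -ltnS; apply: leq_trans vN; rewrite !ltnS -!size_filter.
apply: (@uniq_leq_size _ (u :: _)) => [/=|w].
  by rewrite filter_uniq ?fset_uniq // mem_filter ltxx.
rewrite inE !mem_filter => /orP[/eqP->|/andP[wu ->]]; first by rewrite uv.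
by rewrite (lt_trans wu uv).
Qed.

(** Up to a positive factor, [dot v (omega k)] is the coefficient of [alpha k] in [v]. A positive
    root that is not simple is a sum of positive roots with smaller [phi]. *)
Lemma pos_root_omega v k : ppos v -> 0 <= dot v (omega k).
Proof.
case=> vP; elim/phi_root_ind: v / vP => v vP IH pv.
have [/simpleP[j ->]|ns] := pselect (simple_root Phi phi v).
  rewrite dot_alpha_omega mulr_ge0 //.
  by rewrite divr_ge0 // ltW // (root_gt0 rsP) // alpha_root.
have : exists u w, [/\ ppos u, ppos w, u != w & v = u + w].
  by apply: contrapT => h; apply: ns; split.
move=> [u [w [[uP u0] [wP w0] _ vE]]]; rewrite vE dotDl addr_ge0 //.
  by apply: IH => //; rewrite vE phiD ltrDl.
by apply: IH => //; rewrite vE phiD ltrDr.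
Qed.

Lemma root_posVneg v : v \in Phi -> ppos v \/ ppos (- v).
Proof.
move=> vP; have := phi_reg vP; rewrite neq_lt => /orP[h|h]; last by left.
by right; split; rewrite ?rootN // phiN oppr_gt0.
Qed.

(** The reflection changes only the coefficient along [alpha i]. If it made [v] negative, all other
    coefficients would vanish, and [v] would be [alpha i] or its opposite. *)
Lemma refl_pos i v : ppos v -> v != alpha i -> ppos (s_ i v).
Proof.
move=> pv ne; have [vP v0] := pv.
have uP : s_ i v \in Phi by apply: root_rrefl => //; exact: alpha_root.
have [//|pn] := root_posVneg uP; exfalso.
have vj j : j != i -> dot v (omega j) = 0.
  move=> ji; apply/le_anti; rewrite pos_root_omega // andbT.
  have := pos_root_omega j pn; rewrite dotNl rrefl_coroot dotBl dotZl.
  by rewrite dot_alpha_omega (negbTE ji) !mulr0 subr0 oppr_ge0.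
have vE : v = (dot v (omega i) * (2 / dot (alpha i) (alpha i))) *: alpha i.
  rewrite {1}[v]coroot_expand (bigD1 i) //= big1 ?addr0 => [|j /vj ->].
    by rewrite /coroot scalerA.
  by rewrite scale0r.
move: vP; rewrite vE (roots_scale rsP) ?alpha_root //.
move=> /orP[/eqP e|/eqP e]; first by move: ne; rewrite vE e scale1r eqxx.
have [_] := alpha_pos i; move: v0; rewrite vE e scaleN1r phiN oppr_gt0.
by move=> /lt_trans h /h; rewrite ltxx.
Qed.

(** As [dot v v > 0] and the coefficients of [v] are non-negative, some simple root has a positive
    product with [v]; subtracting a positive multiple of it lowers [phi]. *)
Lemma pos_root_reflect v : ppos v -> (forall i, v != alpha i) ->
  exists i, ppos (s_ i v) /\ phi (s_ i v) < phi v.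
Proof.
move=> pv ne; have [vP v0] := pv.
have [i vi] : exists i, 0 < dot v (alpha i).
  apply: contrapT => h; have := root_gt0 rsP vP.
  rewrite {1}[v]coroot_expand dot_suml ltNge sumr_le0 // => k _.
  rewrite /coroot dotZl dotZl mulr_ge0_le0 ?pos_root_omega //.
  rewrite mulr_ge0_le0 ?divr_ge0 ?dot_ge0 // dotC leNgt; apply/negP => hk.
  by apply: h; exists k.
exists i; split; first exact: refl_pos.
rewrite rrefl_coroot -scaleNr phiD phiZ gtrDl mulNr oppr_lt0 mulr_gt0 //.
  by rewrite /coroot dotZr mulr_gt0 // divr_gt0 // (root_gt0 rsP) // alpha_root.
by have [] := alpha_pos i.
Qed.

Lemma omega_coroot_int v j : v \in Phi -> dot (omega j) (coroot v) \is a Num.int.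
Proof.
suff pos u : ppos u -> dot (omega j) (coroot u) \is a Num.int.
  move=> /root_posVneg[/pos//|/pos].
  by rewrite /coroot dotNl dotNr opprK scalerN dotNr rpredN.
case=> uP; elim/phi_root_ind: u / uP => u uP IH pu.
have [[i ->]|ne] := pselect (exists i, u = alpha i).
  by rewrite dual; case: eqP.
have [i [[sP sp] slt]] : exists i, ppos (s_ i u) /\ phi (s_ i u) < phi u.
  by apply: pos_root_reflect => // i; apply/eqP => e; apply: ne; exists i.
have := IH _ sP slt sp; rewrite coroot_rrefl ?(root_neq0 rsP) ?alpha_root //.
rewrite rrefl_coroot dotBr dotZr; set c := dot (coroot u) _.
(* Moving the factor 2 / <alpha i, alpha i> across leaves a Cartan integer times an entry of the
   duality relation. *)
have -> : c * dot (omega j) (alpha i) =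
    (dot (alpha i) (coroot u)) * dot (omega j) (coroot (alpha i)).
  by rewrite /c /coroot !(dotZl, dotZr) (dotC u); ring.
have ci : dot (alpha i) (coroot u) \is a Num.int.
  have := roots_integral rsP uP (alpha_root i).
  by rewrite /coroot dotZr (dotC (alpha i)) mulrAC.
by rewrite rpredBr // dual rpredM // natr_int.
Qed.

Definition weight p := forall k, dot p (coroot (alpha k)) \is a Num.int.

Lemma weight_coroot p v : weight p -> v \in Phi ->
  dot p (coroot v) \is a Num.int.
Proof.
move=> hp vP; rewrite [p]omega_expand dot_suml rpred_sum // => k _.
by rewrite dotZl rpredM // omega_coroot_int.
Qed.

Lemma weight0 : weight 0.
Proof. by move=> k; rewrite dot0l rpred0. Qed.

Lemma weightD p q : weight p -> weight q -> weight (p + q).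
Proof. by move=> hp hq k; rewrite dotDl rpredD. Qed.

Lemma weightN p : weight p -> weight (- p).
Proof. by move=> hp k; rewrite dotNl rpredN. Qed.

Lemma weight_root v : v \in Phi -> weight v.
Proof.
move=> vP k; rewrite /coroot dotZr mulrAC (dotC v).
by apply: (roots_integral rsP) => //; exact: alpha_root.
Qed.

Lemma weight_omega j : weight (omega j).
Proof. by move=> k; rewrite dual natr_int. Qed.

Lemma weight_weyl A p : weyl Phi A -> weight p -> weight (p *m A).
Proof.
case=> s hs -> hp; elim: s hs => [_|v s IH /= /andP[vP hs]]; rewrite ?mulmx1 //.
rewrite mulmxA mul_rmx rrefl_coroot => k.
rewrite dotBl dotZl rpredB //; first exact: IH.
by apply: rpredM; [exact: weight_coroot (IH hs) vP | exact: weight_root].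
Qed.

Lemma weight_weylE A p : weyl Phi A -> weight (p *m A) <-> weight p.
Proof.
move=> hA; split; last exact: weight_weyl.
have [hT AT] := weyl_inv rsP hA.
by move=> /(weight_weyl hT); rewrite -mulmxA AT mulmx1.
Qed.

(** The pairing with twice the dual Weyl vector, the sum of the positive coroots. *)
Definition ht x := dot x (\sum_(v <- Phi | 0 < phi v) coroot v).

Lemma htD x y : ht (x + y) = ht x + ht y.
Proof. exact: dotDl. Qed.

Lemma htZ a x : ht (a *: x) = a * ht x.
Proof. exact: dotZl. Qed.

Lemma htE x : ht x = \sum_(v <- Phi | 0 < phi v) dot x (coroot v).
Proof. exact: dot_sumr. Qed.

Lemma dot_coroot_self v : v \in Phi -> dot v (coroot v) = 2.
Proof.
by move=> vP; have := root_gt0 rsP vP => h; rewrite /coroot dotZr; field; rewrite gt_eqF.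
Qed.

Lemma rrefl_alphaK i : involutive (s_ i).
Proof. by apply: rreflK; apply: (root_neq0 rsP); exact: alpha_root. Qed.

Lemma ht_alpha i : ht (alpha i) = 2.
Proof.
have [aP a0] := alpha_pos i.
rewrite htE (big_rem (alpha i)) //= a0 dot_coroot_self //.
rewrite rem_filter ?fset_uniq // big_filter_cond.
(* The reflection in [alpha i] permutes the other positive roots and changes the sign of the product
   with [alpha i], so their total [S] is its own opposite. *)
set S := \sum_(_ <- _ | _) _; suff : S = - S by lra.
rewrite {1}/S -big_filter; set t := [seq _ <- _ | _].
have tP v : v \in t = [&& v != alpha i, 0 < phi v & v \in Phi].
  by rewrite mem_filter /= -andbA.
have ts v : v \in t -> s_ i v \in t.
  rewrite !tP => /and3P[ne v0 vP].
  have [-> ->] := refl_pos (conj vP v0) ne; rewrite !andbT.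
  apply/eqP => /(congr1 (s_ i)); rewrite rrefl_alphaK => vE.
  move: v0; rewrite vE rrefl_coroot dot_coroot_self // phiD -scaleNr phiZ; lra.
rewrite (perm_big [seq s_ i v | v <- t]).
  rewrite big_map /S -[in RHS]big_filter -/t -sumrN; apply: eq_bigr => v _.
  rewrite coroot_rrefl ?(root_neq0 rsP) // rrefl_coroot dotBr dotZr.
  have h := root_gt0 rsP aP.
  have -> : dot (coroot v) (coroot (alpha i)) =
      2 / dot (alpha i) (alpha i) * dot (alpha i) (coroot v).
    by rewrite {2}/coroot dotZr dotC.
  by field; rewrite gt_eqF.
apply: uniq_perm.
- by rewrite filter_uniq // fset_uniq.
- by rewrite map_inj_uniq ?filter_uniq ?fset_uniq //; exact: (inv_inj (rrefl_alphaK i)).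
- move=> v; apply/idP/mapP => [vt|[w wt ->]]; last exact: ts.
  by exists (s_ i v); [exact: ts | rewrite rrefl_alphaK].
Qed.

Lemma ht_omega k : exists2 h : nat, (0 < h)%N & ht (omega k) = h%:R.
Proof.
have [aP a0] := alpha_pos k.
have ge0 v : v \in Phi -> 0 < phi v -> 0 <= dot (omega k) (coroot v).
  move=> vP v0; rewrite /coroot dotZr dotC mulr_ge0 ?divr_ge0 ?dot_ge0 //.
  exact: pos_root_omega.
have hint : ht (omega k) \is a Num.int.
  by rewrite htE big_seq_cond rpred_sum // => v /andP[vP _]; exact: omega_coroot_int.
have h1 : 1 <= ht (omega k).
  rewrite htE (big_rem (alpha k)) //= a0 dual eqxx lerDl big_seq_cond.
  apply: sumr_ge0 => v /andP[/mem_rem vP v0]; exact: ge0.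
have /natrP[h hE] : ht (omega k) \is a Num.nat.
  by rewrite natrEint hint (le_trans ler01).
by exists h => //; move: h1; rewrite hE ler1n.
Qed.

End RootBasis.

(** * Dominant representatives of Weyl orbits *)

Section Dominance.
Variables (R : realType) (n : nat) (Phi : {fset 'rV[R]_n}).
Variables (phi : 'rV[R]_n -> R) (alpha omega : 'I_n -> 'rV[R]_n).
Hypothesis rb : root_basis Phi phi alpha omega.
Let rsP := rb_root_system rb.
Implicit Types (u v w x y p q : 'rV[R]_n) (A B : 'M[R]_n).
Local Notation W := (weyl Phi).
Local Notation ht := (ht Phi phi).
Local Notation weight := (weight alpha).

(** A matrix of the group is determined by the images of the simple roots, which form a basis, and
    these images are roots. *)
Lemma finite_weyl : finite_set W.
Proof.
pose Al := \matrix_k alpha k.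
have AlU : Al \in unitmx.
  pose C := \matrix_k coroot (alpha k).
  have CU : C \in unitmx.
    have /mulmx1_unit[_] := omega_coroot_mx rb.
    by rewrite unitmx_tr.
  have -> : Al = diag_mx (\row_k (dot (alpha k) (alpha k) / 2)) *m C.
    apply/row_matrixP => k; rewrite row_mul row_diag_mx -scalemxAl -rowE !rowK.
    by rewrite mxE [LHS](alphaE rb).
  rewrite unitmx_mul CU andbT unitmxE det_diag unitfE.
  apply/prodf_neq0 => k _; rewrite mxE mulf_neq0 ?invr_eq0 ?pnatr_eq0 //.
  by rewrite gt_eqF // (root_gt0 rsP) // (alpha_root rb).
pose g (f : {ffun 'I_n -> Phi}) := invmx Al *m \matrix_k val (f k).
apply: (@sub_finite_set _ _ (g @` setT)); last exact: finite_image.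
move=> A hA; have aA k : alpha k *m A \in Phi.
  by apply: (weyl_root rsP) => //; exact: (alpha_root rb).
exists [ffun k => [` aA k]%fset] => //; rewrite /g.
rewrite [X in _ *m X](_ : _ = Al *m A) ?mulKmx //.
by apply/row_matrixP => k; rewrite row_mul !rowK ffunE.
Qed.

Definition weyls : {fset 'M[R]_n} := fset_set W.

Lemma in_weyls A : reflect (W A) (A \in weyls).
Proof.
rewrite in_fset_set; last exact: finite_weyl.
by apply: (iffP idP) => [/set_mem|/mem_set].
Qed.

Lemma weyls_perm B : W B -> perm_eq weyls [seq A *m B | A <- weyls].
Proof.
move=> hB; have [hT BT] := weyl_inv rsP hB; have TB := mulmx1C BT.
apply: uniq_perm; rewrite ?fset_uniq //.
  rewrite map_inj_uniq ?fset_uniq // => A A' /(congr1 (mulmx^~ B^T)).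
  by rewrite -!mulmxA BT !mulmx1.
move=> A; apply/idP/mapP => [/in_weyls hA|[C /in_weyls hC ->]].
  exists (A *m B^T); last by rewrite -mulmxA TB mulmx1.
  by apply/in_weyls; exact: weylM.
by apply/in_weyls; exact: weylM.
Qed.

Lemma sum_weyls (V : nmodType) B (F : 'M[R]_n -> V) : W B ->
  \sum_(A <- weyls) F (A *m B) = \sum_(A <- weyls) F A.
Proof. by move=> hB; rewrite [RHS](perm_big _ (weyls_perm hB)) big_map. Qed.

Lemma size_weyls_gt0 : (0 < size weyls)%N.
Proof.
have : 1%:M \in weyls by apply/in_weyls; exact: weyl1.
by rewrite lt0n cardfs_eq0; apply: contraTneq => ->; rewrite inE.
Qed.

Definition dominant p := forall k, 0 <= dot p (alpha k).

Lemma dominant_coroot p k : dominant p -> 0 <= dot p (coroot (alpha k)).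
Proof. by move=> /(_ k) h; rewrite /coroot dotZr mulr_ge0 ?divr_ge0 ?dot_ge0. Qed.

Lemma dominant_omega j : dominant (omega j).
Proof.
move=> k; rewrite dotC (dot_alpha_omega rb) mulr_ge0 //.
by rewrite divr_ge0 ?dot_ge0.
Qed.

Lemma dominantD p q : dominant p -> dominant q -> dominant (p + q).
Proof. by move=> hp hq k; rewrite dotDl addr_ge0. Qed.

Lemma dominant0 : dominant 0.
Proof. by move=> k; rewrite dot0l. Qed.

Lemma phi_dot : exists a, forall v, dot v a = phi v.
Proof.
exists (\row_j phi (delta_mx 0 j)) => v; rewrite [in RHS](row_sum_delta v).
rewrite (big_morph phi (rb_phiD rb) (id1 := 0)); last first.
  by rewrite -(scale0r 0) (rb_phiZ rb) mul0r.
by apply: eq_bigr => j _; rewrite (rb_phiZ rb) mxE.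
Qed.

(** The alcove argument with the single level 0. [phi] is the product with a vector [a], regular
    because [phi] vanishes on no root, and a dominant vector lies in the closed chamber of [a]. *)
Lemma dominant_unique A p : W A -> dominant p -> dominant (p *m A) ->
  p *m A = p.
Proof.
move=> [s hs ->] dp dsp; have [a aE] := phi_dot.
pose L : pred int := pred1 0.
have Lsub m l k : L m -> L l -> L (m - k * l).
  by move=> /eqP-> /eqP->; rewrite mulr0 subr0 /L /= eqxx.
have areg v l : v \in Phi -> L l -> dot v a != l%:~R.
  by move=> vP /eqP ->; rewrite aE; exact: (rb_phi_reg rb).
have cl x : dominant x -> closed_alcove Phi L a x.
  move=> dx [v l] /andP[/= vP /eqP ->]; rewrite /apos /aval /= !subr0 aE => v0.
  rewrite [v](coroot_expand rb) dot_suml sumr_ge0 // => k _.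
  rewrite dotZl mulr_ge0 ?(pos_root_omega rb) // dotC.
  exact: dominant_coroot.
rewrite mul_wmx; apply: (wact_closed_alcove rsP Lsub areg).
- by rewrite all_map; apply: sub_all hs => v /= vP; rewrite /isroot /= vP /L /= eqxx.
- exact: cl.
- by rewrite -mul_wmx; exact: cl.
Qed.

(** Reflecting in [alpha k] lowers the height by twice [dot p (coroot (alpha k))], so maximality
    forces this product to be non-negative. *)
Lemma ht_max_dominant p : (forall A, W A -> ht (p *m A) <= ht p) -> dominant p.
Proof.
move=> hp k; have aP := alpha_root rb k.
have := hp _ (weyl_rmx aP); rewrite mul_rmx rrefl_coroot -scaleNr htD htZ.
rewrite (ht_alpha rb) gerDl mulNr oppr_le0 pmulr_lge0 //.
by rewrite /coroot dotZr pmulr_rge0 // divr_gt0 // (root_gt0 rsP).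
Qed.

Lemma ht_argmax p : exists2 A, W A & forall B, W B -> ht (p *m B) <= ht (p *m A).
Proof.
suff argmax (s : seq 'M[R]_n) : (0 < size s)%N ->
    exists2 A, A \in s & forall B, B \in s -> ht (p *m B) <= ht (p *m A).
  have [A /in_weyls hA h] := argmax _ size_weyls_gt0.
  by exists A => // B /in_weyls; exact: h.
elim: s => // C s IH _.
have [s0|] := posnP (size s).
  by exists C; rewrite ?inE ?eqxx // (size0nil s0) => D; rewrite inE => /eqP->.
move=> /IH[A As Am]; have [le|/ltW le] := leP (ht (p *m A)) (ht (p *m C)).
  exists C; rewrite ?inE ?eqxx // => D; rewrite inE => /orP[/eqP->//|/Am h].
  exact: le_trans h le.
by exists A; rewrite ?inE ?As ?orbT // => D; rewrite inE => /orP[/eqP->|/Am].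
Qed.

Lemma dominant_conj p : exists2 A, W A & dominant (p *m A).
Proof.
have [A hA Amax] := ht_argmax p.
exists A => //; apply: ht_max_dominant => B hB; rewrite -mulmxA.
by apply: Amax; exact: weylM.
Qed.

(** A highest point of the orbit is dominant, hence is [p] by uniqueness; a point as high as [p] is
    itself a highest one. *)
Lemma ht_dominant A p : W A -> dominant p ->
  ht (p *m A) <= ht p /\ (ht (p *m A) = ht p -> p *m A = p).
Proof.
suff max B q : W B -> dominant q -> ht (q *m B) <= ht q.
  move=> hA dp; split=> [|e]; first exact: max.
  apply: dominant_unique => //; apply: ht_max_dominant => B hB.
  by rewrite -mulmxA e; apply: max => //; exact: weylM.
move=> {A p} hB dq; have [A hA Amax] := ht_argmax q.
have dA : dominant (q *m A).
  apply: ht_max_dominant => C hC; rewrite -mulmxA.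
  by apply: Amax; exact: weylM.
by rewrite -{2}(dominant_unique hA dq dA); exact: Amax.
Qed.

End Dominance.

(** * Functions on the weights and orbit sums *)

Section OrbitSums.
Variables (R : realType) (n : nat) (Phi : {fset 'rV[R]_n}).
Variables (phi : 'rV[R]_n -> R) (alpha omega : 'I_n -> 'rV[R]_n).
Hypothesis rb : root_basis Phi phi alpha omega.
Variable K : numFieldType.
Let rsP := rb_root_system rb.
Local Notation V := 'rV[R]_n.
Implicit Types (p q r s : V) (A B : 'M[R]_n) (f g : V -> K) (ks : seq 'I_n).
Local Notation W := (weyl Phi).
Local Notation ht := (ht Phi phi).
Local Notation weight := (weight alpha).
Local Notation weyls := (weyls Phi).

Definition orb k : seq V := undup [seq omega k *m A | A <- weyls].

Lemma orbP k r : reflect (exists2 A, W A & r = omega k *m A) (r \in orb k).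
Proof.
rewrite mem_undup; apply: (iffP mapP) => -[A hA ->].
  by exists A => //; apply/(in_weyls rb).
by exists A => //; apply/(in_weyls rb).
Qed.

Lemma orb_perm k A : W A -> perm_eq (orb k) [seq r *m A | r <- orb k].
Proof.
move=> hA; have [hT AT] := weyl_inv rsP hA; have TA := mulmx1C AT.
apply: uniq_perm; rewrite ?undup_uniq //.
  rewrite map_inj_uniq ?undup_uniq // => x y /(congr1 (mulmx^~ A^T)).
  by rewrite -!mulmxA AT !mulmx1.
move=> r; apply/idP/mapP => [/orbP[B hB ->]|[q /orbP[B hB ->] ->]].
  exists (omega k *m (B *m A^T)); last by rewrite -!mulmxA TA mulmx1.
  by apply/orbP; exists (B *m A^T) => //; exact: weylM.
by apply/orbP; exists (B *m A); [exact: weylM | rewrite mulmxA].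
Qed.

Lemma omega_orb k : omega k \in orb k.
Proof. by apply/orbP; exists 1%:M; rewrite ?mulmx1 //; exact: weyl1. Qed.

Definition osum k f p := \sum_(r <- orb k) f (p + r).

Definition osums ks f := foldr osum f ks.

Definition sums ks : seq V :=
  foldr (fun k t => [seq r + s | r <- orb k, s <- t]) [:: 0] ks.

Lemma osumsE ks f p : osums ks f p = \sum_(s <- sums ks) f (p + s).
Proof.
elim: ks p => [|k ks IH] p /=; first by rewrite big_seq1 addr0.
rewrite big_allpairs_dep /osum; apply: eq_bigr => r _.
by rewrite IH; apply: eq_bigr => s _; rewrite addrA.
Qed.

Definition winv f := forall A p, W A -> f (p *m A) = f p.

Lemma osum_winv k f : winv f -> winv (osum k f).
Proof.
move=> fW A p hA; rewrite /osum (perm_big _ (orb_perm k hA)) big_map.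
by apply: eq_bigr => r _; rewrite -mulmxDl fW.
Qed.

Definition wt ks := \sum_(k <- ks) omega k.

(** Each summand is at most as high as its fundamental weight, and is that weight in case of
    equality. So [wt ks] is, up to conjugation, the only highest term, and the iterated orbit sums
    form a triangular system. *)
Lemma sums_ht ks s A : s \in sums ks -> W A ->
  ht (s *m A) <= ht (wt ks) /\ (ht (s *m A) = ht (wt ks) -> s *m A = wt ks).
Proof.
move=> + hA; elim: ks s => [|k ks IH] s /=.
  by rewrite inE /wt big_nil => /eqP->; rewrite mul0mx.
case/allpairsP=> -[r t] /= [/orbP[B hB ->] /IH[h1 h2] ->].
have [g1 g2] := ht_dominant rb (weylM hB hA) (dominant_omega rb k).
rewrite /wt big_cons -/(wt ks) mulmxDl !htD -mulmxA; split; first exact: lerD.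
move=> e; have e1 : ht (omega k *m (B *m A)) = ht (omega k).
  by apply/le_anti; rewrite g1 /= -(lerD2r (ht (t *m A))) e lerD2l.
by rewrite g2 // h2 //; move: e; rewrite e1 => /addrI.
Qed.

Lemma wt_sums ks : wt ks \in sums ks.
Proof.
elim: ks => [|k ks IH] /=; rewrite /wt ?big_nil ?inE // big_cons.
by apply: allpairs_f => //; exact: omega_orb.
Qed.

Lemma sums_weight ks s : s \in sums ks -> weight s.
Proof.
elim: ks s => [|k ks IH] s /=; first by rewrite inE => /eqP->; exact: weight0.
case/allpairsP=> -[r t] /= [/orbP[B hB ->] /IH ht ->].
by apply: weightD => //; apply: (weight_weyl rb) => //; exact: (weight_omega rb).
Qed.

Lemma wt_dominant ks : dominant alpha (wt ks).
Proof.
elim: ks => [|k ks IH]; rewrite /wt ?big_nil ?big_cons; first exact: dominant0.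
by apply: dominantD => //; exact: (dominant_omega rb).
Qed.

Lemma wt_weight ks : weight (wt ks).
Proof. exact/sums_weight/wt_sums. Qed.

Lemma dominant_wt p : weight p -> dominant alpha p -> exists ks, p = wt ks.
Proof.
move=> hp dp; pose m k := Num.truncn (dot p (coroot (alpha k))).
have mE k : dot p (coroot (alpha k)) = (m k)%:R.
  by apply/esym/truncnK; rewrite natrEint hp (dominant_coroot k dp).
exists (flatten [seq nseq (m k) k | k <- index_enum 'I_n]).
rewrite /wt big_flatten big_map [LHS](omega_expand rb).
apply: eq_bigr => k _; rewrite mE big_nseq scaler_nat.
by elim: (m k) => [|j IH]; rewrite ?mulr0n //= mulrS IH.
Qed.

Lemma weight_conj_wt p : weight p -> exists A ks, W A /\ p *m A = wt ks.
Proof.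
move=> hp; have [A hA dA] := dominant_conj rb p.
by have [ks e] := dominant_wt (weight_weyl rb hA hp) dA; exists A, ks.
Qed.

Definition lvl ks : nat := \sum_(k <- ks) Num.truncn (ht (omega k)).

Lemma lvlE ks : ht (wt ks) = (lvl ks)%:R.
Proof.
rewrite /lvl natr_sum /wt; elim: ks => [|k ks IH].
  by rewrite !big_nil [LHS]dot0l.
by rewrite !big_cons htD IH; have [h _ ->] := ht_omega rb k; rewrite natrK.
Qed.

(* The linear forms on invariant functions spanned by the values of the iterated
   orbit sums at 0: on an eigenfunction they depend only on the eigenvalues. *)
Definition orbit_repr (L : (V -> K) -> K) := exists l : seq (K * seq 'I_n),
  forall f, winv f -> L f = \sum_(x <- l) x.1 * osums x.2 f 0.

Lemma orbit_reprD L1 L2 : orbit_repr L1 -> orbit_repr L2 ->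
  orbit_repr (fun f => L1 f + L2 f).
Proof.
move=> [l1 h1] [l2 h2]; exists (l1 ++ l2) => f fW.
by rewrite h1 // h2 // big_cat.
Qed.

Lemma orbit_reprZ a L : orbit_repr L -> orbit_repr (fun f => a * L f).
Proof.
move=> [l h]; exists [seq (a * x.1, x.2) | x <- l] => f fW.
by rewrite h // big_map mulr_sumr; apply: eq_bigr => x _; rewrite mulrA.
Qed.

Lemma orbit_repr_sum (t : seq V) : (forall s, s \in t -> orbit_repr (fun f => f s)) ->
  orbit_repr (fun f => \sum_(s <- t) f s).
Proof.
elim: t => [|s t IH] h; first by exists [::] => f _; rewrite !big_nil.
have [l hl] : orbit_repr (fun f => f s + \sum_(s <- t) f s).
  apply: orbit_reprD; first by apply: h; rewrite inE eqxx.
  by apply: IH => r rt; apply: h; rewrite inE rt orbT.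
by exists l => f fW; rewrite -hl // big_cons.
Qed.

Definition conj_to p s := `[< exists2 A, W A & s *m A = p >].

Lemma conj_to_winv p s f : winv f -> conj_to p s -> f s = f p.
Proof. by move=> fW /asboolP[A hA <-]; rewrite fW. Qed.

Lemma conj_wt_lower ks s : s \in sums ks -> ~~ conj_to (wt ks) s ->
  forall A ks', W A -> s *m A = wt ks' -> (lvl ks' < lvl ks)%N.
Proof.
move=> ss nc A ks' hA e; have [h1 h2] := sums_ht ss hA.
rewrite -(ltr_nat R) -!lvlE -e lt_neqAle h1 andbT.
by apply: contra nc => /eqP /h2 e2; apply/asboolP; exists A.
Qed.

Lemma osums_split ks f : winv f -> osums ks f 0 =
  (count (conj_to (wt ks)) (sums ks))%:R * f (wt ks) +
  \sum_(s <- sums ks | ~~ conj_to (wt ks) s) f s.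
Proof.
move=> fW; rewrite osumsE (bigID (conj_to (wt ks))) /=; congr (_ + _).
  rewrite (eq_bigr (fun => f (wt ks))) => [|s /(conj_to_winv fW) <-]; last by rewrite add0r.
  by rewrite big_const_seq iter_addr_0 mulr_natl.
by apply: eq_bigr => s _; rewrite add0r.
Qed.

Lemma count_conj_gt0 ks : (count (conj_to (wt ks)) (sums ks) > 0)%N.
Proof.
rewrite -has_count; apply/hasP; exists (wt ks); first exact: wt_sums.
by apply/asboolP; exists 1%:M; rewrite ?mulmx1 //; exact: weyl1.
Qed.

(** The triangular system [osums_split] is solved by induction on [lvl]: the terms not conjugate to
    [wt ks] have lower level, and the coefficient of [f (wt ks)] is a positive count, invertible in
    characteristic 0. *)
Lemma orbit_repr_eval p : weight p -> orbit_repr (fun f => f p).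
Proof.
suff dom ks : orbit_repr (fun f => f (wt ks)).
  move=> /weight_conj_wt[A [ks [hA e]]]; have [l hl] := dom ks.
  by exists l => f fW; rewrite -hl // -e fW.
have [N] := ubnP (lvl ks); elim: N ks => // N IH ks; rewrite ltnS => kN.
set c := count (conj_to (wt ks)) (sums ks).
have [l hl] : orbit_repr (fun f => c%:R^-1 * (osums ks f 0 +
    -1 * \sum_(s <- [seq s <- sums ks | ~~ conj_to (wt ks) s]) f s)).
  apply: orbit_reprZ; apply: orbit_reprD.
    by exists [:: (1, ks)] => f _; rewrite big_seq1 mul1r.
  apply: orbit_reprZ; apply: orbit_repr_sum => s; rewrite mem_filter => /andP[nc ss].
  have [A [ks' [hA e]]] := weight_conj_wt (sums_weight ss).
  have [l hl] := IH ks' (leq_trans (conj_wt_lower ss nc hA e) kN).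
  by exists l => f fW; rewrite -hl // -e fW.
exists l => f fW; rewrite -hl // osums_split // big_filter mulN1r addrK mulKf //.
by rewrite pnatr_eq0 -lt0n count_conj_gt0.
Qed.

Lemma osums_inj f : winv f -> (forall ks, osums ks f 0 = 0) ->
  forall p, weight p -> f p = 0.
Proof.
move=> fW f0 p /orbit_repr_eval[l ->] //.
by rewrite big1 // => x _; rewrite f0 mulr0.
Qed.

End OrbitSums.

(** Iterating [G] from zero, the value at [t] is settled after [m t + 1] rounds, because [G t] looks
    only at points of smaller measure. *)
Lemma wf_solution (T : Type) (K : nmodType) (m : T -> nat)
    (G : T -> (T -> K) -> K) :
  (forall t f g, (forall u, (m u < m t)%N -> f u = g u) -> G t f = G t g) ->
  exists f, forall t, f t = G t f.
Proof.
move=> hG; pose F N := iter N (fun f t => G t f) (fun=> 0).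
have stab N M t : (m t < N)%N -> (N <= M)%N -> F M t = F N t.
  elim: N M t => // N IH [|M] t //; rewrite ltnS => tN NM /=; apply: hG => u ut.
  by apply: IH => //; exact: leq_trans ut tN.
exists (fun t => F (m t).+1 t) => t /=; apply: hG => u ut.
exact: (stab (m u).+1).
Qed.

(** * Eigenfunctions of the orbit sums with prescribed eigenvalues *)

Section Eigenfunctions.
Variables (R : realType) (n : nat) (Phi : {fset 'rV[R]_n}).
Variables (phi : 'rV[R]_n -> R) (alpha omega : 'I_n -> 'rV[R]_n).
Hypothesis rb : root_basis Phi phi alpha omega.
Variable K : numFieldType.
Let rsP := rb_root_system rb.
Let dual := rb_dual rb.
Local Notation V := 'rV[R]_n.
Implicit Types (p q r s : V) (A B : 'M[R]_n) (f g : V -> K) (ks : seq 'I_n).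
Local Notation W := (weyl Phi).
Local Notation weight := (weight alpha).
Local Notation weyls := (weyls Phi).
Local Notation osum := (osum Phi omega).
Local Notation osums := (osums Phi omega).
Local Notation sums := (sums Phi omega).
Local Notation wt := (wt omega).
Local Notation lvl := (lvl Phi phi omega).
Local Notation conj_to := (conj_to Phi).

Lemma osums_cons_rem k ks f : k \in ks -> osums ks f =1 osums (k :: rem k ks) f.
Proof.
elim: ks => // j ks IH; rewrite inE /=; have [-> //|jk /=] := eqVneq k j.
move=> /IH /= h p; rewrite /osum.
under eq_bigr => r _ do rewrite h /osum.
rewrite exchange_big; apply: eq_bigr => r _; apply: eq_bigr => s _.
by rewrite addrAC.
Qed.

Lemma osums_perm ks ks' f : perm_eq ks ks' -> osums ks f =1 osums ks' f.
Proof.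
elim: ks ks' => [|k ks IH] ks' h p; first by rewrite perm_sym in h; rewrite (perm_nilP h).
have kks : k \in ks' by rewrite -(perm_mem h) inE eqxx.
rewrite (osums_cons_rem f kks) /=; apply: eq_bigr => r _.
apply: IH; rewrite -(perm_cons k); apply: perm_trans h _.
exact: perm_to_rem.
Qed.

Lemma dot_wt ks k : dot (wt ks) (coroot (alpha k)) = (count_mem k ks)%:R.
Proof.
rewrite /wt dot_suml; elim: ks => [|j ks IH]; rewrite ?big_nil //.
by rewrite big_cons IH dual /= natrD.
Qed.

Lemma wt_perm ks ks' : wt ks = wt ks' -> perm_eq ks ks'.
Proof.
move=> e; apply/allP => k _ /=; apply/eqP.
by apply/eqP; rewrite -(eqr_nat R) -!dot_wt e.
Qed.

(** The word is chosen from a set that depends only on the orbit of [p], so functions defined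
    through it are invariant. The empty word is the default off the weights. *)
Definition dom_word p : seq 'I_n :=
  xget [::] [set ks | exists2 A, W A & p *m A = wt ks].

Lemma dom_wordP p : weight p -> exists2 A, W A & p *m A = wt (dom_word p).
Proof.
move=> /(weight_conj_wt rb)[A [ks [hA e]]].
have : exists ks, [set ks | exists2 A, W A & p *m A = wt ks] ks.
  by exists ks; exists A.
by case=> ks' h; rewrite /dom_word; case: xgetP => [l _ //|/(_ ks')].
Qed.

Lemma dom_word_weyl p B : W B -> dom_word (p *m B) = dom_word p.
Proof.
move=> hB; have [hT BT] := weyl_inv rsP hB; congr (xget [::] _).
apply/seteqP; split=> ks /= -[A hA <-].
  by exists (B *m A); [exact: weylM | rewrite mulmxA].
exists (B^T *m A); first exact: weylM.
by rewrite mulmxA -(mulmxA p) BT mulmx1.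
Qed.

Lemma wt_dom_word ks : wt (dom_word (wt ks)) = wt ks.
Proof.
have [A hA e] := dom_wordP (wt_weight rb ks).
rewrite -e; apply: (dominant_unique rb) => //; first exact: (wt_dominant rb).
by rewrite e; exact: (wt_dominant rb).
Qed.

Variable c : 'I_n -> K.

Definition orbit_eigen f := forall k p, osum k f p = c k * f p.

Lemma osums_eigen ks f p : orbit_eigen f ->
  osums ks f p = (\prod_(k <- ks) c k) * f p.
Proof.
move=> fE; elim: ks p => [|k ks IH] p /=; first by rewrite big_nil mul1r.
rewrite big_cons -mulrA mulrCA -fE mulr_sumr.
by apply: eq_bigr => r _; exact: IH.
Qed.

Lemma exists_orbit_eigen : exists f, [/\ orbit_eigen f, winv Phi f & f 0 = 1].
Proof.
pose cnt p : K := (count (conj_to (wt (dom_word p))) (sums (dom_word p)))%:R.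
(* [G] solves [osums_split] for the value at the dominant weight, with the iterated sum at 0
   replaced by the product of eigenvalues that it must be for an eigenfunction equal to 1 at 0. *)
pose G p f : K := if `[< weight p >] then (cnt p)^-1 *
   (\prod_(k <- dom_word p) c k -
    \sum_(s <- sums (dom_word p) | ~~ conj_to (wt (dom_word p)) s) f s) else 0.
have [f fE] : exists f, forall p, f p = G p f.
  apply: (@wf_solution _ _ (fun p => lvl (dom_word p))) => p f g fg.
  rewrite /G; case: asboolP => // hp; congr (_ * (_ - _)).
  rewrite big_seq_cond [RHS]big_seq_cond; apply: eq_bigr => s /andP[ss nc].
  apply: fg; have [A hA e] := dom_wordP (sums_weight rb ss).
  exact: (conj_wt_lower rb ss nc hA e).
have fW : winv Phi f.
  move=> A p hA; rewrite !fE /G /cnt dom_word_weyl //.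
  by rewrite (asbool_equiv_eq (weight_weylE rb p hA)).
have f0 p : ~ weight p -> f p = 0 by move=> np; rewrite fE /G asboolF.
have fprod ks : osums ks f 0 = \prod_(k <- ks) c k.
  have pe : perm_eq (dom_word (wt ks)) ks by apply: wt_perm; exact: wt_dom_word.
  rewrite -(osums_perm f pe) -(perm_big _ pe) /=.
  rewrite osums_split // wt_dom_word [f _]fE /G asboolT; last exact: (wt_weight rb).
  rewrite /cnt wt_dom_word mulVKf ?subrK // pnatr_eq0 -lt0n -{1}wt_dom_word.
  exact: (count_conj_gt0 rb).
exists f; split=> //; last by have := fprod [::]; rewrite big_nil.
move=> k p; have [hp|np] := pselect (weight p); last first.
  rewrite (f0 _ np) mulr0 /osum big1_seq // => r /andP[_ /(orbP rb)[A hA ->]].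
  apply: f0 => h; apply: np; rewrite -[p](addrK (omega k *m A)).
  apply: weightD => //; apply: weightN; apply: (weight_weyl rb) => //.
  exact: (weight_omega rb).
apply/eqP; rewrite -subr_eq0; apply/eqP.
(* The iterated sum of [g] at 0 along [ks] is the product of [c] over [rcons ks k] minus [c k] times
   the product over [ks], that is 0; an invariant function with this property vanishes on the
   weights. *)
pose g p := osum k f p - c k * f p; rewrite -/(g p); apply: (osums_inj rb) hp.
  by move=> A q hA; rewrite /g (osum_winv rb) // fW.
move=> ks; rewrite osumsE.
rewrite sumrB -mulr_sumr -!osumsE fprod.
have -> : osums ks (osum k f) = osums (rcons ks k) f by rewrite /osums foldr_rcons.
by rewrite fprod -cats1 big_cat /= big_seq1 mulrC subrr.
Qed.

End Eigenfunctions.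

(* Adding x0 to S, or removing it, pairs off opposite terms. *)
Lemma sum_sets_toggle (V : zmodType) (K : pzRingType) (T : finType) (u : T -> V)
    (w : V) (x0 : T) (f : V -> K) : u x0 = w ->
  \sum_(S : {set T}) (-1) ^+ #|S| * f (w *+ #|~: S| + \sum_(x in S) u x) = 0.
Proof.
move=> ux0; pose t (S : {set T}) :=
  (-1) ^+ #|S| * f (w *+ #|~: S| + \sum_(x in S) u x).
rewrite -/(t _) (bigID (fun S : {set T} => x0 \in S)) /=.
rewrite (reindex_onto (fun S => x0 |: S) (fun S => S :\ x0)) /=; last first.
  by move=> S x0S; rewrite finset.setD1K.
rewrite (eq_bigl (fun S : {set T} => x0 \notin S)) => [|S]; last first.
  rewrite finset.in_setU1 eqxx /=; apply/eqP/idP => [<-|x0S]; first by rewrite !inE eqxx.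
  by rewrite finset.setU1K.
rewrite -big_split big1 //= => S x0S; rewrite /t cardsU1 x0S exprS.
rewrite big_setU1 //= ux0 mulN1r mulNr (cardsD1 x0 (~: S)) inE x0S.
by rewrite finset.setCU finset.setIC -finset.setDE add1n mulrSr -[in X in _ + X]addrA addNr.
Qed.

(** * A monic recurrence along each fundamental weight *)

Section Recurrence.
Variables (R : realType) (n : nat) (Phi : {fset 'rV[R]_n}).
Variables (phi : 'rV[R]_n -> R) (alpha omega : 'I_n -> 'rV[R]_n).
Hypothesis rb : root_basis Phi phi alpha omega.
Variable K : numFieldType.
Let rsP := rb_root_system rb.
Local Notation V := 'rV[R]_n.
Implicit Types (p q r s : V) (A B : 'M[R]_n) (f g : V -> K) (ks : seq 'I_n).
Local Notation W := (weyl Phi).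
Local Notation weight := (weight alpha).
Local Notation weyls := (weyls Phi).
Local Notation orbit_eigen := (orbit_eigen Phi omega).

Lemma sum_weylsl (U : nmodType) B (F : 'M[R]_n -> U) : W B ->
  \sum_(A <- weyls) F (B *m A) = \sum_(A <- weyls) F A.
Proof.
move=> hB; have [hT BT] := weyl_inv rsP hB; have TB := mulmx1C BT.
rewrite [RHS](perm_big [seq B *m A | A <- weyls]) ?big_map //.
apply: uniq_perm; rewrite ?fset_uniq //.
  rewrite map_inj_uniq ?fset_uniq // => A A' /(congr1 (mulmx B^T)).
  by rewrite !mulmxA TB !mul1mx.
move=> A; apply/idP/mapP => [/(in_weyls rb) hA|[C /(in_weyls rb) hC ->]].
  exists (B^T *m A); last by rewrite mulmxA BT mul1mx.
  by apply/(in_weyls rb); exact: weylM.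
by apply/(in_weyls rb); exact: weylM.
Qed.

(** On an invariant eigenfunction, the linear form encoded by [l] in [orbit_repr] is this scalar
    times the value at 0. *)
Definition ev (c : 'I_n -> K) (l : seq (K * seq 'I_n)) :=
  \sum_(x <- l) x.1 * \prod_(k <- x.2) c k.

(** As a function of [p] the sum is invariant and again an eigenfunction, so its value at [p] is
    reduced to the one at 0, where every term is [f q]. The list depends on [p] alone, which makes
    later bounds uniform. *)
Lemma orbit_average p : weight p -> exists l, forall c f q, orbit_eigen c f ->
  \sum_(A <- weyls) f (q + p *m A) = ev c l * ((size weyls)%:R * f q).
Proof.
move=> /(orbit_repr_eval rb K)[l hl]; exists l => c f q fE.
pose g p := \sum_(A <- weyls) f (q + p *m A).
have gE : orbit_eigen c g.
  move=> k x; rewrite /osum /g exchange_big mulr_sumr.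
  apply: eq_big_seq => A /(in_weyls rb) hA; rewrite -fE /osum.
  rewrite [RHS](perm_big _ (orb_perm rb k hA)) big_map.
  by apply: eq_bigr => r _; rewrite mulmxDl addrA.
rewrite -/(g p) hl /ev; last first.
  move=> B x hB; rewrite /g -[RHS](sum_weylsl _ hB).
  by apply: eq_bigr => A _; rewrite mulmxA.
rewrite mulr_suml; apply: eq_bigr => x _; rewrite (osums_eigen _ _ gE) mulrA.
congr (_ * _); rewrite /g (eq_bigr (fun=> f q)) => [|A _].
  by rewrite big_const_seq count_predT iter_addr_0 mulr_natl.
by rewrite mul0mx addr0.
Qed.

(* This is the product over A in W of the differences of the shifts by omega k and
   by omega k *m A, expanded over subsets S of W and averaged over W: the average
   turns the shift by the sum over S into the scalar [ev c (b S)]. *)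
Lemma orbit_recurrence k : exists b : {set weyls} -> seq (K * seq 'I_n),
  b finset.set0 = [:: (1, [::])] /\ forall c f q, orbit_eigen c f ->
  \sum_(S : {set weyls}) (-1) ^+ #|S| * ev c (b S) * f (q + omega k *+ #|~: S|) = 0.
Proof.
pose sg (S : {set weyls}) := \sum_(A in S) omega k *m val A.
have sgw S : weight (sg S).
  rewrite /sg; elim/big_rec: _ => [|A x _ hx]; first exact: weight0.
  apply: weightD => //; apply: (weight_weyl rb); last exact: (weight_omega rb).
  exact/(in_weyls rb)/valP.
(* The empty set carries the highest shift; pinning its list to the constant 1 makes the recurrence
   monic. *)
have /choice[b hb] : forall S, exists l, (S = finset.set0 -> l = [:: (1, [::])]) /\
    forall c f q, orbit_eigen c f ->
    \sum_(A <- weyls) f (q + sg S *m A) = ev c l * ((size weyls)%:R * f q).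
  move=> S; have [->|ne] := eqVneq S finset.set0; last first.
    by have [l hl] := orbit_average (sgw S); exists l; split=> // /eqP; rewrite (negbTE ne).
  exists [:: (1, [::])]; split=> // c f q _; rewrite /ev big_seq1 big_nil !mul1r.
  rewrite (eq_bigr (fun=> f q)) => [|A _].
    by rewrite big_const_seq count_predT iter_addr_0 mulr_natl.
  by rewrite /sg finset.big_set0 mul0mx addr0.
exists b; split=> [|c f q fE]; first by have [->] := hb finset.set0.
have W0 : (size weyls)%:R != 0 :> K by rewrite pnatr_eq0 -lt0n (size_weyls_gt0 rb).
apply: (mulfI W0); rewrite mulr0 mulr_sumr.
transitivity (\sum_(S : {set weyls}) \sum_(A <- weyls)
    (-1) ^+ #|S| * f (q + omega k *+ #|~: S| + sg S *m A)).
  apply: eq_bigr => S _; rewrite -mulr_sumr; have [_ h] := hb S; rewrite (h c) //.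
  by rewrite -[in LHS]mulrA [LHS]mulrCA; congr (_ * _); rewrite mulrCA.
rewrite exchange_big big1_seq // => A /andP[_ /(in_weyls rb) hA].
have [hT AT] := weyl_inv rsP hA.
have x0P : A^T \in weyls by apply/(in_weyls rb).
(* For fixed [A], the factor of the product indexed by [A^T], the inverse of [A], compares [omega k]
   with itself and so is zero. *)
rewrite -[RHS](@sum_sets_toggle _ _ _ (fun B : weyls => omega k *m val B *m A)
  (omega k) [` x0P]%fset (fun x => f (q + x))) /=; last first.
  by rewrite -mulmxA (mulmx1C AT) mulmx1.
apply: eq_bigr => S _; rewrite addrA; congr (_ * f (_ + _)).
by rewrite /sg mulmx_suml.
Qed.

(** Along the multiples of [omega k] the function is geometric of ratio [z], so [z] is a root of the
    monic polynomial of the recurrence. Its size is at most 1 plus the sum of the sizes of the lower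
    coefficients, and these are bounded through [ev] by [B]. *)
Lemma eigen_bound k (B : K) : exists M : K, forall c f z,
  (forall j, `|c j| <= B) -> orbit_eigen c f -> f 0 != 0 ->
  (forall p, f (p + omega k) = z * f p) -> `|z| <= M.
Proof.
have [b [b0 hb]] := orbit_recurrence k.
pose D := \sum_(S : {set weyls}) \sum_(x <- b S) `|x.1| * \prod_(k <- x.2) `|B|.
exists (1 + D) => c f z cB fE f0 fz.
have D0 : 0 <= D.
  by do 2![apply: sumr_ge0 => ? _]; rewrite mulr_ge0 // prodr_ge0.
have evD : \sum_(S : {set weyls}) `|ev c (b S)| <= D.
  apply: ler_sum => S _; apply: le_trans (ler_norm_sum _ _ _) _.
  apply: ler_sum => x _; rewrite normrM ler_wpM2l // normr_prod.
  apply: ler_prod => j _; rewrite normr_ge0 /= (le_trans (cB j)) //.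
  by rewrite real_ler_norm // ger0_real // (le_trans _ (cB j)).
have fzm m : f (omega k *+ m) = z ^+ m * f 0.
  elim: m => [|m IH]; first by rewrite mulr0n mul1r.
  by rewrite mulrSr fz IH mulrA -exprS.
have [z1|z1] := real_leP (normr_real z) (real1 K).
  by rewrite (le_trans z1) // lerDl.
have m0 : (0 < #|{: weyls}|)%N by rewrite -cardfE (size_weyls_gt0 rb).
set m := #|{: weyls}| in m0.
have rec : z ^+ m = - \sum_(S : {set weyls} | S != finset.set0)
    (-1) ^+ #|S| * ev c (b S) * z ^+ #|~: S|.
  apply/eqP; rewrite -addr_eq0; apply/eqP/(mulIf f0).
  rewrite mul0r -[RHS](hb c f 0 fE) [RHS](bigD1 finset.set0) //= mulrDl mulr_suml.
  congr (_ + _); last by apply: eq_bigr => S _; rewrite add0r fzm mulrA.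
  rewrite cards0 b0 /ev big_seq1 big_nil !mul1r add0r finset.setC0 cardsT -fzm.
  by congr (f (_ *+ _)).
have : `|z| ^+ m <= `|z| ^+ m.-1 * D.
  rewrite -normrX rec normrN; apply: le_trans (ler_norm_sum _ _ _) _.
  apply: le_trans (ler_wpM2l _ evD); last by rewrite exprn_ge0.
  rewrite mulr_sumr [leRHS](bigID (fun S => S == finset.set0)) /= addrC.
  rewrite -[leLHS]addr0; apply: lerD; last first.
    by apply: sumr_ge0 => S _; rewrite mulr_ge0 // exprn_ge0.
  apply: ler_sum => S S0; rewrite !normrM normrX normrN1 expr1n mul1r mulrC.
  rewrite normrX ler_wpM2r // ler_eXn2l ?ltW //.
  rewrite -ltnS prednK // -/m (cardsCs (~: S)) finset.setCK ltn_subrL m0.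
  by rewrite card_gt0 S0.
rewrite -{1}(prednK m0) exprS mulrC ler_pM2l ?exprn_gt0 ?(lt_trans ltr01) //.
by move=> zD; rewrite (le_trans zD) // lerDr.
Qed.

End Recurrence.

(** * Polynomials in a shift and common eigenvectors *)

Section ShiftPolynomials.
Variables (V : zmodType) (K : closedFieldType) (w : V).
Implicit Types (f g : V -> K) (Q : {poly K}).

Definition shift_poly Q f p := \sum_(i < size Q) Q`_i * f (p + w *+ i).

Lemma shift_poly_wide Q f p N : (size Q <= N)%N ->
  shift_poly Q f p = \sum_(i < N) Q`_i * f (p + w *+ i).
Proof.
move=> QN; rewrite /shift_poly (big_ord_widen N (fun i => Q`_i * f (p + w *+ i))) //.
rewrite big_mkcond; apply: eq_bigr => i _; case: ltnP => // iQ.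
by rewrite nth_default // mul0r.
Qed.

Lemma shift_polyMX Q f p :
  shift_poly (Q * 'X) f p = shift_poly Q (fun q => f (q + w)) p.
Proof.
rewrite (@shift_poly_wide (Q * 'X) f p (size Q).+1); last first.
  by apply: leq_trans (size_polyMleq _ _) _; rewrite size_polyX addn2.
rewrite big_ord_recl coefMX eqxx mul0r add0r; apply: eq_bigr => i _.
by rewrite coefMX /= -addrA -mulrSr.
Qed.

Lemma shift_polyZ a Q f p :
  shift_poly (a *: Q) f p = a * shift_poly Q f p.
Proof.
rewrite (@shift_poly_wide (a *: Q) f p (size Q)) ?size_scale_leq //.
by rewrite /shift_poly mulr_sumr; apply: eq_bigr => i _; rewrite coefZ mulrA.
Qed.

Lemma shift_polyD Q1 Q2 f p :
  shift_poly (Q1 + Q2) f p = shift_poly Q1 f p + shift_poly Q2 f p.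
Proof.
pose N := maxn (size Q1) (size Q2).
rewrite !(@shift_poly_wide _ f p N) ?leq_maxl ?leq_maxr ?size_polyD //.
by rewrite -big_split; apply: eq_bigr => i _; rewrite coefD mulrDl.
Qed.

Lemma shift_polyXn j f p : shift_poly 'X^j f p = f (p + w *+ j).
Proof.
rewrite /shift_poly size_polyXn big_ord_recr /= coefXn eqxx mul1r big1 ?add0r //.
by move=> i _; rewrite coefXn (ltn_eqF (ltn_ord i)) mul0r.
Qed.

Lemma shift_poly_sum (I : finType) (a : I -> K) (j : I -> nat) f p :
  shift_poly (\sum_i a i *: 'X^(j i)) f p = \sum_i a i * f (p + w *+ j i).
Proof.
elim/big_rec2: _ => [|i y Q _ <-].
  by rewrite /shift_poly size_poly0 big_ord0.
by rewrite shift_polyD shift_polyZ shift_polyXn.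
Qed.

(** The linear factors are applied one at a time: the last function before zero is an eigenvector
    for the factor that kills it. [P] collects what the factors must preserve. *)
Lemma shift_poly_prod_eigen (P : (V -> K) -> Prop) (ts : seq K) f :
    (forall g t, P g -> P (fun p => g (p + w) - t * g p)) ->
    P f -> (exists p, f p != 0) ->
    (forall p, shift_poly (\prod_(t <- ts) ('X - t%:P)) f p = 0) ->
  exists g t, [/\ P g, exists p, g p != 0 & forall p, g (p + w) = t * g p].
Proof.
move=> hP; elim: ts f => [|t ts IH] f Pf [p0 fp0] f0.
  have := f0 p0; rewrite big_nil /shift_poly size_poly1 big_ord1 coefC mul1r.
  by rewrite mulr0n addr0 => /eqP; rewrite (negbTE fp0).
pose g p := f (p + w) - t * f p.
have [[p gp]|ng] := pselect (exists p, g p != 0); last first.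
  exists f, t; split=> //; first by exists p0.
  move=> p; apply/eqP; rewrite -subr_eq0 -/(g p); apply/negPn/negP => gp.
  by apply: ng; exists p.
apply: (IH g) => [||q]; [exact: hP | by exists p |].
set Q := \prod_(_ <- ts) _; rewrite -[RHS](f0 q) big_cons mulrC mulrBr -/Q.
rewrite [Q * t%:P]mulrC mul_polyC -scaleNr shift_polyD shift_polyMX shift_polyZ.
rewrite /shift_poly mulr_sumr -big_split; apply: eq_bigr => i _.
by rewrite /g addrAC /=; ring.
Qed.

End ShiftPolynomials.

Section CommonEigenfunction.
Variables (R : realType) (n : nat) (Phi : {fset 'rV[R]_n}).
Variables (phi : 'rV[R]_n -> R) (alpha omega : 'I_n -> 'rV[R]_n).
Hypothesis rb : root_basis Phi phi alpha omega.
Variable K : numClosedFieldType.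
Implicit Types (p q : 'rV[R]_n) (f g : 'rV[R]_n -> K).
Local Notation orbit_eigen := (orbit_eigen Phi omega).

Lemma orbit_eigen_shift c f w t : orbit_eigen c f ->
  orbit_eigen c (fun p => f (p + w) - t * f p).
Proof.
move=> fE k p; rewrite mulrBr mulrCA -!fE /osum mulr_sumr -sumrB.
by apply: eq_bigr => r _; rewrite (addrAC p w).
Qed.

(* The recurrence makes the shift by omega k algebraic on eigenfunctions, so that
   an eigenvector of it can be picked for each k in turn. *)
Lemma common_eigen c : exists f t, [/\ orbit_eigen c f, exists p, f p != 0 &
  forall k p, f (p + omega k) = t k * f p].
Proof.
suff [f [t [fE f0 ft]]] : exists f t, [/\ orbit_eigen c f, exists p, f p != 0 &
  forall k p, k \in enum 'I_n -> f (p + omega k) = t k * f p].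
  by exists f, t; split=> // k p; apply: ft; rewrite mem_enum.
elim: (enum 'I_n) => [|k ks [f [t [fE f0 ft]]]].
  have [f [fE _ f1]] := exists_orbit_eigen rb c.
  by exists f, (fun=> 0); split=> //; exists 0; rewrite f1 oner_eq0.
have [b [b0 hb]] := orbit_recurrence rb K k.
pose a (S : {set weyls Phi}) := (-1) ^+ #|S| * ev c (b S).
pose Q := \sum_(S : {set weyls Phi}) a S *: 'X^#|~: S|.
have Qf p : shift_poly (omega k) Q f p = 0 by rewrite shift_poly_sum; exact: hb.
(* The top degree is reached by the empty set only, with coefficient 1. *)
have Q0 : Q != 0.
  apply/eqP => /(congr1 (fun q : {poly K} => q`_#|{: weyls Phi}|)).
  rewrite coef0 /Q coef_sum (bigD1 finset.set0) //= coefZ coefXn.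
  rewrite finset.setC0 cardsT eqxx /a cards0 b0 /ev big_seq1 big_nil !mulr1.
  rewrite big1 ?addr0 => [/eqP|S S0]; first by rewrite oner_eq0.
  rewrite coefZ coefXn -(cardsC S) -{2}[#|~: S|]add0n eqn_add2r.
  by rewrite cards_eq0 (negbTE S0) mulr0.
have [ts tsE] := closed_field_poly_normal Q.
(* Shifts commute, so a linear factor in the shift by [omega k] preserves the eigenvalues already
   fixed for the earlier weights. *)
pose P g := orbit_eigen c g /\ forall j p, j \in ks -> g (p + omega j) = t j * g p.
have [||||g [u [[gE gt] g0 gu]]] := @shift_poly_prod_eigen _ _ (omega k) P ts f.
- move=> g u [gE gt]; split; first exact: orbit_eigen_shift.
  by move=> j p jk; rewrite (addrAC p) !(gt j) // mulrBr mulrCA.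
- by [].
- by [].
- move=> p; have /eqP := Qf p; rewrite tsE shift_polyZ mulf_eq0 lead_coef_eq0.
  by rewrite (negbTE Q0) => /eqP.
exists g, (fun j => if j == k then u else t j); split=> // j p.
by rewrite inE; case: eqP => [->|_ /= jk]; [rewrite gu | rewrite gt].
Qed.

End CommonEigenfunction.

(** Dedekind's elimination: the relation at p + q minus [chi i p] times the relation at q loses the
    term of [chi i] and multiplies [a0] by [f p - chi i p]. The [chi i] must differ from [f] but may
    coincide with one another. *)
Lemma char_independent (V : zmodType) (K : fieldType) (D : V -> Prop)
    (I : eqType) (f : V -> K) (chi : I -> V -> K) (s : seq I) (a0 : K) (a : I -> K) :
  D 0 -> (forall p q, D p -> D q -> D (p + q)) ->
  f 0 = 1 -> (forall p q, D p -> D q -> f (p + q) = f p * f q) ->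
  (forall i, i \in s -> (forall p q, D p -> D q -> chi i (p + q) = chi i p * chi i q) /\
     exists2 p, D p & chi i p != f p) ->
  (forall p, D p -> a0 * f p + \sum_(i <- s) a i * chi i p = 0) -> a0 = 0.
Proof.
move=> D0 DD f1 fM; elim: s a0 a => [|i s IH] a0 a hs h0.
  by have := h0 0 D0; rewrite big_nil addr0 f1 mulr1.
have [|iM [p Dp ip]] := hs i; first by rewrite inE eqxx.
have : a0 * (f p - chi i p) = 0.
  apply: (IH _ (fun j => a j * (chi j p - chi i p))) => [j js|q Dq].
    by apply: hs; rewrite inE js orbT.
  have := h0 _ (DD _ _ Dp Dq); have := h0 _ Dq; rewrite !big_cons fM // iM //.
  move=> e1 e2; transitivity (0 - chi i p * 0); last by rewrite mulr0 subr0.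
  rewrite -[X in _ = X - _]e2 -[X in _ = _ - _ * X]e1.
  transitivity (a0 * (f p - chi i p) * f q +
      (\sum_(j <- s) a j * chi j (p + q) - \sum_(j <- s) chi i p * (a j * chi j q))).
    rewrite -sumrB; congr (_ + _); apply: eq_big_seq => j js.
    have [|jM _] := hs j; first by rewrite inE js orbT.
    by rewrite jM //; ring.
  by rewrite -mulr_sumr; ring.
by move/eqP; rewrite mulf_eq0 subr_eq0 (eq_sym (f p)) (negbTE ip) orbF => /eqP.
Qed.

(** * Surjectivity and fibres of the generalized cosine *)

Section ComplexExponential.
Variable R : realType.
Implicit Types z w : R[i].
Local Notation twopii := (Complex (0 : R) (2 * pi)).

Lemma cexpD z w : cexp (z + w) = cexp z * cexp w.
Proof.
case: z w => [a b] [c d] /=; rewrite expRD cosD sinD.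
by congr Complex; ring.
Qed.

Lemma cexp0 : cexp (0 : R[i]) = 1.
Proof. by rewrite /cexp /= expR0 cos0 sin0 mulr0 mul1r. Qed.

Lemma norm_cexp z : `|cexp z| = (expR (complex.Re z))%:C%C.
Proof.
case: z => [a b]; rewrite normc_def /= !exprMn -mulrDr cos2Dsin2 mulr1.
by rewrite sqrtr_sqr ger0_norm ?expR_ge0.
Qed.

Lemma cexp_neq0 z : cexp z != 0.
Proof.
by rewrite -normr_eq0 norm_cexp -[0]/(0%:C%C) (inj_eq (@complexI _)) gt_eqF ?expR_gt0.
Qed.

Lemma cos_sin_2pi_int (m : int) :
  cos (2 * pi * m%:~R) = 1 :> R /\ sin (2 * pi * m%:~R) = 0 :> R.
Proof.
have nat_case (k : nat) : cos (2 * pi * k%:R) = 1 :> R /\ sin (2 * pi * k%:R) = 0 :> R.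
  elim: k => [|k [c s]]; first by rewrite mulr0 cos0 sin0.
  rewrite (_ : 2 * pi * k.+1%:R = 2 * pi * k%:R + pi *+ 2); last first.
    by rewrite -natr1; ring.
  by rewrite cosD2pi sinD2pi.
case: m => k; first exact: nat_case.
have [c s] := nat_case k.+1.
by rewrite NegzE rmorphN /= mulrN cosN sinN c s oppr0.
Qed.

Lemma cos1_2pi (x : R) : cos (2 * pi * x) = 1 -> x \is a Num.int.
Proof.
set m := Num.floor x => cx.
have [mx xm] : m%:~R <= x /\ x < m%:~R + 1.
  by have := floor_le x; have := floorD1_gt x; rewrite rmorphD /=.
have [cm sm] := cos_sin_2pi_int m.
have p0 : 0 < pi :> R := pi_gt0 R.
(* Half the angle of the fractional part of [x]: cos (2y) = 1 gives sin y = 0, impossible for 0 < y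
   < pi. *)
set y := pi * (x - m%:~R).
have cy : cos (y *+ 2) = 1.
  rewrite (_ : y *+ 2 = 2 * pi * x - 2 * pi * m%:~R); last by rewrite /y; ring.
  by rewrite cosB cx cm sm mulr0 addr0 mul1r.
have sy : sin y = 0.
  move: cy; rewrite cos_mulr2n cos2sin2 => e.
  by apply/eqP; rewrite -sqrf_eq0; apply/eqP; lra.
suff -> : x = m%:~R by exact: intr_int.
apply/eqP; rewrite eq_le mx andbT leNgt; apply/negP => mlt.
have : 0 < sin y.
  apply: sin_gt0_pi; rewrite /y mulr_gt0 ?subr_gt0 //= gtr_pMr //.
  by rewrite ltrBlDl.
by rewrite sy ltxx.
Qed.

Lemma cexp_2pii_eq1 z : cexp (twopii * z) = 1 <-> exists m : int, z = m%:~R.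
Proof.
have intrC (m : int) : m%:~R = (m%:~R)%:C%C :> R[i].
  by rewrite (rmorph_int (real_complex R)).
case: z => [a b]; split=> [h|[m]]; last first.
  rewrite intrC => -[-> ->] /=; have [c s] := cos_sin_2pi_int m.
  by rewrite !mul0r !mulr0 subr0 add0r expR0 c s mul1r mulr0.
have := congr1 (fun z => `|z|) h; rewrite norm_cexp normr1 /= => -[].
rewrite mul0r sub0r -[X in _ = X]expR0 => /expR_inj/eqP.
rewrite oppr_eq0 mulf_eq0 mulf_eq0 pnatr_eq0 (gt_eqF (pi_gt0 R)) /= => /eqP b0.
move: h; rewrite /= b0 mul0r mulr0 mul0r subr0 expR0 add0r mul1r => -[/cos1_2pi].
by move=> /intrP[m ->] _; exists m; rewrite intrC.
Qed.

Lemma cexp_2pii_onto z : z != 0 -> exists w, cexp (twopii * w) = z.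
Proof.
case: z => [a b] z0; set r := Num.sqrt (a ^+ 2 + b ^+ 2).
have r2 : r ^+ 2 = a ^+ 2 + b ^+ 2 by rewrite sqr_sqrtr // addr_ge0 ?sqr_ge0.
have r0 : 0 < r.
  rewrite lt_def sqrtr_ge0 andbT -sqrf_eq0 r2 paddr_eq0 ?sqr_ge0 // !sqrf_eq0.
  by apply: contra z0 => /andP[/eqP-> /eqP->].
have uv : (a / r) ^+ 2 + (b / r) ^+ 2 = 1.
  by rewrite !exprMn -mulrDl exprVn -r2 divff // sqrf_eq0 gt_eqF.
have u1 : -1 <= a / r <= 1.
  rewrite -ler_norml -(@ler_pXn2r _ 2) ?nnegrE ?ler01 // expr1n real_normK ?num_real //.
  by rewrite -uv lerDl sqr_ge0.
have [t [ct st]] : exists t, cos t = a / r /\ sin t = b / r.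
  have s1 : sin (acos (a / r)) = `|b / r|.
    by rewrite sin_acos // -uv [_ ^+ 2 + _]addrC addrK sqrtr_sqr.
  have [b0|b0] := leP 0 (b / r).
    by exists (acos (a / r)); rewrite acosK ?in_itv //= s1 ger0_norm.
  by exists (- acos (a / r)); rewrite cosN sinN acosK ?in_itv //= s1 ltr0_norm ?opprK.
have p0 : 2 * pi != 0 :> R by rewrite mulf_neq0 ?pnatr_eq0 // gt_eqF ?pi_gt0.
exists (Complex (t / (2 * pi)) (- ln r / (2 * pi))).
rewrite /= !mul0r sub0r add0r !(mulrC (2 * pi)) !divfK // opprK.
by rewrite lnK ?posrE // ct st !(mulrC r) !divfK // gt_eqF.
Qed.

End ComplexExponential.

Section ComplexPoints.
Variables (R : realType) (n : nat).
Local Notation C := R[i].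
Implicit Types (r s v : 'rV[R]_n) (x y : 'rV[C]_n) (A B : 'M[R]_n).

Definition cmx (m : nat) (A : 'M[R]_(m, n)) : 'M[C]_(m, n) := map_mx (real_complex R) A.

Lemma cdotE v x : x *m (cvec v)^T = (cdot (cvec v) x)%:M.
Proof.
apply/matrixP => i j; rewrite !ord1 !mxE mulr1n /cdot.
by apply: eq_bigr => k _; rewrite !mxE /= oppr0 mulrC.
Qed.

Lemma cdotP v x : cdot (cvec v) x = (x *m (cvec v)^T) 0 0.
Proof. by rewrite cdotE mxE mulr1n. Qed.

Lemma cvecD r s : cvec (r + s) = cvec r + cvec s.
Proof. exact: map_mxD. Qed.

Lemma cvecN r : cvec (- r) = - cvec r.
Proof. exact: map_mxN. Qed.

Lemma cvecZ a r : cvec (a *: r) = a%:C%C *: cvec r.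
Proof. exact: map_mxZ. Qed.

Lemma cvec0 : cvec (0 : 'rV[R]_n) = 0.
Proof. exact: map_mx0. Qed.

Lemma cvec_sum (I : finType) (F : I -> 'rV[R]_n) :
  cvec (\sum_i F i) = \sum_i cvec (F i).
Proof. exact: raddf_sum. Qed.

Lemma cvec_mulmx r A : cvec (r *m A) = cvec r *m cmx A.
Proof. exact: map_mxM. Qed.

Lemma cmxM A B : cmx (A *m B) = cmx A *m cmx B.
Proof. exact: map_mxM. Qed.

Lemma cmx1 : cmx (1%:M : 'M[R]_n) = 1%:M.
Proof. exact: map_mx1. Qed.

Lemma cdotDl r s x : cdot (cvec (r + s)) x = cdot (cvec r) x + cdot (cvec s) x.
Proof. by rewrite !cdotP cvecD linearD mulmxDr mxE. Qed.

Lemma cdotZl a r x : cdot (cvec (a *: r)) x = a%:C%C * cdot (cvec r) x.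
Proof. by rewrite !cdotP cvecZ linearZ /= -scalemxAr mxE. Qed.

Lemma cdotDr r x y : cdot (cvec r) (x + y) = cdot (cvec r) x + cdot (cvec r) y.
Proof. by rewrite !cdotP mulmxDl mxE. Qed.

Lemma cdotZr r a x : cdot (cvec r) (a *: x) = a * cdot (cvec r) x.
Proof. by rewrite !cdotP -scalemxAl mxE. Qed.

Lemma cdot_sumr r (I : finType) (F : I -> 'rV[C]_n) :
  cdot (cvec r) (\sum_i F i) = \sum_i cdot (cvec r) (F i).
Proof.
rewrite cdotP mulmx_suml summxE; apply: eq_bigr => i _.
by rewrite cdotP.
Qed.

Lemma cdot_mulmx r x A : cdot (cvec (r *m A)) x = cdot (cvec r) (x *m cmx A^T).
Proof.
rewrite !cdotP cvec_mulmx trmx_mul mulmxA; congr ((_ *m _ *m _) 0 0).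
by rewrite /cmx map_trmx.
Qed.

Lemma creflectionE v l x : v != 0 ->
  creflection (cvec v) l x = x *m cmx (rmx v) + cvec (l *: coroot v).
Proof.
move=> v0; have d0 : (dot v v)%:C%C != 0 :> C.
  by rewrite -[0]/(0%:C%C) (inj_eq (@complexI _)) dot_eq0.
rewrite /creflection cdot_cvec.
have -> : x *m cmx (rmx v) = x - (2 * (cdot (cvec v) x / (dot v v)%:C%C)) *: cvec v.
  have -> : cmx (rmx v) = 1%:M - (2 / (dot v v)%:C%C) *: ((cvec v)^T *m cvec v).
    rewrite /cmx /rmx map_mxB map_mx1 map_mxZ map_mxM map_trmx.
    by congr (_ - _ *: _); rewrite rmorphM /= fmorphV [2%:C%C](rmorph_nat (real_complex R)).
  rewrite mulmxBr mulmx1 -scalemxAr mulmxA cdotE mul_scalar_mx scalerA.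
  by congr (_ - _ *: _); rewrite mulrAC mulrA.
rewrite /coroot scalerA cvecZ -addrA; congr (_ + _).
rewrite -[in RHS]scaleNr -scaleNr -scalerDl; congr (_ *: _).
rewrite !rmorphM /= fmorphV [2%:C%C](rmorph_nat (real_complex R)).
by field.
Qed.

Definition echar r x : C := cexp (Complex 0 (2 * pi) * cdot (cvec r) x).

Lemma echarDl r s x : echar (r + s) x = echar r x * echar s x.
Proof. by rewrite /echar cdotDl mulrDr cexpD. Qed.

Lemma echarDr r x y : echar r (x + y) = echar r x * echar r y.
Proof. by rewrite /echar cdotDr mulrDr cexpD. Qed.

Lemma echar0 x : echar 0 x = 1.
Proof. by rewrite -(scale0r (0 : 'rV_n)) /echar cdotZl mul0r mulr0 cexp0. Qed.

Lemma echar_mulmx r x A : echar (r *m A) x = echar r (x *m cmx A^T).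
Proof. by rewrite /echar cdot_mulmx. Qed.

Lemma echar_neq0 r x : echar r x != 0.
Proof. exact: cexp_neq0. Qed.

Lemma echar_cvec_int r q : dot r q \is a Num.int -> echar r (cvec q) = 1.
Proof.
move=> /intrP[m e]; apply/cexp_2pii_eq1; exists m.
by rewrite cdot_cvec e (rmorph_int (real_complex R)).
Qed.

End ComplexPoints.

(** * The finite and affine groups as affine maps *)

Section GeneratedGroups.
Variables (G : groupType) (S : set G).

Lemma generated_sub (g : G) : S g -> generated_group S g.
Proof. by move=> Sg H [_]; exact. Qed.

Lemma generated1 : generated_group S 1%g.
Proof. exact/set_mem/(generated_group_closed S).1. Qed.

Lemma generatedM (g h : G) : generated_group S g -> generated_group S h ->
  generated_group S (g * h)%g.
Proof.
move=> hg hh; apply/set_mem/(group_closedM (generated_group_closed S)); exact/mem_set.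
Qed.

Lemma generatedV (g : G) : generated_group S g -> generated_group S (g^-1)%g.
Proof.
by move=> hg; apply/set_mem/(group_closedV (generated_group_closed S))/mem_set.
Qed.

Lemma generated_ind (P : G -> Prop) : P 1%g ->
  (forall g h, P g -> P h -> P (g * h)%g) -> (forall g, P g -> P (g^-1)%g) ->
  (forall g, S g -> P g) -> forall g, generated_group S g -> P g.
Proof.
move=> P1 PM PV PS g; apply: smallest_sub; last exact: PS.
split; first exact/mem_set.
by move=> u v /set_mem Pu /set_mem Pv; apply/mem_set/PM => //; exact: PV.
Qed.

End GeneratedGroups.

Section GroupForms.
Variables (R : realType) (n : nat) (Phi : {fset 'rV[R]_n}).
Hypothesis rsP : root_system Phi.
Local Notation C := R[i].
Implicit Types (x y : 'rV[C]_n) (A B : 'M[R]_n) (g : bijection 'rV[C]_n).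
Local Notation W := (weyl Phi).

Lemma cmx_weylKT A x : W A -> x *m cmx A^T *m cmx A = x.
Proof.
by move=> /(weyl_inv rsP)[_ /mulmx1C e]; rewrite -mulmxA -cmxM e cmx1 mulmx1.
Qed.

Lemma reflection0E v x : v \in Phi ->
  reflection (cvec v) 0 x = x *m cmx (rmx v).
Proof.
move=> /(root_neq0 rsP) v0.
by rewrite /= creflectionE // scale0r cvec0 addr0.
Qed.

Lemma weyl_group_mx g : weyl_group Phi g -> exists2 A, W A & g =1 mulmx^~ (cmx A).
Proof.
move: g; apply: (generated_ind
  (P := fun g => exists2 A, W A & bij_fun g =1 mulmx^~ (cmx A))).
- by exists 1%:M; [exact: weyl1 | move=> x /=; rewrite cmx1 mulmx1].
- move=> h k [A hA hE] [B hB kE]; exists (B *m A); first exact: weylM.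
  by move=> x; rewrite cmxM mulmxA -kE -hE.
- move=> h [A hA hE]; exists A^T; first by have [] := weyl_inv rsP hA.
  move=> x; rewrite -[x in LHS](cmx_weylKT x hA) -hE.
  exact: (bij_funK h).
- move=> h [v vP ->]; exists (rmx v); first exact: weyl_rmx.
  by move=> x; exact: reflection0E.
Qed.

Lemma weyl_mx_group A : W A -> exists2 g, weyl_group Phi g & g =1 mulmx^~ (cmx A).
Proof.
case=> s + ->; elim: s => [_|v s IH /= /andP[vP /IH[g hg gE]]].
  by exists 1%g; [exact: generated1 | move=> x /=; rewrite cmx1 mulmx1].
exists (reflection (cvec v) 0 * g)%g.
  by apply: generatedM => //; apply: generated_sub; exists v.
by move=> x; rewrite cmxM mulmxA -gE -reflection0E.
Qed.

Lemma weyl_orbitE r : weyl_orbit Phi r = [set cvec (r *m A) | A in W].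
Proof.
apply/seteqP; split=> _ [g hg <-].
  by have [A hA gE] := weyl_group_mx hg; exists A => //; rewrite cvec_mulmx gE.
have [h hh hE] := weyl_mx_group hg; exists h => //.
by rewrite hE cvec_mulmx.
Qed.

End GroupForms.

Section AffineForms.
Variables (R : realType) (n : nat) (Phi : {fset 'rV[R]_n}).
Variables (phi : 'rV[R]_n -> R) (alpha omega : 'I_n -> 'rV[R]_n).
Hypothesis rb : root_basis Phi phi alpha omega.
Let rsP := rb_root_system rb.
Local Notation C := R[i].
Implicit Types (p q : 'rV[R]_n) (x y : 'rV[C]_n) (A B : 'M[R]_n).
Local Notation W := (weyl Phi).

(** The coroot lattice, described by integrality against the fundamental weights. *)
Definition lattice q := forall k, dot q (omega k) \is a Num.int.

Lemma latticeD q q' : lattice q -> lattice q' -> lattice (q + q').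
Proof. by move=> h h' k; rewrite dotDl rpredD. Qed.

Lemma latticeN q : lattice q -> lattice (- q).
Proof. by move=> h k; rewrite dotNl rpredN. Qed.

Lemma lattice_weight q p : lattice q -> weight alpha p -> dot p q \is a Num.int.
Proof.
move=> hq hp; rewrite [p](omega_expand rb) dot_suml rpred_sum // => k _.
by rewrite dotZl rpredM // dotC.
Qed.

Lemma lattice_weyl A q : W A -> lattice q -> lattice (q *m A).
Proof.
move=> hA hq k; rewrite (weyl_dotC rsP) // dotC.
apply: lattice_weight => //; apply: (weight_weyl rb); last exact: (weight_omega rb).
by have [] := weyl_inv rsP hA.
Qed.

Lemma lattice_coroot v : v \in Phi -> lattice (coroot v).
Proof. by move=> vP k; rewrite dotC; exact: (omega_coroot_int rb). Qed.

Local Notation gens := [set g : bijection 'rV[C]_n |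
    exists2 v, v \in Phi & exists l : int, g = reflection (cvec v) l%:~R].

Lemma affine_form (g : affine_weyl_group Phi) : exists A q,
  [/\ W A, lattice q & val g =1 fun x => x *m cmx A + cvec q].
Proof.
have : generated_group gens (val g) by exact/set_mem/(valP g).
move: (val g) => {}g; move: g; apply: (generated_ind
  (P := fun g => exists A q, [/\ W A, lattice q &
    bij_fun g =1 fun x => x *m cmx A + cvec q])).
- exists 1%:M, 0; split; [exact: weyl1 | by move=> k; rewrite dot0l | ].
  by move=> x /=; rewrite cmx1 mulmx1 cvec0 addr0.
- move=> h k [A [q [hA hq hE]]] [B [q' [hB hq' kE]]].
  exists (B *m A), (q' *m A + q); split; first exact: weylM.
    by apply: latticeD => //; exact: lattice_weyl.
  move=> x; rewrite cmxM mulmxA cvecD addrA cvec_mulmx -mulmxDl -kE.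
  by rewrite -[LHS]/(h (k x)) hE.
- move=> h [A [q [hA hq hE]]]; have [hT AT] := weyl_inv rsP hA.
  exists A^T, (- (q *m A^T)); split=> //.
    by apply: latticeN; exact: lattice_weyl.
  move=> x; rewrite cvecN cvec_mulmx -mulmxBl; apply: (can_inj (bij_funK h)).
  rewrite -[LHS]/(h (bij_inv h x)) bij_invK.
  rewrite -[X in _ = X]/(h ((x - cvec q) *m cmx A^T)) hE.
  by rewrite (cmx_weylKT rsP) // subrK.
- move=> h [v vP [l ->]]; exists (rmx v), (l%:~R *: coroot v); split.
  + exact: weyl_rmx.
  + by move=> k; rewrite dotZl rpredM ?intr_int // lattice_coroot.
  + by move=> x; rewrite /= creflectionE // (root_neq0 rsP).
Qed.

Lemma generated_translation q : lattice q ->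
  exists2 h : bijection 'rV[C]_n, generated_group gens h & h =1 fun x => x + cvec q.
Proof.
pose T q := exists2 h : bijection 'rV[C]_n,
  generated_group gens h & h =1 fun x => x + cvec q.
have T0 : T 0.
  by exists 1%g; [exact: generated1 | move=> x; rewrite cvec0 addr0].
have TD q1 q2 : T q1 -> T q2 -> T (q1 + q2).
  move=> [h hh hE] [k hk kE]; exists (h * k)%g; first exact: generatedM.
  by move=> x; rewrite -[LHS]/(h (k x)) kE hE cvecD addrA addrAC.
have TN q1 : T q1 -> T (- q1).
  move=> [h hh hE]; exists (h^-1)%g; first exact: generatedV.
  move=> x; apply: (can_inj (bij_funK h)).
  rewrite -[LHS]/(h (bij_inv h x)) bij_invK -[RHS]/(h (x + cvec (- q1))) hE.
  by rewrite cvecN subrK.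
have Ta k : T (coroot (alpha k)).
  have aP := alpha_root rb k; have a0 := root_neq0 rsP aP.
  (* Reflections in two parallel hyperplanes, at levels 1 and 0, compose to the translation by the
     coroot. *)
  exists (reflection (cvec (alpha k)) 1%:~R * reflection (cvec (alpha k)) 0%:~R)%g.
    by apply: generatedM; apply: generated_sub; exists (alpha k) => //; eexists.
  move=> x; rewrite -[LHS]/(creflection (cvec (alpha k)) 1%:~R
     (creflection (cvec (alpha k)) 0%:~R x)).
  rewrite [creflection _ 1%:~R _]creflectionE // [X in _ = x + cvec X](_ : _ = 1%:~R *: coroot (alpha k)) ?scale1r //.
  congr (_ + _); rewrite creflectionE // scale0r cvec0 addr0.
  by rewrite -mulmxA -cmxM (rmxK rsP) // cmx1 mulmx1.
have Tm k (m : int) : T (m%:~R *: coroot (alpha k)).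
  have Tn (i : nat) : T (i%:R *: coroot (alpha k)).
    elim: i => [|i IH]; first by rewrite scale0r.
    by rewrite -natr1 scalerDl scale1r; exact: TD.
  case: m => i; first exact: Tn.
  by rewrite NegzE rmorphN scaleNr; apply: TN; exact: Tn.
move=> hq; rewrite [q](coroot_expand rb); elim/big_rec: _ => // k q' _.
by apply: TD; have /intrP[m ->] := hq k; exact: Tm.
Qed.

Lemma affine_exists A q : W A -> lattice q ->
  exists g : affine_weyl_group Phi, val g =1 fun x => x *m cmx A + cvec q.
Proof.
move=> hA /generated_translation[h hh hE].
have [k hk kE] : exists2 k : bijection 'rV[C]_n,
    generated_group gens k & k =1 mulmx^~ (cmx A).
  case: hA => s + ->; elim: s => [_|v s IH /= /andP[vP /IH[k hk kE]]].
    by exists 1%g; [exact: generated1 | move=> x /=; rewrite cmx1 mulmx1].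
  exists (reflection (cvec v) 0%:~R * k)%g.
    by apply: generatedM => //; apply: generated_sub; exists v => //; exists 0.
  by move=> x; rewrite cmxM mulmxA -kE -(reflection0E rsP).
have hP : (h * k)%g \in generated_group gens by apply/mem_set; exact: generatedM.
exists (exist _ (h * k)%g hP) => x; rewrite -[LHS]/(h (k x)) hE kE //.
Qed.

End AffineForms.

(** * Fibres, surjectivity and bounds for the cosine *)

Section GeneralizedCosine.
Variables (R : realType) (n : nat) (Phi : {fset 'rV[R]_n}).
Variables (phi : 'rV[R]_n -> R) (alpha omega : 'I_n -> 'rV[R]_n).
Hypothesis rb : root_basis Phi phi alpha omega.
Let rsP := rb_root_system rb.
Let dual := rb_dual rb.
Local Notation C := R[i].
Implicit Types (p q r : 'rV[R]_n) (x y : 'rV[C]_n) (A B : 'M[R]_n).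
Local Notation W := (weyl Phi).
Local Notation weyls := (weyls Phi).
Local Notation orb := (orb Phi omega).
Local Notation cosine := (generalized_cosine Phi omega).

Lemma cosineE x k : cosine x 0 k = \sum_(r <- orb k) echar r x.
Proof.
rewrite mxE; have -> : weyl_orbit Phi (omega k) = [set` map (@cvec R n) (orb k)].
  rewrite (weyl_orbitE rsP); apply/seteqP; split=> [_ [A hA <-] /=|y /= /mapP[r]].
    by apply: map_f; apply/(orbP rb); exists A.
  by move=> /(orbP rb)[A hA ->] ->; exists A.
rewrite -fsbig_seq ?big_map //.
by rewrite map_inj_uniq ?undup_uniq //; exact: cvec_inj.
Qed.

Lemma echar_lattice A r q x : W A -> weight alpha r -> lattice omega q ->
  echar r (x *m cmx A + cvec q) = echar (r *m A^T) x.
Proof.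
move=> hA hr hq; rewrite echarDr echar_cvec_int ?mulr1 ?echar_mulmx ?trmxK //.
exact: (lattice_weight rb).
Qed.

Lemma cosine_form A q x : W A -> lattice omega q ->
  cosine (x *m cmx A + cvec q) = cosine x.
Proof.
move=> hA hq; have [hT _] := weyl_inv rsP hA.
apply/rowP => k; rewrite !cosineE [RHS](perm_big _ (orb_perm rb k hT)) big_map.
apply: eq_big_seq => r /(orbP rb)[B hB ->]; apply: echar_lattice => //.
by apply: (weight_weyl rb) => //; exact: (weight_omega rb).
Qed.

Lemma cosine_affine (g : affine_weyl_group Phi) x : cosine (val g x) = cosine x.
Proof. by have [A [q [hA hq ->]]] := affine_form rb g; exact: cosine_form. Qed.

Lemma echar_eigen x : orbit_eigen Phi omega (cosine x 0) (fun p => echar p x).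
Proof.
move=> k p; rewrite /osum cosineE mulr_suml; apply: eq_bigr => r _.
by rewrite echarDl mulrC.
Qed.

Lemma echar_mulmx_eigen A x : W A ->
  orbit_eigen Phi omega (cosine x 0) (fun p => echar (p *m A) x).
Proof.
move=> hA; have [hT _] := weyl_inv rsP hA; have l0 : lattice omega 0.
  by move=> k; rewrite dot0l.
rewrite -(cosine_form x hT l0) cvec0 addr0 => k p.
rewrite echar_mulmx -(echar_eigen _ k p).
by apply: eq_bigr => r _; rewrite echar_mulmx.
Qed.

Lemma complex_coroot_expand x :
  x = \sum_k cdot (cvec (omega k)) x *: cvec (coroot (alpha k)).
Proof.
pose Om := \matrix_j omega j; pose Ch := \matrix_k coroot (alpha k).
have e : cmx Om^T *m cmx Ch = 1%:M.
  by rewrite -cmxM -[X in cmx X]trmxK trmx_mul trmxK (mulmx1C (omega_coroot_mx rb))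
    trmx1 cmx1.
rewrite -[LHS]mulmx1 -e mulmxA mulmx_sum_row; apply: eq_bigr => k _.
congr (_ *: _); last by apply/rowP => j; rewrite !mxE.
rewrite cdotP !mxE; apply: eq_bigr => i _; rewrite !mxE //.
Qed.

Lemma echar_weight_eq x y :
  (forall p, weight alpha p -> echar p x = echar p y) ->
  exists2 q, lattice omega q & x = y + cvec q.
Proof.
move=> h; have /choice[m mE] : forall k, exists m : int,
    cdot (cvec (omega k)) (x - y) = m%:~R.
  move=> k; apply/cexp_2pii_eq1; rewrite -/(echar _ _).
  apply: (mulIf (echar_neq0 (omega k) y)); rewrite -echarDr subrK mul1r.
  by apply: h; exact: (weight_omega rb).
exists (\sum_k (m k)%:~R *: coroot (alpha k)).
  move=> j; rewrite dot_suml rpred_sum // => k _.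
  by rewrite dotZl dotC dual rpredM ?intr_int // natr_int.
rewrite -[LHS](subrK y) addrC; congr (_ + _).
rewrite [LHS]complex_coroot_expand cvec_sum; apply: eq_bigr => k _.
rewrite mE [RHS]cvecZ; congr (_ *: _).
by rewrite (rmorph_int (real_complex R)).
Qed.

Definition orbit_char x p := \sum_(A <- weyls) echar (p *m A) x.

(** The difference is invariant, an eigenfunction for the common eigenvalues, and zero at 0; so its
    iterated sums at 0 all vanish. *)
Lemma orbit_char_eq x y : cosine x = cosine y ->
  forall p, weight alpha p -> orbit_char x p = orbit_char y p.
Proof.
move=> xy; pose f p := orbit_char x p - orbit_char y p.
have oW z B p : W B -> orbit_char z (p *m B) = orbit_char z p.
  move=> hB; rewrite /orbit_char -[RHS](sum_weylsl rb _ hB).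
  by apply: eq_bigr => A _; rewrite mulmxA.
have oE z k p : osum Phi omega k (orbit_char z) p = cosine z 0 k * orbit_char z p.
  rewrite /osum /orbit_char exchange_big mulr_sumr; apply: eq_big_seq => A.
  by move=> /(in_weyls rb) hA; rewrite -(echar_mulmx_eigen z hA).
have fE : orbit_eigen Phi omega (cosine x 0) f.
  move=> k p; rewrite /osum sumrB -/(osum Phi omega k (orbit_char x) p).
  by rewrite -/(osum Phi omega k (orbit_char y) p) !oE -xy mulrBr.
have f0 : f 0 = 0.
  rewrite /f /orbit_char -sumrB big1 // => A _.
  by rewrite mul0mx !echar0 subrr.
move=> p hp; apply/eqP; rewrite -subr_eq0; apply/eqP; rewrite -/(f p).
apply: (osums_inj rb) hp; first by move=> A q hA; rewrite /f !oW.
by move=> ks; rewrite (osums_eigen _ _ fE) f0 mulr0.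
Qed.

Lemma cosine_fibre x y : cosine x = cosine y ->
  exists g : affine_weyl_group Phi, val g y = x.
Proof.
move=> xy; have h := orbit_char_eq xy.
suff [A hA e] : exists2 A, W A &
    forall p, weight alpha p -> echar p x = echar p (y *m cmx A).
  have [q hq ->] := echar_weight_eq e; have [g gE] := affine_exists rb hA hq.
  by exists g; rewrite gE.
apply: contrapT => nex.
(* [S] selects the conjugates that equal the character of [x]. If no conjugate of that of [y] equals
   it, independence forces its coefficient [count S weyls] to be 0, although the identity is
   counted. *)
pose S A := `[< forall p, weight alpha p -> echar (p *m A) x = echar p x >].
pose chi (i : 'M[R]_n + 'M[R]_n) p : C :=
  match i with inl A => echar (p *m A) x | inr A => echar (p *m A) y end.
pose a (i : 'M[R]_n + 'M[R]_n) : C := if i is inl _ then 1 else -1.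
pose s := [seq inl A | A <- weyls & ~~ S A] ++ [seq inr A | A <- weyls].
have chiM i p q : chi i (p + q) = chi i p * chi i q.
  by case: i => A /=; rewrite mulmxDl echarDl.
have : (count S weyls)%:R = 0 :> C.
  apply: (@char_independent _ _ (weight alpha) _ (fun p => echar p x) chi s _ a).
  - exact: weight0.
  - exact: weightD.
  - exact: echar0.
  - by move=> p q _ _; exact: echarDl.
  - move=> i is_; split=> [p q _ _|]; first exact: chiM.
    apply: contrapT => ne; have {}ne p : weight alpha p -> chi i p = echar p x.
      by move=> hp; apply: contrapT => /eqP e; apply: ne; exists p.
    move: is_; rewrite mem_cat => /orP[/mapP[A]|/mapP[A]].
      by rewrite mem_filter => /andP[/asboolP nS _] iE; apply: nS => p /ne; rewrite iE.
    move=> /(in_weyls rb) hA iE; apply: nex.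
    have [hT _] := weyl_inv rsP hA; exists A^T => // p hp.
    by rewrite -echar_mulmx -(ne _ hp) iE.
  - move=> p hp; have := h p hp; rewrite /orbit_char (bigID S) /= => e.
    rewrite /s big_cat !big_map /= big_filter.
    under [X in _ + (X + _)]eq_bigr do rewrite mul1r.
    under [X in _ + (_ + X)]eq_bigr do rewrite mulN1r.
    rewrite sumrN -e addrA; apply/eqP; rewrite subr_eq0; apply/eqP; congr (_ + _).
    rewrite (eq_bigr (fun=> echar p x)) => [|A /asboolP]; last exact.
    by rewrite big_const_seq iter_addr_0 mulr_natl.
apply/eqP; rewrite pnatr_eq0 -lt0n -has_count; apply/hasP; exists 1%:M.
  by apply/(in_weyls rb); exact: weyl1.
by apply/asboolP => p _; rewrite mulmx1.
Qed.

Lemma cosine_onto c : exists x, cosine x = c.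
Proof.
have [f [t [fE [q0 f0] ft]]] := common_eigen rb (c 0).
have t0 k : t k != 0.
  apply: contraNneq f0 => tk; rewrite -[q0](subrK (omega k)) ft tk mul0r //.
have /choice[z zE] : forall k, exists z, cexp (Complex 0 (2 * pi) * z) = t k.
  by move=> k; exact: cexp_2pii_onto.
pose x := \sum_k z k *: cvec (coroot (alpha k)).
have xE k : echar (omega k) x = t k.
  rewrite -zE /echar cdot_sumr (bigD1 k) //= big1 => [|j jk].
    by rewrite addr0 cdotZr cdot_cvec dual eqxx mulr1.
  by rewrite cdotZr cdot_cvec dual eq_sym (negbTE jk) mulr0.
pose D p := forall q, f (q + p) = echar p x * f q.
have D0 : D 0 by move=> q; rewrite addr0 echar0 mul1r.
have DD p p' : D p -> D p' -> D (p + p').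
  by move=> hp hp' q; rewrite addrA hp' hp echarDl mulrA (mulrC (echar p' x)).
have DN p : D p -> D (- p).
  move=> hp q; apply: (mulfI (echar_neq0 p x)).
  by rewrite mulrA -echarDl -hp subrK subrr echar0 mul1r.
have Do k : D (omega k) by move=> q; rewrite ft xE.
have Dm k (m : int) : D (m%:~R *: omega k).
  have Dn (i : nat) : D (i%:R *: omega k).
    elim: i => [|i IH]; first by rewrite scale0r.
    by rewrite -natr1 scalerDl scale1r; exact: DD.
  case: m => i; first exact: Dn.
  by rewrite NegzE rmorphN scaleNr; apply: DN; exact: Dn.
have Dw p : weight alpha p -> D p.
  move=> hp; rewrite [p](omega_expand rb); elim/big_rec: _ => // k p' _.
  by apply: DD; have /intrP[m ->] := hp k; exact: Dm.
(* The orbit-sum equation of [f] at [q0], divided by [f q0], says that the orbit sum of the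
   exponentials at [x] is [c 0 k]. *)
exists x; apply/rowP => k; apply: (mulIf f0); rewrite -fE cosineE /osum mulr_suml.
apply: eq_big_seq => r /(orbP rb)[A hA ->]; rewrite Dw //.
by apply: (weight_weyl rb) => //; exact: (weight_omega rb).
Qed.

(** The sum is fixed by every simple reflection, hence orthogonal to all simple coroots. *)
Lemma sum_weyls_omega p : \sum_(A <- weyls) p *m A = 0.
Proof.
set u := \sum_(_ <- _) _; rewrite [u](omega_expand rb) big1 // => k _.
have aP := alpha_root rb k.
have : u *m rmx (alpha k) = u.
  rewrite /u mulmx_suml -[RHS](sum_weyls rb _ (weyl_rmx aP)).
  by apply: eq_bigr => A _; rewrite mulmxA.
rewrite mul_rmx rrefl_coroot => /eqP; rewrite -subr_eq0 addrAC subrr sub0r oppr_eq0.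
by rewrite scaler_eq0 (negbTE (root_neq0 rsP aP)) orbF => /eqP ->; rewrite scale0r.
Qed.

(** The modulus of an exponential sees only the imaginary part, so [eigen_bound] bounds that part
    below on all conjugates of [omega k]; as they sum to 0, it is bounded above too. A translation
    brings the real coordinates into [0, 1), whence the 1 in the constant. *)
Lemma cosine_bounded (B : R) : exists M : R, forall x,
  (forall k, `|cosine x 0 k| <= B%:C%C) ->
  exists g : affine_weyl_group Phi, forall k,
    `|complex.Re (cdot (cvec (omega k)) (val g x))| <= M /\
    `|complex.Im (cdot (cvec (omega k)) (val g x))| <= M.
Proof.
have /choice[N hN] : forall k, exists N : C, forall c f z,
    (forall j, `|c j| <= B%:C%C) -> orbit_eigen Phi omega c f -> f 0 != 0 ->
    (forall p, f (p + omega k) = z * f p) -> `|z| <= N.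
  by move=> k; exact: (eigen_bound rb).
pose N' k := `|ln (complex.Re (N k)) / (2 * pi)|.
exists (1 + (size weyls)%:R * \sum_k N' k) => x xB.
have p0 : 0 < 2 * pi :> R by rewrite mulr_gt0 // pi_gt0.
have ImA k A : W A -> - N' k <= complex.Im (cdot (cvec (omega k *m A)) x).
  move=> hA; have := hN k (cosine x 0) (fun p => echar (p *m A) x)
    (echar (omega k *m A) x) xB (echar_mulmx_eigen x hA).
  rewrite mul0mx echar0 oner_eq0 => /(_ isT) h.
  have {h} : `|echar (omega k *m A) x| <= N k.
    by apply: h => p; rewrite mulmxDl echarDl mulrC.
  rewrite norm_cexp lecE => /andP[_ /=]; set z := cdot _ x.
  case: z => [u v] /=; rewrite mul0r sub0r => eN.
  have N0 : 0 < complex.Re (N k) by apply: lt_le_trans eN; exact: expR_gt0.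
  have : - (2 * pi * v) <= ln (complex.Re (N k)).
    by rewrite -(expRK (- _)) ler_ln ?posrE ?expR_gt0.
  rewrite -[leRHS](divfK (lt0r_neq0 p0)) mulrC -mulNr ler_pM2r // => h.
  by rewrite /N' lerNl (le_trans h) // ler_norm.
have ImS k : \sum_(A <- weyls) complex.Im (cdot (cvec (omega k *m A)) x) = 0.
  have ImD (s : seq 'M[R]_n) : \sum_(A <- s) complex.Im (cdot (cvec (omega k *m A)) x) =
      complex.Im (cdot (cvec (\sum_(A <- s) omega k *m A)) x).
    elim: s => [|A s IH].
      by rewrite !big_nil -(scale0r (0 : 'rV_n)) cdotZl mul0r.
    by rewrite !big_cons cdotDl IH; case: (cdot _ x) (cdot _ x) => [? ?] [? ?].
  by rewrite ImD sum_weyls_omega -(scale0r (0 : 'rV_n)) cdotZl mul0r.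
have N'0 k : 0 <= N' k by exact: normr_ge0.
have ImB k : `|complex.Im (cdot (cvec (omega k)) x)| <= (size weyls)%:R * N' k.
  have W1 : 1%:M \in weyls by apply/(in_weyls rb); exact: weyl1.
  rewrite ler_norml; apply/andP; split.
    have := ImA k 1%:M (weyl1 _); rewrite mulmx1; apply: le_trans.
    by rewrite lerN2 ler_peMl // ler1n (size_weyls_gt0 rb).
  have := ImS k; rewrite (big_rem 1%:M) //= mulmx1 => /eqP.
  rewrite addr_eq0 => /eqP->; rewrite -sumrN.
  apply: (@le_trans _ _ (\sum_(A <- rem 1%:M weyls) N' k)).
    rewrite big_seq [leRHS]big_seq; apply: ler_sum => A /mem_rem /(in_weyls rb) hA.
    by rewrite lerNl; exact: ImA.
  rewrite big_const_seq count_predT iter_addr_0 -[leLHS]mulr_natl ler_wpM2r // ler_nat.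
  by rewrite size_rem // leq_pred.
pose m k := Num.floor (complex.Re (cdot (cvec (omega k)) x)).
pose q := - \sum_k (m k)%:~R *: coroot (alpha k).
have qE k : dot (omega k) q = - (m k)%:~R.
  rewrite /q dotNr dot_sumr (bigD1 k) //= big1 => [|j jk].
    by rewrite addr0 dotZr dual eqxx mulr1.
  by rewrite dotZr dual eq_sym (negbTE jk) mulr0.
have hq : lattice omega q by move=> k; rewrite dotC qE rpredN intr_int.
have [g gE] := affine_exists rb (weyl1 Phi) hq.
exists g => k; rewrite gE cmx1 mulmx1 cdotDr cdot_cvec qE.
have S0 j : N' j <= \sum_k N' k.
  by rewrite (bigD1 j) //= lerDl sumr_ge0.
have W0 : 0 <= (size weyls)%:R * \sum_k N' k by rewrite mulr_ge0 // sumr_ge0.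
have := ImB k; have : m k = Num.floor (complex.Re (cdot (cvec (omega k)) x)) by [].
case: (cdot _ x) => [u v] /= mE vB; split.
  have := floor_le u; have := floorD1_gt u; rewrite -mE rmorphD /= => h1 h2.
  by rewrite ger0_norm ?subr_ge0 // lerBlDl addrA ler_wpDr // ltW.
rewrite addr0 (le_trans vB) // ler_wpDl // ler_wpM2l //.
Qed.

End GeneralizedCosine.

Lemma exists_pos_lbound (R : realType) (T : eqType) (P : T -> R -> Prop) (s : seq T) :
  (forall x, x \in s -> exists2 e, 0 < e & forall d, 0 < d -> d < e -> P x d) ->
  exists2 e, 0 < e & forall d, 0 < d -> d < e -> forall x, x \in s -> P x d.
Proof.
elim: s => [|x s IH] h; first by exists 1.
have [|e e0 he] := IH; first by move=> y ys; apply: h; rewrite inE ys orbT.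
have [|e' e'0 he'] := h x; first by rewrite inE eqxx.
exists (Num.min e e'); first by rewrite lt_min e0.
move=> d d0; rewrite lt_min => /andP[de de'] y; rewrite inE => /orP[/eqP->|ys].
  exact: he'.
exact: he.
Qed.

(** * Regular points *)

Section RealImaginary.
Variables (R : realType) (n : nat).
Local Notation C := R[i].
Implicit Types (x y : 'rV[C]_n) (A : 'M[R]_n) (q v a b : 'rV[R]_n).

Definition rpart x : 'rV[R]_n := map_mx (@complex.Re R) x.
Definition ipart x : 'rV[R]_n := map_mx (@complex.Im R) x.

Lemma rpartD x y : rpart (x + y) = rpart x + rpart y.
Proof. by apply/rowP => j; rewrite !mxE; case: (x 0 j) (y 0 j) => [? ?] []. Qed.

Lemma ipartD x y : ipart (x + y) = ipart x + ipart y.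
Proof. by apply/rowP => j; rewrite !mxE; case: (x 0 j) (y 0 j) => [? ?] []. Qed.

Lemma rpartN x : rpart (- x) = - rpart x.
Proof. by apply/rowP => j; rewrite !mxE; case: (x 0 j). Qed.

Lemma ipartN x : ipart (- x) = - ipart x.
Proof. by apply/rowP => j; rewrite !mxE; case: (x 0 j). Qed.

Lemma rpart_cvec q : rpart (cvec q) = q.
Proof. by apply/rowP => j; rewrite !mxE. Qed.

Lemma ipart_cvec q : ipart (cvec q) = 0.
Proof. by apply/rowP => j; rewrite !mxE. Qed.

Lemma rpart_mulmx x A : rpart (x *m cmx A) = rpart x *m A.
Proof.
apply/rowP => j; rewrite !mxE (big_morph (@complex.Re R) (id1 := 0) (op1 := +%R)) //.
  by apply: eq_bigr => k _; rewrite !mxE; case: (x 0 k) => [? ?] /=; rewrite mulr0 subr0.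
by move=> [? ?] [].
Qed.

Lemma ipart_mulmx x A : ipart (x *m cmx A) = ipart x *m A.
Proof.
apply/rowP => j; rewrite !mxE (big_morph (@complex.Im R) (id1 := 0) (op1 := +%R)) //.
  by apply: eq_bigr => k _; rewrite !mxE; case: (x 0 k) => [? ?] /=; rewrite mulr0 add0r.
by move=> [? ?] [].
Qed.

Lemma eq_parts x y : rpart x = rpart y -> ipart x = ipart y -> x = y.
Proof.
move=> /rowP r /rowP i; apply/rowP => j; have := r j; have := i j; rewrite !mxE.
by case: (x 0 j) (y 0 j) => [? ?] [? ?] /= -> ->.
Qed.

Lemma cdot_parts v x : cdot (cvec v) x = Complex (dot v (rpart x)) (dot v (ipart x)).
Proof.
rewrite /cdot /dot; elim/big_rec3: _ => [|j y1 y2 y3 _ ->] //.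
by rewrite !mxE; case: (x 0 j) => [? ?] /=; rewrite oppr0; simpc.
Qed.

Definition nrm2 x := dot (rpart x) (rpart x) + dot (ipart x) (ipart x).

Lemma nrm2_ge0 x : 0 <= nrm2 x.
Proof. by rewrite addr_ge0 ?dot_ge0. Qed.

Lemma nrm2_eq0 x : nrm2 x = 0 -> x = 0.
Proof.
move/eqP; rewrite paddr_eq0 ?dot_ge0 // !dot_eq0 => /andP[/eqP r /eqP i].
apply: eq_parts; first by rewrite r; apply/rowP => j; rewrite !mxE.
by rewrite i; apply/rowP => j; rewrite !mxE.
Qed.

Lemma dot_quasi_triangle a b : dot (a + b) (a + b) <= 2 * (dot a a + dot b b).
Proof.
have := dot_ge0 (a - b); rewrite !(dotBl, dotBr, dotDl, dotDr) (dotC b a); lra.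
Qed.

Lemma nrm2D x y : nrm2 (x + y) <= 2 * (nrm2 x + nrm2 y).
Proof.
rewrite /nrm2 rpartD ipartD.
have := dot_quasi_triangle (rpart x) (rpart y).
have := dot_quasi_triangle (ipart x) (ipart y); lra.
Qed.

Lemma nrm2N x : nrm2 (- x) = nrm2 x.
Proof. by rewrite /nrm2 rpartN ipartN !dotNl !dotNr !opprK. Qed.

Lemma cauchy_schwarz a b : dot a b ^+ 2 <= dot a a * dot b b.
Proof.
have [->|b0] := eqVneq b 0; first by rewrite !dot0r mulr0 expr0n.
have h := dot_gt0 b0; have := dot_ge0 (a - (dot a b / dot b b) *: b).
rewrite !(dotBl, dotBr, dotZl, dotZr) (dotC b a) => e.
rewrite -ler_pdivrMr // -subr_ge0; move: e; congr (0 <= _).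
by field; rewrite gt_eqF.
Qed.

End RealImaginary.

Section RegularPoints.
Variables (R : realType) (n : nat) (Phi : {fset 'rV[R]_n}).
Variables (phi : 'rV[R]_n -> R) (alpha omega : 'I_n -> 'rV[R]_n).
Hypothesis rb : root_basis Phi phi alpha omega.
Let rsP := rb_root_system rb.
Local Notation C := R[i].
Implicit Types (x y : 'rV[C]_n) (A B : 'M[R]_n) (a b v : 'rV[R]_n).
Local Notation isroot := (isroot Phi xpredT).
Local Notation lin s := [seq (c.1, 0) | c <- s].

Lemma wactD (s : seq ('rV[R]_n * int)) a b t :
  wact s (a + t *: b) = wact s a + t *: wact (lin s) b.
Proof. by elim: s => //= c s IH; rewrite IH /arefl rreflD. Qed.

(** Roots and levels being real, translations act on the real part only, and the imaginary part sees
    the linear reflections. *)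
Lemma affine_word (g : affine_weyl_group Phi) : exists2 s, all isroot s &
  forall x, rpart (val g x) = wact s (rpart x) /\
            ipart (val g x) = wact (lin s) (ipart x).
Proof.
have : generated_group [set g : bijection 'rV[C]_n |
    exists2 v, v \in Phi & exists l : int, g = reflection (cvec v) l%:~R] (val g) by exact/set_mem/(valP g).
move: (val g) => {}g; move: g; apply: (generated_ind
  (P := fun g => exists2 s, all isroot s &
  forall x, rpart (bij_fun g x) = wact s (rpart x) /\
            ipart (bij_fun g x) = wact (lin s) (ipart x))).
- by exists [::].
- move=> g h [s hs gE] [t ht hE]; exists (s ++ t); first by rewrite all_cat hs.
  move=> x; rewrite map_cat !wact_cat.
  have [<- <-] := hE x; exact: gE.
- move=> g [s hs gE]; exists (rev s); first by rewrite all_rev.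
  have rK (u : seq ('rV[R]_n * int)) b : all isroot u -> wact (rev u) (wact u b) = b.
    elim: u b => //= c u IH b /andP[hc hu].
    rewrite rev_cons wact_rcons (areflK rsP hc) IH //.
  move=> x; have [e1 e2] := gE (bij_inv g x).
  have -> : bij_fun (g^-1)%g x = bij_inv g x by [].
  rewrite -{2 4}[x](bij_invK g) e1 e2 map_rev !rK //.
  by rewrite all_map; apply: sub_all hs => c /andP[cP _]; rewrite /isroot /= cP.
- move=> g [v vP [l ->]]; exists [:: (v, l)]; first by rewrite /= /isroot /= vP.
  have v0 := root_neq0 rsP vP; move=> x; rewrite /= creflectionE //.
  rewrite rpartD ipartD rpart_mulmx ipart_mulmx rpart_cvec ipart_cvec addr0.
  rewrite !mul_rmx; split=> //; rewrite /arefl /rrefl /coroot /=.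
  by apply/rowP => j; rewrite !mxE; ring.
Qed.

Lemma regular_pointsP x : regular_points Phi x <->
  forall v, v \in Phi -> forall l : int,
    ~ (dot v (rpart x) = l%:~R /\ dot v (ipart x) = 0).
Proof.
split=> [h v vP l [r i]|h [v /= vP [l _]]]; last first.
  by rewrite /hyperplane /= cdot_parts => -[r i]; exact: (h v vP l).
by apply: h; exists v => //; exists l => //; rewrite /hyperplane /= cdot_parts r i.
Qed.

Lemma avoid_integers (s t : R) : ~ (exists2 l : int, s = l%:~R & t = 0) ->
  exists2 e, 0 < e & forall d, 0 < d -> d < e -> forall l : int, s + d * t != l%:~R.
Proof.
have pos (u w : R) : 0 < w ->
    exists2 e, 0 < e & forall d, 0 < d -> d < e -> forall l : int, u + d * w != l%:~R.
  move=> w0; set m := Num.floor u.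
  have m1 : m%:~R <= u by exact: floor_le.
  have m2 : u < (m + 1)%:~R by exact: floorD1_gt.
  exists (((m + 1)%:~R - u) / w); first by rewrite divr_gt0 // subr_gt0.
  move=> d d0; rewrite ltr_pdivlMr // ltrBrDl => dw l; apply/eqP => e.
  have : m < l by rewrite -(ltr_int R) -e (le_lt_trans m1) // ltrDl mulr_gt0.
  have : l < m + 1 by rewrite -(ltr_int R) -e.
  by lia.
move=> h; have [t0|t0|t0] := ltgtP t 0.
- have [|e e0 he] := pos (- s) (- t); first by rewrite oppr_gt0.
  exists e => // d d0 de l; have := he d d0 de (- l).
  by rewrite rmorphN /= mulrN -opprD eqr_opp.
- exact: pos.
- exists 1 => // d _ _ l; rewrite t0 mulr0 addr0; apply/eqP => sl.
  by apply: h; exists l.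
Qed.

(* For x = u + i v off the complex hyperplanes, the real point u + d v is off the
   real ones for all small d > 0. *)
Lemma regular_free (g : affine_weyl_group Phi) x :
  regular_points Phi x -> val g x = x -> g = 1%g.
Proof.
move=> /regular_pointsP hx gx; have [s hs sE] := affine_word g.
have [ra ib] := sE x; rewrite gx in ra ib.
set a := rpart x in hx ra *; set b := ipart x in hx ib *.
have [e e0 he] : exists2 e, 0 < e & forall d, 0 < d -> d < e ->
    forall v, v \in enum_fset Phi -> forall l : int, dot v a + d * dot v b != l%:~R.
  apply: exists_pos_lbound => v vP; apply: avoid_integers => -[l l1 l2].
  exact: (hx v vP l).
pose d := e / 2; have d0 : 0 < d by rewrite divr_gt0.
have de : d < e by rewrite ltr_pdivrMr // ltr_pMr // ltr1n.
have idP (u : 'rV[R]_n) : wact s u = u.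
  apply: (@wact_fix_regular _ _ _ rsP xpredT _ (a + d *: b)) => //.
    by move=> v l vP _; rewrite dotDr dotZr; exact: he.
  by rewrite wactD -ra -ib.
have idl (u : 'rV[R]_n) : wact (lin s) u = u.
  have := wactD s 0 u 1; rewrite !idP !scale1r => /addrI <-.
  by [].
apply: val_inj; apply: bijectionP => y.
by have [r i] := sE y; apply: eq_parts; rewrite ?r ?i ?idP ?idl.
Qed.

Lemma affine_nrm2 (g : affine_weyl_group Phi) x y :
  nrm2 (val g x - val g y) = nrm2 (x - y).
Proof.
have [A [q [hA _ gE]]] := affine_form rb g.
rewrite !gE opprD addrACA subrr addr0 -mulmxBl /nrm2.
by rewrite rpart_mulmx ipart_mulmx !(weyl_dot rsP).
Qed.

(** The coordinates of [q] on the simple coroots are integers, and Cauchy-Schwarz against the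
    fundamental weights makes their squares less than 1. *)
Lemma lattice_discrete :
  exists2 e : R, 0 < e & forall q, lattice omega q -> dot q q < e -> q = 0.
Proof.
set D := 1 + \sum_k dot (omega k) (omega k).
have D0 : 0 < D by rewrite ltr_wpDr // sumr_ge0 // => k _; exact: dot_ge0.
exists D^-1; rewrite ?invr_gt0 // => q hq qe.
rewrite [q](coroot_expand rb) big1 // => k _.
have wD : dot (omega k) (omega k) <= D.
  rewrite /D (bigD1 k) //= addrCA lerDl addr_ge0 // sumr_ge0 // => j _.
  exact: dot_ge0.
have : dot q (omega k) ^+ 2 < 1.
  apply: le_lt_trans (cauchy_schwarz _ _) _.
  apply: le_lt_trans (ler_wpM2l (dot_ge0 _) wD) _.
  by rewrite -ltr_pdivlMr // div1r.
have /intrP[m ->] := hq k; rewrite -rmorphXn /= (ltr_int R _ 1) expr2 => m1.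
suff -> : m = 0 by rewrite scale0r.
by move: m1; clear; nia.
Qed.

Lemma lattice_separated a : exists2 e : R, 0 < e &
  forall q, lattice omega q -> dot (a + q) (a + q) < e -> a + q = 0.
Proof.
have [e e0 he] := lattice_discrete.
have [[q0 [hq0 q0e q0n]]|nq] := pselect (exists q, [/\ lattice omega q,
    dot (a + q) (a + q) < e / 4 & a + q != 0]); last first.
  exists (e / 4); first by rewrite divr_gt0.
  move=> q hq qe; apply/eqP/negPn/negP => qn; apply: nq; by exists q.
(* Two points of the coset with squared norm below e/4 differ by a lattice vector of squared norm
   below 2 (e/4 + e/4) = e, hence coincide. So [q0] is the only exception, and its own norm is the
   bound. *)
exists (dot (a + q0) (a + q0)); first exact: dot_gt0.
move=> q hq qe; suff qq : q - q0 = 0.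
  by move: qe; rewrite (subr0_eq qq) ltxx.
apply: he; first by apply: latticeD => //; exact: latticeN.
have -> : q - q0 = (a + q) + - (a + q0) by rewrite opprD addrACA subrr add0r.
apply: le_lt_trans (dot_quasi_triangle _ _) _; rewrite dotNl dotNr opprK.
lra.
Qed.

(** There are finitely many linear parts. For each, the displacement of [x] has a fixed imaginary
    part and a real part in a coset of the lattice, so a small displacement is zero, and freeness
    concludes. *)
Lemma regular_separated x : regular_points Phi x -> exists2 e : R, 0 < e &
  forall g : affine_weyl_group Phi, nrm2 (val g x - x) < e -> g = 1%g.
Proof.
move=> hx.
have [e e0 he] : exists2 e, 0 < e & forall d, 0 < d -> d < e ->
    forall A, A \in enum_fset (weyls Phi) -> forall q, lattice omega q ->
    nrm2 (x *m cmx A + cvec q - x) < d -> x *m cmx A + cvec q = x.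
  apply: exists_pos_lbound => A _.
  set b := ipart x *m A - ipart x; set a := rpart x *m A - rpart x.
  have nE q : nrm2 (x *m cmx A + cvec q - x) = dot (a + q) (a + q) + dot b b.
    rewrite /nrm2 !rpartD !ipartD rpartN ipartN rpart_mulmx ipart_mulmx.
    by rewrite rpart_cvec ipart_cvec addr0 (addrAC _ q).
  have [b0|bn] := eqVneq b 0; last first.
    exists (dot b b); first exact: dot_gt0.
    move=> d _ de q _; rewrite nE => h; exfalso; have := dot_ge0 (a + q); lra.
  have [e e0 he] := lattice_separated a.
  exists e => // d d0 de q hq; rewrite nE b0 dot0l addr0 => h.
  have {}h := he q hq (lt_trans h de).
  apply: eq_parts; rewrite ?rpartD ?ipartD ?rpart_mulmx ?ipart_mulmx.
    apply/eqP; rewrite rpart_cvec -subr_eq0 addrAC -/a h //.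
  by apply/eqP; rewrite ipart_cvec addr0 -subr_eq0 -/b b0.
exists (e / 2); first by rewrite divr_gt0.
move=> g; have [A [q [hA hq gE]]] := affine_form rb g => h.
apply: (regular_free hx); rewrite gE.
apply: (he (e / 2)) => //; rewrite ?divr_gt0 //; last by rewrite -gE.
  by rewrite ltr_pdivrMr // ltr_pMr // ltr1n.
exact/(in_weyls rb).
Qed.

Lemma regular_affine (g : affine_weyl_group Phi) x :
  regular_points Phi x -> regular_points Phi (val g x).
Proof.
have [A [q [hA hq gE]]] := affine_form rb g.
move=> /regular_pointsP hx; apply/regular_pointsP => v vP l.
have [hT AT] := weyl_inv rsP hA.
rewrite gE rpartD ipartD rpart_mulmx ipart_mulmx rpart_cvec ipart_cvec addr0.
rewrite dotDr dotC (weyl_dotC rsP) // (dotC v (_ *m _)) (weyl_dotC rsP) //.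
have /intrP[m ->] := lattice_weight rb hq (weight_root rb vP).
rewrite dotC (dotC (ipart x)) => -[h1 h2].
apply: (hx (v *m A^T) (weyl_root rsP hT vP) (l - m)); split=> //.
by rewrite rmorphB /= -h1 addrK.
Qed.

End RegularPoints.

Lemma norm_lt_sqr (R : realType) (w e : R) : 0 < e -> w ^+ 2 < e ^+ 2 -> `|w| < e.
Proof.
move=> e0 we; rewrite -(@ltr_pXn2r _ 2) ?nnegrE ?normr_ge0 ?(ltW e0) //.
by rewrite real_normK ?num_real.
Qed.

Lemma continuous_const (S T : topologicalType) (t : T) : continuous (fun _ : S => t).
Proof. by move=> s; apply: (@cvg_cst _ t _ (nbhs s)); exact: (nbhs_filter (s : S)). Qed.

Lemma continuousD_real (R : realType) (T : topologicalType) (f g : T -> R) :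
  continuous f -> continuous g -> continuous (fun t => f t + g t).
Proof. by move=> cf cg t; apply: cvgD; [exact: cf | exact: cg]. Qed.

Lemma continuousB_real (R : realType) (T : topologicalType) (f g : T -> R) :
  continuous f -> continuous g -> continuous (fun t => f t - g t).
Proof. by move=> cf cg t; apply: cvgB; [exact: cf | exact: cg]. Qed.

Lemma continuousM_real (R : realType) (T : topologicalType) (f g : T -> R) :
  continuous f -> continuous g -> continuous (fun t => f t * g t).
Proof. by move=> cf cg t; apply: cvgM; [exact: cf | exact: cg]. Qed.

Lemma continuousZ_real (R : realType) (T : topologicalType) (a : R) (f : T -> R) :
  continuous f -> continuous (fun t => a * f t).
Proof. by move=> cf t; apply: cvgM; [exact: cvg_cst | exact: cf]. Qed.

(** * Topology of the generalized cosine *)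

Section ComplexSpaceTopology.
Variables (R : realType) (n : nat).
Local Notation C := R[i].
Implicit Types (x y z : 'rV[C]_n).

Lemma nrm2E x : nrm2 x = \sum_j (complex.Re (x 0 j) ^+ 2 + complex.Im (x 0 j) ^+ 2).
Proof.
by rewrite /nrm2 /dot -big_split; apply: eq_bigr => j _; rewrite !mxE !expr2.
Qed.

Lemma nbhs_nrm2 x (U : set 'rV[C]_n) : nbhs x U <->
  exists2 e : R, 0 < e & forall y, nrm2 (y - x) < e -> U y.
Proof.
have lt_norm (z : C) (e : R) : 0 < e ->
    (`|z| < e%:C%C) = (complex.Re z ^+ 2 + complex.Im z ^+ 2 < e ^+ 2).
  move=> e0; rewrite normc_def ltcR -[in RHS](@sqr_sqrtr _ (_ + _)) ?addr_ge0 ?sqr_ge0 //.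
  by rewrite ltr_pXn2r // nnegrE ?sqrtr_ge0 // ltW.
rewrite nbhs_ballP; split=> [[/= e e0 eU]|[e e0 eU]].
  have eE : e = (complex.Re e)%:C%C by rewrite RRe_real // gtr0_real.
  have e'0 : 0 < complex.Re e by move: e0; rewrite ltcE => /andP[].
  exists (complex.Re e ^+ 2); first by rewrite exprn_gt0.
  move=> y yx; apply: eU; split=> // i j; rewrite !ord1.
  suff : ball (x 0 j : C^o) e (y 0 j : C^o) by [].
  rewrite -ball_normE /= eE.
  rewrite distrC lt_norm //; apply: le_lt_trans yx.
  by rewrite nrm2E (bigD1 j) //= !mxE lerDl sumr_ge0 // => k _; rewrite addr_ge0 ?sqr_ge0.
(* Dividing by n + 1 keeps the sum of [n] squares strictly below [e], also for n = 0. *)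
set d := Num.sqrt (e / n.+1%:R).
have d0 : 0 < d by rewrite sqrtr_gt0 divr_gt0.
exists d%:C%C; first by rewrite /= ltcR.
move=> y [_ /= xy]; apply: eU; rewrite nrm2E.
apply: (@le_lt_trans _ _ (\sum_(j < n) d ^+ 2)).
  apply: ler_sum => j _; apply: ltW; rewrite -lt_norm // !mxE distrC.
  have : ball (x 0 j : C^o) d%:C%C (y 0 j : C^o) by exact: xy.
  by rewrite -ball_normE.
rewrite sumr_const card_ord sqr_sqrtr; last by rewrite divr_ge0 // ltW.
by rewrite -mulrnAl ltr_pdivrMr // -[_ *+ n]mulr_natr ltr_pM2l // ltr_nat.
Qed.

Lemma near_nrm2 x (e : R) : 0 < e -> \forall y \near x, nrm2 (y - x) < e.
Proof. by move=> e0; apply/nbhs_nrm2; exists e. Qed.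

Lemma continuous_Re j : continuous (fun x : 'rV[C]_n => complex.Re (x 0 j)).
Proof.
move=> x; have FF : Filter (nbhs x) := nbhs_filter (x : 'rV[C]_n).
apply/cvgrPdist_lt => e e0; have e2 : 0 < e ^+ 2 by rewrite exprn_gt0.
have := near_nrm2 x e2; apply: filterS => y.
move=> yx; apply: norm_lt_sqr => //; move: yx.
apply: le_lt_trans; rewrite nrm2E (bigD1 j) //= !mxE.
have -> : complex.Re (x 0 j) - complex.Re (y 0 j) = - complex.Re (y 0 j - x 0 j).
  by case: (x 0 j) (y 0 j) => [? ?] [? ?] /=; rewrite opprB.
rewrite sqrrN -addrA lerDl addr_ge0 ?sqr_ge0 // sumr_ge0 // => k _.
by rewrite addr_ge0 ?sqr_ge0.
Qed.

Lemma continuous_Im j : continuous (fun x : 'rV[C]_n => complex.Im (x 0 j)).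
Proof.
move=> x; have FF : Filter (nbhs x) := nbhs_filter (x : 'rV[C]_n).
apply/cvgrPdist_lt => e e0; have e2 : 0 < e ^+ 2 by rewrite exprn_gt0.
have := near_nrm2 x e2; apply: filterS => y.
move=> yx; apply: norm_lt_sqr => //; move: yx.
apply: le_lt_trans; rewrite nrm2E (bigD1 j) //= !mxE.
have -> : complex.Im (x 0 j) - complex.Im (y 0 j) = - complex.Im (y 0 j - x 0 j).
  by case: (x 0 j) (y 0 j) => [? ?] [? ?] /=; rewrite opprB.
rewrite sqrrN addrAC lerDr addr_ge0 ?sqr_ge0 // sumr_ge0 // => k _.
by rewrite addr_ge0 ?sqr_ge0.
Qed.

Lemma continuous_sum (T : topologicalType) (I : Type) (s : seq I) (f : I -> T -> R) :
  (forall i, continuous (f i)) -> continuous (fun t => \sum_(i <- s) f i t).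
Proof.
move=> cf; elim: s => [|i s IH] t.
  rewrite (_ : (fun _ => _) = fun=> 0); first exact: cvg_cst.
  by apply/funext => u; rewrite big_nil.
rewrite (_ : (fun _ => _) = fun u => f i u + \sum_(i <- s) f i u).
  by apply: cvgD; [exact: cf | exact: IH].
by apply/funext => u; rewrite big_cons.
Qed.

Lemma continuous_rV (T : topologicalType) (f : T -> 'rV[C]_n) :
  (forall j, continuous (fun t => complex.Re (f t 0 j))) ->
  (forall j, continuous (fun t => complex.Im (f t 0 j))) -> continuous f.
Proof.
move=> cr ci t U /nbhs_nrm2[e e0 eU].
pose h s := \sum_j ((complex.Re (f s 0 j) - complex.Re (f t 0 j)) ^+ 2 +
                    (complex.Im (f s 0 j) - complex.Im (f t 0 j)) ^+ 2).
have hE s : nrm2 (f s - f t) = h s.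
  rewrite nrm2E; apply: eq_bigr => j _; rewrite !mxE.
  by case: (f s 0 j) (f t 0 j) => [? ?] [? ?].
have ch : continuous h.
  apply: continuous_sum => j s; apply: cvgD; rewrite !expr2; apply: cvgM; apply: cvgB;
    by [exact: cr | exact: ci | exact: cvg_cst].
have ht : h t < e by rewrite -hE subrr nrm2E big1 // => j _; rewrite !mxE /= expr0n addr0.
suff : \forall s \near t, U (f s) by [].
have : \forall s \near t, h s < e by apply: (cvgr_lt (h t)) => //; exact: ch.
by apply: filterS => s hs; apply: eU; rewrite hE.
Qed.

End ComplexSpaceTopology.

Section CosineTopology.
Variables (R : realType) (n : nat) (Phi : {fset 'rV[R]_n}).
Variables (phi : 'rV[R]_n -> R) (alpha omega : 'I_n -> 'rV[R]_n).
Hypothesis rb : root_basis Phi phi alpha omega.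
Local Notation C := R[i].
Implicit Types (x y z : 'rV[C]_n) (A : 'M[R]_n) (v : 'rV[R]_n).
Local Notation cosine := (generalized_cosine Phi omega).

Lemma continuous_dot_Re v : continuous (fun x : 'rV[C]_n => dot v (rpart x)).
Proof.
rewrite (_ : (fun _ => _) = fun x : 'rV[C]_n => \sum_j v 0 j * complex.Re (x 0 j)).
  apply: (continuous_sum (T := 'rV[C]_n)) => j.
  by apply: (continuousZ_real (T := 'rV[C]_n)); exact: continuous_Re.
by apply/funext => y; apply: eq_bigr => j _; rewrite mxE.
Qed.

Lemma continuous_dot_Im v : continuous (fun x : 'rV[C]_n => dot v (ipart x)).
Proof.
rewrite (_ : (fun _ => _) = fun x : 'rV[C]_n => \sum_j v 0 j * complex.Im (x 0 j)).
  apply: (continuous_sum (T := 'rV[C]_n)) => j.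
  by apply: (continuousZ_real (T := 'rV[C]_n)); exact: continuous_Im.
by apply/funext => y; apply: eq_bigr => j _; rewrite mxE.
Qed.

Lemma echarE v x : echar v x =
  Complex (expR (- (2 * pi * dot v (ipart x))) * cos (2 * pi * dot v (rpart x)))
          (expR (- (2 * pi * dot v (ipart x))) * sin (2 * pi * dot v (rpart x))).
Proof. by rewrite /echar cdot_parts /= !mul0r sub0r add0r. Qed.

Lemma continuous_cosine : continuous cosine.
Proof.
have ce v : continuous (fun x : 'rV[C]_n => expR (- (2 * pi * dot v (ipart x)))).
  rewrite (_ : (fun _ => _) = fun x : 'rV[C]_n => expR (- (2 * pi) * dot v (ipart x))).
    apply: (@continuous_compT 'rV[C]_n _ _ _ expR _ (@continuous_expR R)).
    by apply: (continuousZ_real (T := 'rV[C]_n)); exact: continuous_dot_Im.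
  by apply/funext => x; rewrite mulNr.
have cr v : continuous (fun x : 'rV[C]_n => 2 * pi * dot v (rpart x)).
  by apply: (continuousZ_real (T := 'rV[C]_n)); exact: continuous_dot_Re.
apply: (continuous_rV (T := 'rV[C]_n)) => k.
  rewrite (_ : (fun _ => _) = fun x => \sum_(r <- orb Phi omega k)
     expR (- (2 * pi * dot r (ipart x))) * cos (2 * pi * dot r (rpart x))).
    apply: (continuous_sum (T := 'rV[C]_n)) => r.
    apply: (continuousM_real (T := 'rV[C]_n)); first exact: ce.
    exact: (@continuous_compT 'rV[C]_n _ _ _ _ (cr r) (@continuous_cos R)).
  apply/funext => x; rewrite (cosineE rb) (big_morph (@complex.Re R) (id1 := 0) (op1 := +%R)) //.
    by apply: eq_bigr => r _; rewrite echarE.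
  by move=> [? ?] [].
rewrite (_ : (fun _ => _) = fun x => \sum_(r <- orb Phi omega k)
   expR (- (2 * pi * dot r (ipart x))) * sin (2 * pi * dot r (rpart x))).
  apply: (continuous_sum (T := 'rV[C]_n)) => r.
  apply: (continuousM_real (T := 'rV[C]_n)); first exact: ce.
  exact: (@continuous_compT 'rV[C]_n _ _ _ _ (cr r) (@continuous_sin R)).
apply/funext => x; rewrite (cosineE rb) (big_morph (@complex.Im R) (id1 := 0) (op1 := +%R)) //.
  by apply: eq_bigr => r _; rewrite echarE.
by move=> [? ?] [].
Qed.

Lemma continuous_affine_act (g : affine_weyl_group Phi) : continuous (val g).
Proof.
move=> x U /nbhs_nrm2[e e0 eU]; apply/nbhs_nrm2; exists e => // y yx.
by apply: eU; rewrite (affine_nrm2 rb).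
Qed.

(** A box in the coordinates on the simple coroots, in the form that [cosine_bounded] delivers. *)
Definition coweight_box (M : R) := [set x : 'rV[C]_n | forall k,
  `|complex.Re (cdot (cvec (omega k)) x)| <= M /\
  `|complex.Im (cdot (cvec (omega k)) x)| <= M].

Lemma compact_coweight_box M : compact (coweight_box M).
Proof.
pose S := [set v : 'rV[R]_n | forall k, `[- M, M]%classic (v 0 k)].
have cS : compact S.
  apply: (@rV_compact R n (fun=> `[(- M), M]%classic)) => k.
  exact: segment_compact.
pose h (ab : 'rV[R]_n * 'rV[R]_n) : 'rV[C]_n :=
  \sum_k Complex (ab.1 0 k) (ab.2 0 k) *: cvec (coroot (alpha k)).
have hj ab j : h ab 0 j = Complex (\sum_k ab.1 0 k * coroot (alpha k) 0 j)
                                  (\sum_k ab.2 0 k * coroot (alpha k) 0 j).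
  rewrite summxE; elim/big_rec3: _ => // k y1 y2 y3 _ ->.
  by rewrite !mxE; simpc.
have c1 k : continuous (fun ab : 'rV[R]_n * 'rV[R]_n => ab.1 0 k).
  apply: (@continuous_compT _ _ _ fst (fun v : 'rV[R]_n => v 0 k)).
    by move=> ab; exact: cvg_fst.
  exact: coord_continuous.
have c2 k : continuous (fun ab : 'rV[R]_n * 'rV[R]_n => ab.2 0 k).
  apply: (@continuous_compT _ _ _ snd (fun v : 'rV[R]_n => v 0 k)).
    by move=> ab; exact: cvg_snd.
  exact: coord_continuous.
have ch : continuous h.
  apply: continuous_rV => j.
    rewrite (_ : (fun _ => _) = fun ab : 'rV[R]_n * 'rV[R]_n => \sum_k ab.1 0 k * coroot (alpha k) 0 j).
      by apply: continuous_sum => k ab; apply: cvgM; [exact: c1 | exact: cvg_cst].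
    by apply/funext => ab; rewrite hj.
  rewrite (_ : (fun _ => _) = fun ab : 'rV[R]_n * 'rV[R]_n => \sum_k ab.2 0 k * coroot (alpha k) 0 j).
    by apply: continuous_sum => k ab; apply: cvgM; [exact: c2 | exact: cvg_cst].
  by apply/funext => ab; rewrite hj.
have hk ab k : cdot (cvec (omega k)) (h ab) = Complex (ab.1 0 k) (ab.2 0 k).
  rewrite cdot_sumr (bigD1 k) //= big1 => [|j jk].
    by rewrite addr0 cdotZr cdot_cvec (rb_dual rb) eqxx mulr1.
  by rewrite cdotZr cdot_cvec (rb_dual rb) eq_sym (negbTE jk) mulr0.
rewrite (_ : coweight_box M = h @` (S `*` S)).
  by apply: continuous_compact; [exact: continuous_subspaceT | exact: compact_setX].
apply/seteqP; split=> [x hx|_ [ab [/= h1 h2] <-] k]; last first.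
  by rewrite hk /= !ler_norml; have := h1 k; have := h2 k; rewrite /= !in_itv.
exists (\row_k complex.Re (cdot (cvec (omega k)) x),
                    \row_k complex.Im (cdot (cvec (omega k)) x)).
  by split=> k /=; rewrite mxE in_itv /= -ler_norml; have [] := hx k.
rewrite /h [RHS](complex_coroot_expand rb); apply: eq_bigr => k _.
by rewrite !mxE; case: (cdot _ x).
Qed.

End CosineTopology.

(* By surjectivity, c near the image of x0 has a preimage, which the group moves into
   a fixed compact box, and there all solutions lie near translates of x0. *)
Lemma cosine_open (R : realType) (n : nat) (Phi : {fset 'rV[R]_n}) phi alpha omega
    (x0 : 'rV[R[i]]_n) (U : set 'rV[R[i]]_n) :
  root_basis Phi phi alpha omega -> nbhs x0 U ->
  \forall c \near generalized_cosine Phi omega x0,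
    exists2 x, U x & generalized_cosine Phi omega x = c.
Proof.
move=> rb U0; set cosine := generalized_cosine Phi omega.
pose B := \sum_k (complex.Re `|cosine x0 0 k| + 1).
have [M hM] := cosine_bounded rb B.
have : near_covering (coweight_box omega M).
  by apply/compact_near_coveringP; exact: (compact_coweight_box rb).
move=> /(_ _ (nbhs (cosine x0)) (fun c z => cosine z = c ->
  exists g : affine_weyl_group Phi, U (val g z)) (nbhs_filter _)) cov.
have {}cov : \forall c \near cosine x0, forall z, coweight_box omega M z ->
    cosine z = c -> exists g : affine_weyl_group Phi, U (val g z).
  apply: cov => z _; have [e|ne] := eqVneq (cosine z) (cosine x0).
    have [g gz] := cosine_fibre rb (esym e).
    have Uz : \forall z' \near z, U (val g z').
      have h := @continuous_affine_act _ _ _ _ _ _ rb g z U; apply: h.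
      by rewrite gz.
    exists ([set z' | U (val g z')], setT); first by split=> //; exact: filterT.
    by move=> [z' c] [/= Uz' _] _; exists g.
  (* A value within d/4 of both images would give d < 2 (d/4 + d/4) = d, so near such a [z] the
     equation has no solution. *)
  pose d := nrm2 (cosine z - cosine x0).
  have d0 : 0 < d.
    rewrite lt_def nrm2_ge0 andbT; apply: contra ne => /eqP/nrm2_eq0/eqP.
    by rewrite subr_eq0.
  have d4 : 0 < d / 4 by rewrite divr_gt0.
  exists ([set z' | nrm2 (cosine z' - cosine z) < d / 4],
          [set c | nrm2 (c - cosine x0) < d / 4]).
    split; last exact: near_nrm2.
    have h := @continuous_cosine _ _ _ _ _ _ rb z [set c | nrm2 (c - cosine z) < d / 4].
    by apply: h; exact: near_nrm2.
  move=> [z' c] [/= h1 h2] cz'; exfalso.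
  have := nrm2D (- (cosine z' - cosine z)) (c - cosine x0).
  rewrite nrm2N opprB -cz' addrA subrK -/d; rewrite -cz' in h2; lra.
have bnd : \forall c \near cosine x0, forall k, `|(c : 'rV[R[i]]_n) 0 k| <= B%:C%C.
  have := near_nrm2 (cosine x0) ltr01; apply: filterS => c hc k.
  have : `|c 0 k - cosine x0 0 k| <= 1.
    rewrite normc_def -[1]/(1%:C%C) lecR -sqrtr1 ler_sqrt //.
    move: hc => /ltW; apply: le_trans; rewrite nrm2E (bigD1 k) //= !mxE lerDl.
    by rewrite sumr_ge0 // => j _; rewrite addr_ge0 ?sqr_ge0.
  move=> h; have : `|c 0 k| <= `|cosine x0 0 k| + 1.
    rewrite -[c 0 k](subrK (cosine x0 0 k)) addrC (le_trans (ler_normD _ _)) //.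
    by rewrite lerD2l.
  have nE (z : R[i]) : `|z| = (complex.Re `|z|)%:C%C :> R[i] by rewrite normc_def.
  move=> /le_trans; apply; rewrite (nE (cosine x0 0 k)) -[1]/(1%:C%C) -rmorphD /= lecR.
  rewrite /B (bigD1 k) //= lerDl sumr_ge0 // => j _; rewrite addr_ge0 //.
  by have := normr_ge0 (cosine x0 0 j); rewrite lecE => /andP[_].
have := @filterI _ _ (nbhs_filter (cosine x0)) _ _ cov bnd.
apply: (@filterS _ _ (nbhs_filter (cosine x0))) => c [h1 h2].
have [x xc] := cosine_onto rb c.
have [|g hg] := hM x; first by move=> k; rewrite xc.
have [|g' Ug'] := h1 (val g x) hg; first by rewrite /cosine (cosine_affine rb).
by exists (val g' (val g x)) => //; rewrite /cosine !(cosine_affine rb).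
Qed.

(** * Homotopy lifting *)

Section Covering.
Variables (R : realType) (Y X : topologicalType) (F : Y -> X).
Variables (d : Y -> Y -> R) (G : Type) (act : G -> Y -> Y).
Hypothesis cF : continuous F.
Hypothesis d_eq0 : forall y z, d y z = 0 -> y = z.
Hypothesis dxx : forall y, d y y = 0.
Hypothesis dC : forall y z, d y z = d z y.
(* d is a squared distance, hence the factor 2 *)
Hypothesis d_triangle : forall x y z, d x z <= 2 * (d x y + d y z).
Hypothesis nbhs_d : forall y (U : set Y), nbhs y U <->
  exists2 e : R, 0 < e & forall z, d y z < e -> U z.
Hypothesis d_act : forall g y z, d (act g y) (act g z) = d y z.
Hypothesis F_act : forall g y, F (act g y) = F y.
Hypothesis F_fibre : forall y z, F y = F z -> exists g, act g y = z.
Hypothesis F_open : forall y (U : set Y), nbhs y U -> nbhs (F y) (F @` U).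
Hypothesis F_onto : forall x, exists y, F y = x.
Hypothesis F_free : forall y, exists2 e : R, 0 < e &
  forall g, d (act g y) y < e -> forall z, act g z = z.
Local Notation I := (unit_interval R).

Lemma near_d (y : Y) (e : R) : 0 < e -> \forall z \near y, d y z < e.
Proof. by move=> e0; apply/nbhs_d; exists e. Qed.

(** An isometry brings the two points next to [y0]. The element taking one to the other then moves
    [y0] by less than 10 e/16, hence acts trivially by freeness. *)
Lemma fibre_separated (x0 : X) : exists2 e : R, 0 < e & \forall x \near x0,
  forall y z, F y = x -> F z = x -> d y z < e -> y = z.
Proof.
have [y0 <-] := F_onto x0; have [e e0 he] := F_free y0.
have t0 : 0 < e / 16 by rewrite divr_gt0.
exists (e / 16) => //; have := F_open (near_d y0 t0); apply: filterS.
move=> x [w /= yw <-] y z yE zE yz.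
have [g gy] := F_fibre yE.
have [h hw] : exists h, act h w = act g z by apply: F_fibre; rewrite F_act zE.
have hid u : act h u = u.
  apply: he; have h1 := d_triangle (act h y0) (act h w) y0.
  have h2 := d_triangle (act h w) w y0; rewrite d_act in h1.
  have h3 : d (act h w) w < e / 16 by rewrite hw -gy d_act dC.
  rewrite (dC w y0) in h2; lra.
by apply: d_eq0; rewrite -(d_act g) gy -hw hid dxx.
Qed.

(** Openness at the single point [y0] is carried to the whole fibre by isometries. *)
Lemma fibre_near (x0 : X) (e : R) : 0 < e -> exists2 V : set X, nbhs x0 V &
  forall x x', V x -> V x' -> forall y, F y = x -> exists2 z, F z = x' & d y z < e.
Proof.
move=> e0; have [y0 <-] := F_onto x0.
have t0 : 0 < e / 4 by rewrite divr_gt0.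
exists (F @` [set z | d y0 z < e / 4]); first exact/F_open/near_d.
move=> _ _ [w /= yw <-] [w' /= yw' <-] y yE.
have [g gw] := F_fibre (esym yE).
exists (act g w'); first by rewrite F_act.
rewrite -gw d_act; have := d_triangle w y0 w'; rewrite (dC w y0); lra.
Qed.

(** A Lebesgue number, from the near-covering form of compactness with the filter of positive
    numbers tending to 0. *)
Lemma exists_uniform (K : set (R * R)) (P : R -> R * R -> Prop) : compact K ->
  (forall p, K p -> exists2 e : R, 0 < e &
     exists2 V, nbhs p V & forall q r, V q -> 0 < r -> r < e -> P r q) ->
  exists2 r : R, 0 < r & forall p, K p -> P r p.
Proof.
move=> /compact_near_coveringP/(_ _ (0^'+) P (at_right_proper_filter 0)) cov hP.
have {}cov : \forall r \near 0^'+, K `<=` P r.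
  apply: cov => p /hP[e e0 [V pV hV]].
  exists (V, [set r : R | 0 < r /\ r < e]).
    split=> //=; apply: filterI; first exact: nbhs_right_gt.
    exact: nbhs_right_lt.
  by move=> [q r] [/= Vq [r0 re]]; exact: hV.
have gt0 : \forall r \near (0 : R)^'+, 0 < r by exact: nbhs_right_gt.
by have [r [r0 hr]] := filter_ex (filterI gt0 cov); exists r.
Qed.

Section Square.
Variable H : I * I -> X.
Hypothesis cH : continuous H.

Let HR (p : R * R) := H (to_unit p.1, to_unit p.2).

Let cHR : continuous HR.
Proof.
apply: (continuous_compT (f := fun p : R * R => (to_unit p.1, to_unit p.2)) _ cH).
by apply: continuous_pairT; apply: continuous_compT (@continuous_to_unit R) => p;
  [exact: cvg_fst | exact: cvg_snd].
Qed.

Let K : set (R * R) := `[0, 1]%classic `*` `[0, 1]%classic.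

Let cK : compact K.
Proof. by apply: compact_setX; exact: segment_compact. Qed.

Lemma square_separated : exists2 e : R, 0 < e &
  forall p y z, F y = H p -> F z = H p -> d y z < e -> y = z.
Proof.
have [|e e0 he] := @exists_uniform K (fun e p => forall y z, F y = HR p ->
    F z = HR p -> d y z < e -> y = z) cK.
  move=> p Kp; have [e e0 he] := fibre_separated (HR p); exists e => //.
  exists (HR @^-1` [set x | forall y z, F y = x -> F z = x -> d y z < e -> y = z]).
    exact: cHR.
  by move=> q r /= hq r0 re y z yE zE yz; apply: hq yE zE _; exact: lt_trans yz re.
exists e => // -[t s] y z; have := he (of_unit t, of_unit s); rewrite /HR /= !of_unitK.
by apply; split; rewrite /= in_itv; exact: of_unit_itv.
Qed.

Lemma square_near (e : R) : 0 < e -> exists2 r : R, 0 < r &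
  forall t t' s : R, 0 <= t <= 1 -> 0 <= s <= 1 -> `|t' - t| < r ->
  forall y, F y = HR (t, s) -> exists2 z, F z = HR (t', s) & d y z < e.
Proof.
move=> e0.
have [|r r0 hr] := @exists_uniform K (fun r p => forall t', `|t' - p.1| < r ->
  forall y, F y = HR p -> exists2 z, F z = HR (t', p.2) & d y z < e) cK.
  move=> p Kp; have [V pV hV] := fibre_near (HR p) e0.
  have /nbhs_ballP[r /= r0 hr] : nbhs p (HR @^-1` V) by exact: cHR.
  have r2 : 0 < r / 2 by rewrite divr_gt0.
  exists (r / 2) => //; exists (ball p (r / 2)); first exact: nbhsx_ballx.
  move=> q u [q1 q2] u0 ur t' tq y yE.
  move: q1 q2; rewrite /ball /= => q1 q2.
  apply: hV yE; apply: hr; split; rewrite /ball /=; try by lra.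
  have -> : p.1 - t' = (p.1 - q.1) - (t' - q.1) by lra.
  by apply: le_lt_trans (ler_normB _ _) _; lra.
exists r => // t t' s t01 s01 tt' y yE.
by apply: (hr (t, s)) => //; split; rewrite /= in_itv.
Qed.

(* The homotopy is lifted at times j t / N, simultaneously for all s, by induction
   on j: the next lift is the unique point close to the previous one. *)
Lemma lift_square (y0 : Y) : (forall s, H (zero, s) = F y0) ->
  exists L : I * I -> Y, [/\ continuous L, forall p, F (L p) = H p &
    forall s, L (zero, s) = y0].
Proof.
move=> H0; have [e e0 he] := square_separated.
(* The nested triangle inequalities of the continuity argument add up to less than 22 e/32. *)
have a0 : 0 < e / 32 by rewrite divr_gt0.
have [r r0 hr] := square_near a0.
pose N := Num.bound r^-1.
have rN : r^-1 < N%:R by apply: archi_boundP; rewrite invr_ge0 ltW.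
have N0 : 0 < N%:R :> R by apply: lt_trans rN; rewrite invr_gt0.
have Nr : N%:R^-1 < r by rewrite invf_plt // posrE.
pose Hj (j : nat) (p : I * I) := HR (j%:R / N%:R * of_unit p.1, of_unit p.2).
have cHj j : continuous (Hj j).
  apply: (continuous_compT (f := fun p : I * I =>
    (j%:R / N%:R * of_unit p.1, of_unit p.2)) _ cHR).
  apply: continuous_pairT; last exact: continuous_snd_unit.
  by apply: continuousZ_real; exact: continuous_fst_unit.
have HjH j p : exists q, Hj j p = H q.
  by exists (to_unit (j%:R / N%:R * of_unit p.1), to_unit (of_unit p.2)).
suff [L [cL LE L0]] : exists L : I * I -> Y, [/\ continuous L,
    forall p, F (L p) = Hj N p & forall s, L (zero, s) = y0].
  exists L; split=> // -[t s]; rewrite LE /Hj /HR /= divff ?gt_eqF // mul1r.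
  by rewrite !of_unitK.
have : (N <= N)%N by [].
elim: {1 3}N => [_|j IH jN].
  exists (fun=> y0); split=> //; first by move=> p; exact: cvg_cst.
  by move=> p; rewrite /Hj /HR /= mul0r mul0r to_unit0 H0.
have [L [cL LE L0]] := IH (ltnW jN).
have /choice[L' L'P] : forall p, exists z, F z = Hj j.+1 p /\ d (L p) z < e / 32.
  move=> p; have /andP[p0 p1] := of_unit_itv p.1.
  have jN1 : j%:R / N%:R <= 1 :> R by rewrite ler_pdivrMr // mul1r ler_nat ltnW.
  have jN0 : 0 <= j%:R / N%:R :> R by rewrite divr_ge0.
  have h1 : 0 <= j%:R / N%:R * of_unit p.1 <= 1 by rewrite mulr_ge0 //= mulr_ile1.
  have h2 : `|j.+1%:R / N%:R * of_unit p.1 - j%:R / N%:R * of_unit p.1| < r.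
    rewrite -!mulrBl -natrB // subSnn mul1r ger0_norm ?mulr_ge0 ?invr_ge0 //.
    by apply: le_lt_trans Nr; rewrite ger_pMr // invr_gt0.
  by have [z zE zd] := hr _ _ _ h1 (of_unit_itv p.2) h2 (L p) (LE p); exists z.
exists L'; split.
- move=> p U /nbhs_d[u u0 hU]; have [L'p Lp] := L'P p.
  pose u' := Num.min u (e / 32).
  have u'0 : 0 < u' by rewrite lt_min u0.
  (* Openness provides a point over the value at [q] close to [L' p]; separation in the fibre
     identifies it with [L' q]. *)
  have h1 : \forall q \near p, (F @` [set z | d (L' p) z < u']) (Hj j.+1 q).
    by apply: (cHj j.+1 p); rewrite -L'p; apply: F_open; exact: near_d.
  have h2 : \forall q \near p, d (L p) (L q) < e / 32.
    exact: (cL p _ (near_d (L p) a0)).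
  have := @filterI _ _ (nbhs_filter (p : I * I)) _ _ h1 h2.
  apply: (@filterS _ _ (nbhs_filter (p : I * I))) => q [[z /= zd zE] Lpq].
  apply: hU; have [L'q Lq] := L'P q.
  move: zd; rewrite lt_min => /andP[zd1 zd2].
  suff <- : z = L' q by [].
  have [q' q'E] := HjH j.+1 q.
  apply: (he q'); rewrite -?q'E //.
  have e1 := d_triangle (L p) (L q) (L' q).
  have e2 := d_triangle (L' p) (L p) (L' q); rewrite (dC (L' p) (L p)) in e2.
  have e3 := d_triangle z (L' p) (L' q); rewrite (dC z (L' p)) in e3.
  lra.
- by move=> p; have [] := L'P p.
- move=> s; have [L'p Lp] := L'P (zero, s).
  have [q' q'E] := HjH j.+1 (zero, s).
  apply/esym/(he q'); rewrite -?q'E -?L'p //.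
    by rewrite L'p /Hj /HR /= of_unit0 mulr0 to_unit0 H0.
  by rewrite -(L0 s) (lt_trans Lp) // ltr_pdivrMr //; lra.
Qed.

End Square.

Lemma unit_interval_connected (P : set I) : P zero ->
  (forall t, P t -> \forall s \near t, P s) ->
  (forall t, ~ P t -> \forall s \near t, ~ P s) -> forall t, P t.
Proof.
move=> P0 oP cP t.
have cT : connected [set: I].
  have -> : [set: I] = @to_unit R @` `[0, 1]%classic.
    apply/seteqP; split=> // s _; exists (of_unit s); last exact: of_unitK.
    by rewrite /= in_itv; exact: of_unit_itv.
  apply: connected_continuous_connected; first exact: segment_connected.
  by apply: continuous_subspaceT; exact: continuous_to_unit.
have PT : P = setT.
  apply: cT; first by exists zero.
  - exists P; last by rewrite setTI.
    by rewrite openE => s /oP.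
  - exists P; last by rewrite setTI.
    rewrite -[P]setCK; apply: open_closedC; rewrite openE => s /cP.
    exact.
by rewrite PT.
Qed.

(** Agreement is open because nearby fibres are separated, and closed because a positive distance
    persists. *)
Lemma unique_lift (k l : I -> Y) : continuous k -> continuous l ->
  (forall t, F (k t) = F (l t)) -> k zero = l zero -> forall t, k t = l t.
Proof.
move=> ck cl kl kl0; apply: (unit_interval_connected (P := fun t => k t = l t)) => //.
  move=> t klt; have [e e0 he] := fibre_separated (F (k t)).
  have t0 : 0 < e / 4 by rewrite divr_gt0.
  have h1 : \forall s \near t, d (k t) (k s) < e / 4 by exact: (ck t _ (near_d (k t) t0)).
  have h2 : \forall s \near t, d (l t) (l s) < e / 4 by exact: (cl t _ (near_d (l t) t0)).
  have h3 : \forall s \near t, forall y z, F y = F (k s) -> F z = F (k s) ->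
      d y z < e -> y = z.
    exact: (ck t _ (cF he)).
  apply: (@filterS3 _ _ (nbhs_filter t) _ _ _ _ _ h3 h1 h2) => s hs k1 l1.
  apply: hs => //; rewrite -klt in l1.
  have := d_triangle (k s) (k t) (l s); rewrite (dC (k s) (k t)); lra.
move=> t klt.
have d0 : 0 < d (k t) (l t).
  rewrite lt_def; apply/andP; split; first by apply/eqP => /d_eq0.
  by have := d_triangle (k t) (l t) (k t); rewrite dxx (dC (l t)); lra.
have t0 : 0 < d (k t) (l t) / 4 by rewrite divr_gt0.
have h1 : \forall s \near t, d (k t) (k s) < d (k t) (l t) / 4.
  exact: (ck t _ (near_d (k t) t0)).
have h2 : \forall s \near t, d (l t) (l s) < d (k t) (l t) / 4.
  exact: (cl t _ (near_d (l t) t0)).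
apply: (@filterS2 _ _ (nbhs_filter t) _ _ _ _ h1 h2) => s k1 l1 kls.
rewrite kls in k1; have := d_triangle (k t) (l s) (l t); rewrite (dC (l s) (l t)); lra.
Qed.

End Covering.

(** * The exact sequence *)

Section CosineCovering.
Variables (R : realType) (n : nat) (Phi : {fset 'rV[R]_n}).
Variables (phi : 'rV[R]_n -> R) (alpha omega : 'I_n -> 'rV[R]_n).
Hypothesis rb : root_basis Phi phi alpha omega.
Local Notation C := R[i].
Local Notation Y := (regular_points Phi).
Local Notation X := (regular_values Phi omega).
Local Notation I := (unit_interval R).
Local Notation cosine := (generalized_cosine Phi omega).
Local Notation AW := (affine_weyl_group Phi).

Lemma nbhs_initial (S : choiceType) (T : topologicalType) (f : S -> T)
    (y : initial_topology f) (U : set (initial_topology f)) :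
  nbhs y U <-> exists2 V, nbhs (f y) V & forall z, V (f z) -> U z.
Proof.
split=> [yU|[V fV VU]].
  rewrite nbhsE in yU; case: yU => [B [[A oA <-] Ay] BU].
  by exists A; [exact: open_nbhs_nbhs | move=> z; exact: BU].
move: fV; rewrite nbhsE => -[A [oA Ay] AV].
rewrite nbhsE; exists (f @^-1` A); first by split=> //; exists A.
by move=> z Az; apply/VU/AV.
Qed.

(** A point of the diagram with the same image would be in the orbit of [y], and the group preserves
    regular points. *)
Lemma regular_valueP (y : Y) : cosine (val y) \in X.
Proof.
apply/mem_set => -[z hz e]; have [g gz] := cosine_fibre rb e.
by have := @regular_affine _ _ _ _ _ _ rb g _ (set_mem (valP y)); rewrite gz.
Qed.

Definition cosine_map (y : Y) : X := exist _ (cosine (val y)) (regular_valueP y).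

Lemma affine_actP (g : AW) (y : Y) : val g (val y) \in Y.
Proof. exact/mem_set/(regular_affine rb)/set_mem/(valP y). Qed.

Definition affine_act (g : AW) (y : Y) : Y := exist _ (val g (val y)) (affine_actP g y).

Definition ydist (y z : Y) : R := nrm2 (val z - val y).

Lemma nbhs_ydist (y : Y) (U : set Y) : nbhs y U <->
  exists2 e : R, 0 < e & forall z, ydist y z < e -> U z.
Proof.
split=> [/nbhs_initial[V /nbhs_nrm2[e e0 eV] VU]|[e e0 eU]].
  by exists e => // z yz; apply/VU/eV.
apply/nbhs_initial; exists [set x | nrm2 (x - val y) < e]; first exact: near_nrm2.
by move=> z; exact: eU.
Qed.

Lemma continuous_cosine_map : continuous cosine_map.
Proof.
apply: continuous_comp_initial; rewrite /comp /=.
apply: (@continuous_compT Y 'rV[C]_n 'rV[C]_n val cosine); last exact: (continuous_cosine rb).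
exact: initial_continuous.
Qed.

Lemma continuous_affine_action g : continuous (affine_act g).
Proof.
apply: continuous_comp_initial.
apply: (@continuous_compT Y 'rV[C]_n 'rV[C]_n val (val g)); last exact: (continuous_affine_act rb).
exact: initial_continuous.
Qed.

Lemma ydist_eq0 y z : ydist y z = 0 -> y = z.
Proof. by move=> /nrm2_eq0 /subr0_eq e; apply: val_inj. Qed.

Lemma ydistxx y : ydist y y = 0.
Proof. by rewrite /ydist subrr /nrm2 -(subrr 0) rpartD rpartN ipartD ipartN !subrr !dot0l addr0. Qed.

Lemma ydistC y z : ydist y z = ydist z y.
Proof. by rewrite /ydist -nrm2N opprB. Qed.

Lemma ydist_triangle x y z : ydist x z <= 2 * (ydist x y + ydist y z).
Proof.
rewrite /ydist -[val z - val x](subrK (val y - val x)) addrC.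
have -> : val z - val x - (val y - val x) = val z - val y.
  by rewrite opprB addrA subrK.
exact: nrm2D.
Qed.

Lemma ydist_act g y z : ydist (affine_act g y) (affine_act g z) = ydist y z.
Proof. exact: (affine_nrm2 rb). Qed.

Lemma cosine_map_act g y : cosine_map (affine_act g y) = cosine_map y.
Proof. by apply: val_inj; rewrite /= (cosine_affine rb). Qed.

Lemma cosine_map_fibre y z : cosine_map y = cosine_map z ->
  exists g, affine_act g y = z.
Proof.
move=> /(congr1 val)/= e; have [g gz] := cosine_fibre rb (esym e).
by exists g; apply: val_inj.
Qed.

Lemma cosine_regular x : cosine x \in X -> x \in Y.
Proof. by move=> /set_mem h; apply/mem_set => hx; apply: h; exists x. Qed.

Lemma cosine_map_onto x : exists y, cosine_map y = x.
Proof.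
have [y yx] := cosine_onto rb (val x).
have yY : y \in Y by apply: cosine_regular; rewrite yx; exact: valP.
by exists (exist _ y yY); apply: val_inj.
Qed.

Lemma cosine_map_open (y : Y) (U : set Y) : nbhs y U ->
  nbhs (cosine_map y) (cosine_map @` U).
Proof.
move=> /nbhs_initial[V yV VU]; apply/nbhs_initial.
exists [set c | exists2 x, V x & cosine x = c]; first exact: (cosine_open rb).
move=> z [x Vx xz].
have xY : x \in Y by apply: cosine_regular; rewrite xz; exact: valP.
by exists (exist _ x xY); [exact: VU | exact: val_inj].
Qed.

Lemma affine_act_free y : exists2 e : R, 0 < e &
  forall g, ydist (affine_act g y) y < e -> forall z, affine_act g z = z.
Proof.
have [e e0 he] := regular_separated rb (set_mem (valP y)).
exists e => // g; rewrite ydistC => /he -> z; exact: val_inj.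
Qed.

Lemma affine_act_inj g h y : affine_act g y = affine_act h y -> g = h.
Proof.
move=> /(congr1 val)/= e.
have : (h^-1 * g)%g = 1%g :> AW.
  apply: (regular_free rb (set_mem (valP y))).
  rewrite -[LHS]/(bij_inv (val h) (val g (val y))) e; exact: (bij_funK (val h)).
by move=> /(congr1 (fun k => h * k)%g); rewrite mulgA mulgV mul1g mulg1.
Qed.

Lemma affine_actM g h y : affine_act (g * h)%g y = affine_act g (affine_act h y).
Proof. exact: val_inj. Qed.

Lemma continuous_slicel (s : I) : continuous (fun t : I => (t, s)).
Proof.
apply: (continuous_pairT (f := id) (g := fun=> s)); last exact: continuous_const.
by move=> t; exact: cvg_id.
Qed.

Lemma continuous_slicer (t : I) : continuous (fun s : I => (t, s)).
Proof.
apply: (continuous_pairT (f := fun=> t) (g := id)); first exact: continuous_const.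
by move=> s; exact: cvg_id.
Qed.

Lemma path_lift (c : I -> X) (y : Y) : continuous c -> c zero = cosine_map y ->
  exists l : I -> Y, [/\ continuous l, l zero = y & forall t, cosine_map (l t) = c t].
Proof.
move=> cc c0; pose H (p : I * I) := c p.1.
have cH : continuous H.
  by apply: continuous_compT cc => p; exact: cvg_fst.
have [L [cL LE L0]] := lift_square ydist_eq0 ydistxx ydistC ydist_triangle
  nbhs_ydist ydist_act cosine_map_act cosine_map_fibre cosine_map_open
  cosine_map_onto affine_act_free cH (fun=> c0).
exists (fun t => L (t, zero)); split=> [|//|t]; last exact: LE.
apply: (continuous_compT (f := fun t : I => (t, zero : I)) _ cL).
exact: continuous_slicel.
Qed.

Lemma lift_unique (k l : I -> Y) : continuous k -> continuous l ->
  (forall t, cosine_map (k t) = cosine_map (l t)) -> k zero = l zero -> k =1 l.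
Proof.
exact: (unique_lift continuous_cosine_map ydist_eq0 ydistxx ydistC ydist_triangle
  nbhs_ydist ydist_act cosine_map_act cosine_map_fibre cosine_map_open
  cosine_map_onto affine_act_free).
Qed.

Lemma homotopy_lift (y : Y) (x : X) (c c' : {path I from cosine_map y to x})
    (l l' : I -> Y) :
  homotopic c c' -> continuous l -> continuous l' -> l zero = y -> l' zero = y ->
  (forall t, cosine_map (l t) = c t) -> (forall t, cosine_map (l' t) = c' t) ->
  exists L : I * I -> Y, [/\ continuous L, forall t, L (t, zero) = l t,
    forall t, L (t, one) = l' t, forall s, L (zero, s) = y &
    forall s, L (one, s) = l one].
Proof.
move=> [H [cH H0 H1 Hx Hy]] cl cl' l0 l'0 lE l'E.
have [L [cL LE L0]] := lift_square ydist_eq0 ydistxx ydistC ydist_triangle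
  nbhs_ydist ydist_act cosine_map_act cosine_map_fibre cosine_map_open
  cosine_map_onto affine_act_free cH Hx.
have ch s : continuous (fun t => L (t, s)).
  apply: (continuous_compT (f := fun t : I => (t, s : I)) _ cL).
  exact: continuous_slicel.
have cv t : continuous (fun s => L (t, s)).
  apply: (continuous_compT (f := fun s : I => (t : I, s)) _ cL).
  exact: continuous_slicer.
have Ll t : L (t, zero) = l t.
  by apply: (lift_unique (ch zero) cl) => [u|]; rewrite ?LE ?H0 ?lE ?L0 ?l0.
exists L; split=> // [t|s].
  by apply: (lift_unique (ch one) cl') => [u|]; rewrite ?LE ?H1 ?l'E ?L0 ?l'0.
(* The end points trace a lift of a constant path, so they do not move. *)
rewrite -Ll; apply: (lift_unique (l := fun=> L (one, zero)) (cv one)) => // [|u].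
  exact: continuous_const.
by rewrite !LE !Hy.
Qed.

(* The segment from y to g y is bent along u + i s u (1 - u): each of the countably
   many hyperplanes is met for at most one s. *)
Lemma connected_regular (g : AW) (y : Y) :
  exists l : I -> Y, [/\ continuous l, l zero = y & l one = affine_act g y].
Proof.
pose dl := val g (val y) - val y.
pose xt (s u : R) : 'rV[C]_n := val y + Complex u (s * (u * (1 - u))) *: dl.
have xt0 s : xt s 0 = val y by rewrite /xt mul0r mulr0 scale0r addr0.
have xt1 s : xt s 1 = val g (val y).
  by rewrite /xt subrr mulr0 mulr0 -[Complex 1 0]/(1 : C) scale1r addrC subrK.
pose bad (vl : Phi * int) (s : R) :=
  exists2 u, 0 <= u <= 1 & cdot (cvec (val vl.1)) (xt s u) = (vl.2%:~R)%:C%C.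
have yP := set_mem (valP y); have gyP := set_mem (affine_actP g y).
have notY (z : 'rV[C]_n) (v : Phi) (l : int) :
    regular_points Phi z -> cdot (cvec (val v)) z <> (l%:~R)%:C%C.
  by move=> hz e; apply: hz; exists (val v); [exact: valP | exists l].
(* The pairing of the root with [dl] is non-zero, or [y] would be on the hyperplane; so the complex
   coefficient of [dl] is determined. Its real part is [u], which is neither 0 nor 1 as both ends
   are regular, and then its imaginary part determines [s]. *)
have bad1 vl s s' : bad vl s -> bad vl s' -> s = s'.
  case: vl => v l [u u01 e] [u' u'01 e']; rewrite /= in e e'.
  have B0 : cdot (cvec (val v)) dl != 0.
    apply/eqP => B0; apply: (notY (val y) v l yP).
    by rewrite -e /xt cdotDr cdotZr B0 mulr0 addr0.
  have : Complex u (s * (u * (1 - u))) = Complex u' (s' * (u' * (1 - u'))).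
    apply: (mulIf B0); apply: (addrI (cdot (cvec (val v)) (val y))).
    by rewrite -!cdotZr -!cdotDr -/(xt s u) -/(xt s' u') e e'.
  case=> uu'; rewrite -{}uu' in e' *; apply: mulIf; rewrite mulf_neq0 //.
    by apply/eqP => u0; apply: (notY (val y) v l yP); rewrite -e u0 xt0.
  rewrite subr_eq0; apply/eqP => u1; apply: (notY _ v l gyP).
  by rewrite -e -u1 xt1.
have [s hs] : exists s : R, forall vl, ~ bad vl s.
  (* If every [s] were bad, the reals would be countable, against the Lebesgue measure of [0, 1]. *)
  apply: contrapT => nex.
  pose h (vl : Phi * int) : R := xget 0 (bad vl).
  have : countable [set: R].
    apply: (@sub_countable _ _ _ (h @` setT)); last first.
      by apply: sub_countable (card_image_le _ _) _; exact: countableP.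
    apply: subset_card_le => s _.
    have [vl bs] : exists vl, bad vl s.
      by apply: contrapT => nb; apply: nex; exists s => vl bs; apply: nb; exists vl.
    exists vl => //; rewrite /h; case: xgetP => [s' _ bs'|/(_ s)//].
    exact: bad1 bs' bs.
  move=> cR; have c01 : countable (`[0, 1]%classic : set R).
    by apply: sub_countable cR; exact: subset_card_le.
  have := countable_lebesgue_measure0 c01.
  rewrite lebesgue_measure_itv /= lte_fin ltr01 -EFinB subr0 => /eqP.
  by rewrite eqe oner_eq0.
have xtY (t : I) : xt s (of_unit t) \in Y.
  apply/mem_set => -[v /= vP [l _ e]]; apply: (hs ([` vP]%fset, l)).
  by exists (of_unit t); first exact: of_unit_itv.
exists (fun t => exist _ (xt s (of_unit t)) (xtY t)); split.
- apply: continuous_comp_initial.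
  have cu := @continuous_of_unit R.
  have cuu : continuous (fun t : I => s * (of_unit t * (1 - of_unit t))).
    by apply: continuousZ_real; apply: continuousM_real => //; exact: continuous_revarg.
  have cZ (a : R) (f : I -> R) : continuous f -> continuous (fun t => f t * a).
    by move=> cf; apply: continuousM_real => //; exact: continuous_const.
  apply: continuous_rV => j.
    rewrite (_ : (fun _ => _) = fun t : I => complex.Re (val y 0 j) +
       (of_unit t * complex.Re (dl 0 j) - s * (of_unit t * (1 - of_unit t)) * complex.Im (dl 0 j))).
      apply: continuousD_real; first exact: continuous_const.
      by apply: continuousB_real; exact: cZ.
    apply/funext => t; rewrite /= !mxE.
    by case: (val g (val y) 0 j - val y 0 j) => a b; rewrite raddfD.
  rewrite (_ : (fun _ => _) = fun t : I => complex.Im (val y 0 j) +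
     (of_unit t * complex.Im (dl 0 j) + s * (of_unit t * (1 - of_unit t)) * complex.Re (dl 0 j))).
    apply: continuousD_real; first exact: continuous_const.
    by apply: continuousD_real; exact: cZ.
  apply/funext => t; rewrite /= !mxE.
  by case: (val g (val y) 0 j - val y 0 j) => a b; rewrite raddfD.
- by apply: val_inj; rewrite /= of_unit0 xt0.
- by apply: val_inj; rewrite /= of_unit1 xt1.
Qed.

End CosineCovering.

(** * The monodromy homomorphism and exactness *)

Section Monodromy.
Variables (R : realType) (n : nat) (Phi : {fset 'rV[R]_n}).
Variables (phi : 'rV[R]_n -> R) (alpha omega : 'I_n -> 'rV[R]_n).
Hypothesis rb : root_basis Phi phi alpha omega.
Variable y0 : regular_points Phi.
Local Notation Y := (regular_points Phi).
Local Notation X := (regular_values Phi omega).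
Local Notation I := (unit_interval R).
Local Notation AW := (affine_weyl_group Phi).

Definition cosine_cts : continuousType Y X :=
  HB.pack (cosine_map rb) (isContinuous.Build Y X (cosine_map rb) (@continuous_cosine_map _ _ _ _ _ _ rb)).
Local Notation F := cosine_cts.
Local Notation loop := {path I from F y0 to F y0}.

(** A relation on loops; [has_lift_ex] and [has_lift_homotopic] turn it into a function of the
    homotopy class. *)
Definition has_lift (g : AW) (c : loop) : Prop :=
  exists l : {path I from y0 to affine_act rb g y0}, forall t, F (l t) = c t.

Lemma continuous_path (T : topologicalType) (x y : T) (c : {path I from x to y}) :
  continuous c.
Proof. by move=> t; exact: cts_fun. Qed.

Lemma has_lift_ex (c : loop) : exists g, has_lift g c.
Proof.
have [l [cl l0 lE]] := path_lift (continuous_path (c := c)) (path_zero (s := c)).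
have [g gE] : exists g, affine_act rb g y0 = l one.
  apply: (cosine_map_fibre (rb := rb)); rewrite (lE one).
  exact/esym/(path_one (s := c)).
by exists g, (mk_path cl l0 (esym gE)).
Qed.

Lemma has_lift_homotopic (c c' : loop) g g' :
  homotopic c c' -> has_lift g c -> has_lift g' c' -> g = g'.
Proof.
move=> cc' [l lE] [l' l'E].
have [L [_ L0 L1 _ Le]] := homotopy_lift cc' (continuous_path (c := l))
  (continuous_path (c := l')) (path_zero (s := l)) (path_zero (s := l')) lE l'E.
apply: (affine_act_inj (rb := rb) (y := y0)).
by rewrite -(path_one (s := l)) -(path_one (s := l')) -L1 Le.
Qed.

(** The lift of [d] from the translate of [y0] by [g] is the translate of [k]. It ends at g (h y0),
    so products come in the order of concatenation. *)
Lemma has_lift_cat g h (c d : loop) :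
  has_lift g c -> has_lift h d -> has_lift (g * h)%g (path_cat c d).
Proof.
move=> [l lE] [k kE].
have ck : continuous (affine_act rb g \o k).
  exact: continuous_compT (continuous_path (c := k)) (continuous_affine_action (g := g)).
have k0 : (affine_act rb g \o k) zero = affine_act rb g y0.
  by rewrite /= (path_zero (s := k)).
have k1 : (affine_act rb g \o k) one = affine_act rb (g * h)%g y0.
  by rewrite /= (path_one (s := k)) -affine_actM.
exists (path_cat l (mk_path ck k0 k1)) => t; rewrite !path_catE.
case: ifP => _; first exact: lE.
by rewrite -kE; exact: cosine_map_act.
Qed.

Lemma monodromy_ex : exists p : pi1 R (F y0) -> AW,
  forall c, has_lift (p (pi1_class c)) c.
Proof.
have /choice[p pP] : forall a : pi1 R (F y0), exists g, forall c, pi1_class c = a -> has_lift g c.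
  elim/pi1_ind => c; have [g gc] := has_lift_ex c.
  exists g => c' /esym/pi1_classP cc'; have [g' gc'] := has_lift_ex c'.
  by rewrite (has_lift_homotopic cc' gc gc').
by exists p => c; exact: pP.
Qed.

Lemma affine_act1 y : affine_act rb 1%g y = y.
Proof. exact: val_inj. Qed.

Lemma affine_actK g : cancel (affine_act rb g) (affine_act rb g^-1%g).
Proof. by move=> y; rewrite -affine_actM mulVg affine_act1. Qed.

Lemma affine_actVK g : cancel (affine_act rb g^-1%g) (affine_act rb g).
Proof. by move=> y; rewrite -affine_actM mulgV affine_act1. Qed.

Definition deck g : bijection Y := Bijection (@affine_actK g) (@affine_actVK g).

Lemma deckP g : deck_transformation F (deck g).
Proof.
split; [exact: continuous_affine_action | exact: continuous_affine_action |].
exact: cosine_map_act.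
Qed.

Lemma homotopic_cosine (l l' : {path I from y0 to y0}) :
  homotopic (path_image F l) (path_image F l') -> homotopic l l'.
Proof.
move=> h.
have [L [cL L0 L1 Lx Le]] := homotopy_lift h (continuous_path (c := l))
  (continuous_path (c := l')) (path_zero (s := l)) (path_zero (s := l'))
  (fun t => erefl) (fun t => erefl).
by exists L; split=> // s; rewrite Le (path_one (s := l)).
Qed.

Lemma monodromy_exact : exists p : {multiplicative pi1 R (F y0) -> AW},
  canonical_projection p /\ short_exact (pi1_map R F y0) p.
Proof.
have [p pP] := monodromy_ex.
have pU c g : has_lift g c -> p (pi1_class c) = g.
  exact: has_lift_homotopic (homotopic_refl c) (pP c).
have pM : {morph p : c d / (c * d)%g}.
  elim/pi1_ind => c; elim/pi1_ind => d.
  rewrite -[(_ * _)%g]/(pi1_mul (pi1_class c) (pi1_class d)) pi1_mulE.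
  by apply: pU; exact: has_lift_cat.
pose q : {multiplicative pi1 R (F y0) -> AW} :=
  HB.pack p (isMultiplicative.Build (pi1 R (F y0)) AW p pM).
exists q; split=> [c|].
  exists (deck (p (pi1_class c))); split=> //; first exact: deckP.
  exact: pP.
split.
- elim/pi1_ind => l; elim/pi1_ind => l' /=; rewrite !pi1_mapE => /pi1_classP h.
  exact/pi1_classP/homotopic_cosine.
- elim/pi1_ind => c; split=> [c1|[a]].
    (* With trivial projection the lift returns to [y0], so it is a loop with image [c]. *)
    have [l lE] := pP c; rewrite [p _]c1 in l lE *.
    have l1 : l one = y0 by rewrite (path_one (s := l)) affine_act1.
    exists (pi1_class (mk_path (continuous_path (c := l)) (path_zero (s := l)) l1)).
    rewrite /= pi1_mapE; congr pi1_class; apply/path_eqP => t; exact: lE.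
  elim/pi1_ind: a => l <-; rewrite /= pi1_mapE; apply: pU.
  have l1 : l one = affine_act rb 1%g y0 by rewrite affine_act1 (path_one (s := l)).
  by exists (mk_path (continuous_path (c := l)) (path_zero (s := l)) l1).
(* A path from [y0] to its translate by [g] maps to a loop, whose lift is that path. *)
- move=> g; have [l [cl l0 l1]] := connected_regular rb g y0.
  have cF : continuous (F \o l) by exact: continuous_compT cl (@continuous_cosine_map _ _ _ _ _ _ rb).
  have F0 : (F \o l) zero = F y0 by rewrite /= l0.
  have F1 : (F \o l) one = F y0 by rewrite /= l1; exact: cosine_map_act.
  exists (pi1_class (mk_path cF F0 F1)); apply: pU.
  by exists (mk_path cl l0 l1).
Qed.

End Monodromy.

Theorem corollary2p8 (R : realType) (n : nat) (Phi : {fset 'rV[R]_n})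
    (omega : 'I_n -> 'rV[R]_n) (y0 : regular_points Phi) :
  root_system Phi -> fundamental_weights Phi omega ->
  exists F : continuousType (regular_points Phi) (regular_values Phi omega),
    (forall y, val (F y) = generalized_cosine Phi omega (val y)) /\
    exists p : {multiplicative pi1 R (F y0) -> affine_weyl_group Phi},
      canonical_projection p /\ short_exact (pi1_map R F y0) p.
Proof.
move=> rs [phi [alpha [phi_reg _ simpleP dual]]].
have rb : root_basis Phi phi alpha omega.
  by split=> // *; rewrite ?linearD ?linearZ.
by exists (cosine_cts rb); split=> //; exact: monodromy_exact.
Qed.
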